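(* Up to multiplication by a scalar independent of $r$, the transformations $\eta$ and $\eta'$ are defined over $F^{ab}$. That is: there exist nonzero complex numbers $c,c'$, independent of $r$, such that for every integer $r\ge1$ the map $c\,\eta: H^0(\mathcal E,\mathcal L_r)\to H^1(\mathcal E',\mathcal L'_{-r})$ and the map $c'\,\eta':H^0(\mathcal E',\mathcal L'_r)\to H^1(\mathcal E,\mathcal L_{-r})$ send $F^{ab}$-rational sections to $F^{ab}$-rational cohomology classes.
   Context: **Boundary data.** $F\subset\mathbb C$ is an imaginary quadratic field, $F^{ab}\subset\mathbb C$ its maximal abelian extension, $G=SU(2,1)$ the special unitary group of the hermitian form $H(x,y,t)=-x\bar t+y\bar y-\bar xt$ on $F^3$, $\Gamma\subset G$ a sufficiently small congruence subgroup, and $$V=\Big\{\begin{pmatrix}1&\alpha&\beta\\0&1&\bar\alpha\\0&0&1\end{pmatrix}:\alpha,\beta\in F,\ \beta+\bar\beta=\alpha\bar\alpha\Big\}\subset G .$$ $\beta_0$ is the element of smallest positive imaginary part among the purely imaginary $\beta$ with $\begin{pmatrix}1&0&\beta\\0&1&0\\0&0&1\end{pmatrix}\in\Gamma$. $\mathcal R\subset F$ is the lattice of all $\alpha$ for which some $\beta$ gives a matrix $(\alpha,\beta)$ in $\Gamma\cap V$; $\beta$ is determined by $\alpha$ modulo $\mathbb Z\beta_0$. $\mathcal E=\mathbb C/\overline{\mathcal R}$ and $\mathcal E'=\mathbb C/\mathcal R$ are elliptic curves with complex multiplication. For $r\in\mathbb Z$, $\mathcal L_r$ is the line bundle on $\mathcal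 E$ whose sections are functions with $g(y+\bar\alpha)=g(y)\exp\big(\tfrac{2\pi i r}{\beta_0}(\alpha y+\beta)\big)$, and $\mathcal L'_r$ the line bundle on $\mathcal E'$ whose sections are functions with $g'(v+\alpha)=g'(v)\exp\big(\tfrac{2\pi ir}{\beta_0}(\bar\alpha v+\beta)\big)$, for all $(\alpha,\beta)\in\Gamma\cap V$. **The transformations.** (Eastwood–Gindikin–Wong) If $\pi:X\to M$ is a holomorphic fibration with contractible fibres and $X$ Stein, and $\mathcal F$ is a holomorphic vector bundle on $M$, then $H^q(M,\mathcal F)\simeq H^q(\Gamma(X,\Omega^\bullet_\pi(\mathcal F)))$, the cohomology of the complex of global $\pi$-relative holomorphic forms with values in $\pi^*\mathcal F$. Let $\mathbf W=\mathcal R\backslash(\mathbb C\times\mathbb C)$, $\alpha\in\mathcal R$ acting by $(z,z')\mapsto(z+\bar\alpha,z'-\alpha)$, a Stein manifold, with projections $\pi_1:\mathbf W\to\mathcal E$, $\pi_2:\mathbf W\to\mathcal E'$ with contractible fibres. For $r\ge1$, $\eta'(\phi')\in H^1(\mathcal E,\mathcal L_{-r})$ is the class of the $\pi_1$-relative form $\phi'(z')\exp(\tfrac{2\pi ir}{\beta_0}zz')\,dz'$, and $\eta(\phi)\in H^1(\mathcal E',\mathcal L'_{-r})$ is the class of the $\pi_2$-relative form $\phi(z)\exp(\tfrac{2\pi ir}{\beta_0}zz')\,dz$. In Dolbeault cohomology these are $-\phi'(-\bar z)\exp(-\tfrac{2\pi ir}{\beta_0}z\bar z)\,d\bar z$ and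 $-\phi(-\bar z')\exp(-\tfrac{2\pi ir}{\beta_0}z'\bar z')\,d\bar z'$ respectively. **$F^{ab}$-rationality.** The curves and line bundles above have $F^{ab}$-structures (Shimura). Let $M=\overline{\mathcal R}$ (for $\mathcal E,\mathcal L_r$) or $M=\mathcal R$ (for $\mathcal E',\mathcal L'_r$), $r\ge1$, $\lambda=ir/\beta_0>0$. Sections of the bundle are functions with $f(u+m)=f(u)\psi(m)\exp(2\pi\lambda\bar m u+\pi\lambda|m|^2)$, $m\in M$, where $\psi(\bar\alpha)$ (resp. $\psi(\alpha)$) equals $\exp(2\pi ir\,\mathrm{Im}\,\beta/\mathrm{Im}\,\beta_0)$, a root of unity. Let $(\omega_1,\omega_2)$ be a basis of $M$ with $\tau=\omega_1/\omega_2$ in the upper half plane (chosen independently of $r$), $\mu=2\lambda|\omega_2|^2\,\mathrm{Im}\,\tau$ (a positive integer), $\rho,s\in\mathbb Q$ with $\psi(\omega_2)=e^{2\pi i\mu\rho}$, $\psi(\omega_1)=e^{-2\pi is}$, and $$f_{\rho,s}(u)=\exp\Big(\tfrac{\pi\mu}{2\,\mathrm{Im}\,\tau}\,\omega_2^{-2}u^2\Big)\sum_{n\in\mathbb Z}\exp\big(\pi i(n+\rho)^2\mu\tau+2\pi i(n+\rho)(\mu\omega_2^{-1}u+s)\big).$$ The $F^{ab}$-rational sections are the $F^{ab}$-span of the functions $h(\tau)^{-1}f_{\rho+j,s}$, $j\in\mu^{-1}\mathbb Z/\mathbb Z$ (a $\mathbb C$-basis of the space of sections), where $h$ is a modular form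 of weight $1/2$ with Fourier coefficients in $\mathbb Q^{ab}$ and $h(\tau)\ne0$, chosen independently of $r$ (the choice is immaterial). The $F^{ab}$-model of the curve is the one whose rational functions are the quotients of $F^{ab}$-rational sections. A class in $H^1$ of the dual bundle ($\mathcal L_{-r}$, resp. $\mathcal L'_{-r}$) is $F^{ab}$-rational if it comes from the $F^{ab}$-structure on the curve and bundle, i.e. if its Serre-duality pairing with every $F^{ab}$-rational section of $\mathcal L_r$ (resp. $\mathcal L'_r$) times an $F^{ab}$-rational invariant differential lies in $F^{ab}$ (Serre's trace being $\frac1{2\pi i}\int$ in Dolbeault cohomology). *)

(* Defs.v *)
From HB Require Import structures.
From mathcomp Require Import all_boot all_order all_algebra all_fingroup
  all_solvable all_field.
From mathcomp Require Import all_classical all_reals all_analysis.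
From mathcomp Require Import complex.

Set Implicit Arguments.
Unset Strict Implicit.
Unset Printing Implicit Defensive.

Import Order.TTheory GRing.Theory Num.Theory numFieldNormedType.Exports.

Local Open Scope classical_set_scope.
Local Open Scope ring_scope.
Local Open Scope complex_scope.

(* Real-valued real and imaginary parts. *)
Local Notation Re := complex.Re.
Local Notation Im := complex.Im.

(** * Fields *)

(* A number field is given with its complex embedding [iota]; the subfield of
   the complex numbers meant in the text is [range iota]. *)
Definition imaginary_quadratic (R : realType) (F : fieldExtType rat)
    (iota : {rmorphism F -> R[i]}) : Prop :=
  \dim {:F} = 2%N /\ exists x, Im (iota x) != 0.

(* K^ab: the union of the finite abelian extensions of K inside the complex
   numbers. *)
Definition max_abelian (R : realType) (K : fieldType)
    (iota : {rmorphism K -> R[i]}) : set R[i] :=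
  [set x | exists (L : splittingFieldType K) (j : {rmorphism L -> R[i]}),
    [/\ forall a : K, j a%:A = iota a,
        galois 1 {:L},
        abelian 'Gal({:L} / 1)
      & range j x]].

Definition Qab (R : realType) : set R[i] :=
  max_abelian (ratr : {rmorphism rat -> R[i]}).

(** * The group SU(2,1), congruence subgroups and their boundary data *)

Definition herm (R : realType) (v : 'cV[R[i]]_3) : R[i] :=
  let x := v 0 0 in let y := v 1 0 in let t := v (inord 2) 0 in
  - (x * t^*) + y * y^* - x^* * t.

Definition SU21 (R : realType) (F : fieldExtType rat)
    (iota : {rmorphism F -> R[i]}) : set 'M[R[i]]_3 :=
  [set g : 'M[R[i]]_3 | [/\ forall i j, range iota (g i j),
               \det g = 1
             & forall v : 'cV[R[i]]_3, (forall i, range iota (v i 0)) ->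
                 herm (g *m v) = herm v]].

Definition principal_congruence (R : realType) (F : fieldExtType rat)
    (iota : {rmorphism F -> R[i]}) (N : nat) : set 'M[R[i]]_3 :=
  [set g : 'M[R[i]]_3 | SU21 iota g /\
     forall i j, exists x : R[i],
       [/\ range iota x, integralOver (intr : int -> R[i]) x
         & g i j - (1%:M : 'M[R[i]]_3) i j = N%:R * x]].

Definition congruence_subgroup (R : realType) (F : fieldExtType rat)
    (iota : {rmorphism F -> R[i]}) (Gamma : set 'M[R[i]]_3) : Prop :=
  [/\ Gamma `<=` SU21 iota,
      Gamma 1%:M,
      forall g h, Gamma g -> Gamma h -> Gamma (g *m h),
      forall g, Gamma g -> Gamma (invmx g)
    & exists N : nat,
        [/\ (0 < N)%N,
            principal_congruence iota N `<=` Gamma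
          & exists s : seq 'M[R[i]]_3, forall g, Gamma g ->
              exists h k, [/\ h \in s, principal_congruence iota N k
                            & g = h *m k]]].

Definition unip (R : realType) (a b : R[i]) : 'M[R[i]]_3 :=
  \matrix_(i, j) (nth [::] [:: [:: 1; a; b];
                              [:: 0; 1; a^*];
                              [:: 0; 0; 1]] i)`_j.

Definition V (R : realType) (F : fieldExtType rat)
    (iota : {rmorphism F -> R[i]}) : set 'M[R[i]]_3 :=
  [set g : 'M[R[i]]_3 | exists a b : R[i],
     [/\ range iota a, range iota b, b + b^* = a * a^* & g = unip a b]].

Definition is_beta0 (R : realType) (Gamma : set 'M[R[i]]_3) (b0 : R[i]) : Prop :=
  [/\ Re b0 = 0, 0 < Im b0, Gamma (unip 0 b0)
    & forall b, Re b = 0 -> 0 < Im b -> Gamma (unip 0 b) -> Im b0 <= Im b].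

(* The two elliptic curves are treated uniformly.  A curve C/M with its line
   bundles is described by the set P of the pairs (m, beta), where m = alpha^*
   for E and m = alpha for E', (alpha, beta) running through Gamma :&: V.  The
   lattice M is the first projection of P, and both automorphy factors of the
   text read exp (2 pi i r / beta0 * (m^* u + beta)). *)
Definition pairs_E (R : realType) (F : fieldExtType rat)
    (iota : {rmorphism F -> R[i]}) (Gamma : set 'M[R[i]]_3) : set (R[i] * R[i]) :=
  [set p : R[i] * R[i] | (Gamma `&` V iota) (unip p.1^* p.2)].

Definition pairs_E' (R : realType) (F : fieldExtType rat)
    (iota : {rmorphism F -> R[i]}) (Gamma : set 'M[R[i]]_3) : set (R[i] * R[i]) :=
  [set p : R[i] * R[i] | (Gamma `&` V iota) (unip p.1 p.2)].

(** * Complex analysis *)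

Definition cexp (R : realType) (z : R[i]) : R[i] :=
  (expR (Re z))%:C * (cos (Im z) +i* sin (Im z)).

Definition pii (R : realType) : R[i] := (pi : R)%:C * 'i%C.
Arguments pii {R}.

(* Sum over the integers, as a limit of symmetric partial sums; it is only
   used for absolutely convergent series. *)
Definition zsum (R : realType) (a : int -> R[i]) : R[i] :=
  limn (fun N : nat => \sum_(0 <= k < N.*2.+1) a (k%:Z - N%:Z) : R[i]^o).

Definition holomorphic_at (R : realType) (f : R[i] -> R[i]) (z : R[i]) : Prop :=
  derivable (f : R[i]^o -> R[i]^o) z 1.

Definition cderive (R : realType) (f : R[i] -> R[i]) (z : R[i]) : R[i] :=
  derive1 (f : R[i]^o -> R[i]^o) z.

Fixpoint Ck (R : realType) (n : nat) (f : R -> R -> R) : Prop :=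
  continuous (fun p : R * R => f p.1 p.2) /\
  if n is m.+1 then
    [/\ forall x y, derivable (fun t => f t y) x 1,
        forall x y, derivable (fun t => f x t) y 1,
        Ck m (fun x y => derive1 (fun t => f t y) x)
      & Ck m (fun x y => derive1 (fun t => f x t) y)]
  else True.

Definition smooth (R : realType) (f : R[i] -> R[i]) : Prop :=
  forall n, Ck n (fun x y => Re (f (x +i* y))) /\
            Ck n (fun x y => Im (f (x +i* y))).

Definition dx (R : realType) (f : R[i] -> R[i]) (z : R[i]) : R[i] :=
  derive1 (fun t => Re (f (t +i* Im z))) (Re z) +i*
  derive1 (fun t => Im (f (t +i* Im z))) (Re z).

Definition dy (R : realType) (f : R[i] -> R[i]) (z : R[i]) : R[i] :=
  derive1 (fun t => Re (f (Re z +i* t))) (Im z) +i*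
  derive1 (fun t => Im (f (Re z +i* t))) (Im z).

Definition dbar (R : realType) (f : R[i] -> R[i]) (z : R[i]) : R[i] :=
  2^-1 * (dx f z + 'i%C * dy f z).

Definition integral01 (R : realType) (f : R -> R[i]) : R[i] :=
  (\int[lebesgue_measure]_(t in `[0%R, 1%R]) Re (f t)) +i*
  (\int[lebesgue_measure]_(t in `[0%R, 1%R]) Im (f t)).

(** * Line bundles on C/M and their cohomology *)

Definition automorphic (R : realType) (P : set (R[i] * R[i])) (b0 : R[i])
    (r : int) (g : R[i] -> R[i]) : Prop :=
  forall m b u, P (m, b) ->
    g (u + m) = g u * cexp (2 * pii * r%:~R / b0 * (m^* * u + b)).

Definition hol_sections (R : realType) (P : set (R[i] * R[i])) (b0 : R[i]) (r : int) :
    set (R[i] -> R[i]) :=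
  [set g | (forall u, holomorphic_at g u) /\ automorphic P b0 r g].

(* Smooth sections.  As the differential of conj(u) is invariant under
   translations, these are also the coefficients g of the smooth
   (0,1)-forms g d(conj u) with values in the bundle. *)
Definition smooth_section (R : realType) (P : set (R[i] * R[i])) (b0 : R[i])
    (r : int) : set (R[i] -> R[i]) :=
  [set g | smooth g /\ automorphic P b0 r g].

Definition dolbeault_class (R : realType) (P : set (R[i] * R[i])) (b0 : R[i])
    (r : int) (g : R[i] -> R[i]) : set (R[i] -> R[i]) :=
  [set g' | exists2 s, smooth_section P b0 r s &
              g' = (fun u => g u + dbar s u)].

Definition dolbeault_H1 (R : realType) (P : set (R[i] * R[i])) (b0 : R[i]) (r : int) :
    set (set (R[i] -> R[i])) :=
  [set X | exists2 g, smooth_section P b0 r g & X = dolbeault_class P b0 r g].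

Definition scale_class (R : realType) (c : R[i]) (X : set (R[i] -> R[i])) :
    set (R[i] -> R[i]) :=
  [set (fun u => c * g u) | g in X].

(** * The transformations *)

(* Coefficients of dz, resp. dz', in the relative forms on
   W = R \ (C x C). *)
Definition eta_form (R : realType) (b0 : R[i]) (r : int) (phi : R[i] -> R[i])
    (z z' : R[i]) : R[i] :=
  phi z * cexp (2 * pii * r%:~R / b0 * z * z').

Definition eta'_form (R : realType) (b0 : R[i]) (r : int) (phi' : R[i] -> R[i])
    (z z' : R[i]) : R[i] :=
  phi' z' * cexp (2 * pii * r%:~R / b0 * z * z').

(* The isomorphism from the cohomology of relative forms to Dolbeault
   cohomology is the pull-back along a smooth section of the fibration: the
   section z' |-> (- conj z', z') of pi_2 sends omega dz to
   - omega (- conj z', z') d(conj z'), and symmetrically for pi_1. *)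
Definition dolbeault2 (R : realType) (omega : R[i] -> R[i] -> R[i])
    (z' : R[i]) : R[i] := - omega (- z'^*) z'.

Definition dolbeault1 (R : realType) (omega : R[i] -> R[i] -> R[i])
    (z : R[i]) : R[i] := - omega z (- z^*).

(* [P] is [pairs_E'] for eta and [pairs_E] for eta'. *)
Definition eta_map (R : realType) (P : set (R[i] * R[i])) (b0 : R[i]) (r : int)
    (phi : R[i] -> R[i]) : set (R[i] -> R[i]) :=
  dolbeault_class P b0 (- r) (dolbeault2 (eta_form b0 r phi)).

Definition eta'_map (R : realType) (P : set (R[i] * R[i])) (b0 : R[i]) (r : int)
    (phi' : R[i] -> R[i]) : set (R[i] -> R[i]) :=
  dolbeault_class P b0 (- r) (dolbeault1 (eta'_form b0 r phi')).

(** * Modular forms of weight 1/2 *)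

Definition theta_std (R : realType) (t : R[i]) : R[i] :=
  zsum (fun n => cexp (2 * pii * n%:~R ^+ 2 * t)).

Definition mobius (R : realType) (a b c d : int) (t : R[i]) : R[i] :=
  (a%:~R * t + b%:~R) / (c%:~R * t + d%:~R).

(* Weight 1/2 with respect to some Gamma(N), 4 | N, the factor of automorphy
   being that of [theta_std] (which has no zero in the upper half plane);
   holomorphy at the cusps is boundedness at i oo of all the transforms under
   SL_2(Z), in absolute value so as to avoid choosing square roots. *)
Definition modular_form_half_Qab (R : realType) (h : R[i] -> R[i]) : Prop :=
  (forall t, 0 < Im t -> holomorphic_at h t) /\
  exists N : nat,
    [/\ (0 < N)%N /\ (4 %| N)%N,
        (forall a b c d : int, a * d - b * c = 1 ->
          (a = 1 %[mod N])%Z -> (b = 0 %[mod N])%Z ->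
          (c = 0 %[mod N])%Z -> (d = 1 %[mod N])%Z ->
          forall t, 0 < Im t ->
            h (mobius a b c d t) * theta_std t =
            theta_std (mobius a b c d t) * h t),
        (forall a b c d : int, a * d - b * c = 1 ->
          exists B : R[i], forall t, 1 <= Im t ->
            `|h (mobius a b c d t)| ^+ 2 <= B * `|c%:~R * t + d%:~R|)
      & exists2 a : nat -> R[i], (forall n, Qab (a n)) &
          forall t, 0 < Im t ->
            series (fun n => a n * cexp (2 * pii * n%:R * t / N%:R) : R[i]^o)
              @ \oo --> (h t : R[i]^o)].

(** * Rationality over F^ab *)

(* The choices, independent of r, on which the rational structure is built. *)
Record frame (R : realType) := Frame {
  om1 : R[i];
  om2 : R[i];
  hform : R[i] -> R[i] }.

Definition tau (R : realType) (fr : frame R) : R[i] := om1 fr / om2 fr.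

Definition frame_of (R : realType) (P : set (R[i] * R[i])) (fr : frame R) : Prop :=
  [/\ forall m, (exists b, P (m, b)) <->
                (exists a b : int, m = a%:~R * om1 fr + b%:~R * om2 fr),
      0 < Im (tau fr),
      modular_form_half_Qab (hform fr)
    & hform fr (tau fr) != 0].

(* [psi_val P b0 r m z] is psi(m) = z. *)
Definition psi_val (R : realType) (P : set (R[i] * R[i])) (b0 : R[i]) (r : int)
    (m z : R[i]) : Prop :=
  exists2 b, P (m, b) & z = cexp (2 * pii * r%:~R * (Im b / Im b0)%:C).

(* f_{rho,s} *)
Definition theta_fun (R : realType) (fr : frame R) (mu : nat) (rho s u : R[i]) :
    R[i] :=
  cexp ((pi * mu%:R / (2 * Im (tau fr)))%:C * om2 fr ^- 2 * u ^+ 2) *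
  zsum (fun n : int =>
    cexp (pii * (n%:~R + rho) ^+ 2 * mu%:R * tau fr +
          2 * pii * (n%:~R + rho) * (mu%:R * (om2 fr)^-1 * u + s))).

Definition rational_section (R : realType) (F : fieldExtType rat)
    (iota : {rmorphism F -> R[i]}) (P : set (R[i] * R[i])) (b0 : R[i])
    (fr : frame R) (r : int) : set (R[i] -> R[i]) :=
  [set f | exists (mu : nat) (rho s : rat) (x : 'I_mu -> R[i]),
     let lambda := 'i%C * r%:~R / b0 in
     [/\ mu%:R = 2 * lambda * `|om2 fr| ^+ 2 * (Im (tau fr))%:C,
         psi_val P b0 r (om2 fr) (cexp (2 * pii * mu%:R * ratr rho)),
         psi_val P b0 r (om1 fr) (cexp (- (2 * pii * ratr s))),
         forall k, max_abelian iota (x k)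
       & f = (fun u => \sum_(k < mu) x k *
                ((hform fr (tau fr))^-1 *
                 theta_fun fr mu (ratr rho + k%:R / mu%:R) (ratr s) u))]].

(* Numerator and denominator of an F^ab-rational function on the curve. *)
Definition rational_quotient (R : realType) (F : fieldExtType rat)
    (iota : {rmorphism F -> R[i]}) (P : set (R[i] * R[i])) (b0 : R[i])
    (fr : frame R) (p q : R[i] -> R[i]) : Prop :=
  exists r : int,
    [/\ 1 <= r, rational_section iota P b0 fr r p,
        rational_section iota P b0 fr r q & exists u, q u != 0].

(* The invariant differential w du is F^ab-rational: it is of the form A dB,
   with A and B rational functions on the F^ab-model of the curve. *)
Definition rational_differential (R : realType) (F : fieldExtType rat)
    (iota : {rmorphism F -> R[i]}) (P : set (R[i] * R[i])) (b0 : R[i])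
    (fr : frame R) (w : R[i]) : Prop :=
  exists p q p' q' : R[i] -> R[i],
    [/\ rational_quotient iota P b0 fr p q,
        rational_quotient iota P b0 fr p' q'
      & forall u, q u != 0 -> q' u != 0 ->
          w = p u / q u * cderive (fun v => p' v / q' v) u].

(* 1/(2 pi i) times the integral over C/M of (g d(conj u)) /\ (f w du), where
   d(conj u) /\ du = 2 i dx dy and dx dy = Im (om1 conj(om2)) ds dt for
   u = s om1 + t om2. *)
Definition serre_pairing (R : realType) (fr : frame R) (w : R[i])
    (g f : R[i] -> R[i]) : R[i] :=
  (2 * pii)^-1 * (2 * 'i%C * (Im (om1 fr * (om2 fr)^*))%:C) *
  integral01 (fun s => integral01 (fun t =>
    let u := s%:C * om1 fr + t%:C * om2 fr in g u * (f u * w))).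

(* F^ab-rational classes in H^1 of the bundle of index - r.  The parameter w
   stands for a nonzero F^ab-rational invariant differential w du; these
   differentials form a line over F^ab and the rational sections an
   F^ab-space, so that the choice of w is immaterial. *)
Definition rational_class (R : realType) (F : fieldExtType rat)
    (iota : {rmorphism F -> R[i]}) (P : set (R[i] * R[i])) (b0 : R[i])
    (fr : frame R) (w : R[i]) (r : int) (X : set (R[i] -> R[i])) : Prop :=
  dolbeault_H1 P b0 (- r) X /\
  forall g f, X g -> rational_section iota P b0 fr r f ->
    max_abelian iota (serre_pairing fr w g f).

(* Main.v *)
Require Import Defs.
From HB Require Import structures.
From mathcomp Require Import all_boot all_order all_algebra all_fingroup
  all_solvable all_field.
From mathcomp Require Import all_classical all_reals all_analysis.
From mathcomp Require Import measurable_realfun complex ring lra zify.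
Set Implicit Arguments.
Unset Strict Implicit.
Unset Printing Implicit Defensive.
Import Order.TTheory GRing.Theory Num.Theory numFieldNormedType.Exports.
Local Open Scope classical_set_scope.
Local Open Scope ring_scope.
Local Open Scope complex_scope.
Local Notation Re := complex.Re.
Local Notation Im := complex.Im.
Local Notation nc := (@ComplexField.Normc.normc _).

(** Write lambda = i r / beta0 and let mu be the degree of the bundles.  The map
    u |-> - conj u carries the lattice of E' onto that of E, by an integral matrix
    of determinant -1 in positively oriented bases [basis_change].  The transform
    of a section phi of E is represented by
    - phi (- conj u) exp (- 2 pi lambda |u|^2), and it has to be paired with the
    rational sections f of E'; exchanging the curves gives the other transform.

    In the real coordinates of a basis, a theta function is exp (pi lambda |u|^2)
    times a series of Gaussians [theta_fun_theta_twist].  The three exponential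
    factors cancel, and the pairing of two theta functions becomes the integral
    over the unit square of the product of two such series, in (s, t) and in
    (p s + q t, p' s + q' t) [transform_pairing].  The automorphy of phi relates
    the characters of the two series [theta_comb_char], so that the integral can be
    unfolded.  If q is nonzero, it is a sum of |q| phases times a Gaussian integral
    over the plane that depends on mu only through a factor 1 / mu
    [pairing_Iint, Iint_scale]; if q = 0, it is zero or a phase times a Gaussian
    integral over the line times 1 / sqrt mu [pairing_parallel].  The
    characteristics are rational, hence the phases are roots of unity.  These, mu
    and sqrt mu lie in the maximal abelian extension, which is a field
    [max_abelian_compositum].  So all the pairings lie in one line over this field,
    the same for all r [pairing_rational], and the scalar c rescales it.

    It remains to see that the pairing with f does not depend on the representative
    of the Dolbeault class, which is Stokes' theorem on a period parallelogram
    [stokes_dbar], and that the transform is a smooth section.  Both rest on the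
    holomorphy of the theta functions, proved termwise: functions of a complex
    variable are differentiated with explicit quadratic remainders [rdiff], which
    add up in a series of exponentials [eseries_rdiff]. *)

(** * The maximal abelian extension is a field containing roots of unity and square roots *)

(** A nonzero polynomial of least degree over K that kills z is irreducible, so
    the formal extension K[X]/(q) embeds into C. *)
Lemma adjoin_root_in (K C : fieldType) (iota : {rmorphism K -> C})
    (p : {poly K}) (z : C) : p != 0 -> root (map_poly iota p) z ->
  exists (L : fieldExtType K) (j : {rmorphism L -> C}),
    (forall a : K, j a%:A = iota a) /\ exists y, j y = z.
Proof.
move=> nzp rz.
pose P n := `[< exists q : {poly K},
  [/\ q != 0, root (map_poly iota q) z & size q = n] >].
have exP : exists n, P n by exists (size p); apply/asboolP; exists p.
case: (ex_minnP exP) => n /asboolP[q [nzq rq sq]] minq.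
have irr : irreducible_poly q.
  apply/(subfx_irreducibleP rq nzq) => r rr nzr; rewrite sq; apply: minq.
  by apply/asboolP; exists r.
exists (SubFieldExtType rq irr), (@subfx_inj _ _ iota z q); split.
  by move=> a; exact: subfx_inj_base.
by exists (subfx_root _ z q); exact: subfx_inj_root.
Qed.

Lemma adjoin_roots_in (K C : fieldType) (iota : {rmorphism K -> C})
    (p : {poly K}) (zs : seq C) : p != 0 ->
  (forall z, z \in zs -> root (map_poly iota p) z) ->
  exists (L : fieldExtType K) (j : {rmorphism L -> C}),
    (forall a : K, j a%:A = iota a) /\ exists ys, map j ys = zs.
Proof.
move=> nzp; elim: zs => [|z zs IH] rz.
  exists (K^o : fieldExtType K), iota; split; last by exists [::].
  by move=> a; rewrite /GRing.scale/= mulr1.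
have [|L [j [ja [ys jys]]]] := IH.
  by move=> x xz; apply: rz; rewrite inE xz orbT.
have rz' : root (map_poly j (map_poly (in_alg L) p)) z.
  rewrite -map_poly_comp (eq_map_poly (g := iota)) ?rz ?mem_head//.
have [|L' [j' [ja' [y jy]]]] := adjoin_root_in _ rz'.
  by rewrite map_poly_eq0.
exists (baseFieldType L'), j'; split.
  by move=> a; rewrite baseField_scaleE ja' ja.
exists (y :: map (in_alg L') ys); rewrite /= jy -map_comp -jys.
by congr cons; apply: eq_map => x /=; rewrite ja'.
Qed.

(** Cutting down to the subfield generated by the chosen elements makes them
    generators, which is what a splitting field requires. *)
Lemma generated_subfield (K C : fieldType) (L0 : fieldExtType K)
    (j0 : {rmorphism L0 -> C}) (ys : seq L0) :
  exists (L1 : fieldExtType K) (j1 : {rmorphism L1 -> C}) (zs : seq L1),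
    [/\ forall a : K, j1 a%:A = j0 a%:A,
        <<1 & zs>>%VS = fullv
      & map j1 zs = map j0 ys].
Proof.
pose L1 := subvs_of <<1 & ys>>; pose toL := linfun (vsval : L1 -> L0).
have toLE x : toL x = vsval x by rewrite lfunE.
have [zs Dys]: {zs | map (vsval : L1 -> L0) zs = ys}.
  exists (map (vsproj _) ys); rewrite -map_comp map_id_in // => y ys_y.
  by rewrite /= vsprojK ?seqv_sub_adjoin.
pose j1 : {rmorphism L1 -> C} := j0 \o (vsval : {rmorphism L1 -> L0}).
exists L1, j1, zs; split.
- move=> a; rewrite /j1 /=; congr (j0 _).
  by rewrite algid1.
- set Lzs := LHS; pose Lys := (toL @: Lzs)%VS; apply/vspaceP=> u.
  have: val u \in Lys.
    rewrite /Lys aimg_adjoin_seq aimg1 (_ : map toL zs = ys) ?(valP u)//.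
    by rewrite (eq_map toLE).
  by case/memv_imgP=> v Lzs_v; rewrite memvf lfunE => /val_inj->.
- by rewrite -[in RHS]Dys -map_comp.
Qed.

Lemma split_in (K : fieldType) (C : closedFieldType)
    (iota : {rmorphism K -> C}) (p : {poly K}) (L1 : fieldExtType K)
    (j1 : {rmorphism L1 -> C}) (zs : seq L1) (c : C) : c != 0 ->
  (forall a : K, j1 a%:A = iota a) ->
  map_poly iota p = c *: \prod_(w <- map j1 zs) ('X - w%:P) ->
  map_poly (in_alg L1) p %= \prod_(z <- zs) ('X - z%:P).
Proof.
move=> c0 ja1 Dp; rewrite -(eqp_map j1) -map_poly_comp.
rewrite (eq_map_poly (g := iota))//.
rewrite Dp (eqp_trans (eqp_scale _ c0))// big_map rmorph_prod.
rewrite (eq_bigr (fun z => map_poly j1 ('X - z%:P))) ?eqpxx// => i _ /=.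
by rewrite map_polyXsubC.
Qed.

(** Any polynomial has a splitting field inside an algebraically closed C: adjoin
    all its roots in C, then keep the subfield that they generate. *)
Lemma splitting_field_in (K : fieldType) (C : closedFieldType)
    (iota : {rmorphism K -> C}) (p : {poly K}) : p != 0 ->
  exists (L : splittingFieldType K) (j : {rmorphism L -> C}) (zs : seq L),
    [/\ forall a : K, j a%:A = iota a,
        <<1 & zs>>%VS = fullv,
        forall z, z \in zs -> root (map_poly (in_alg L) p) z
      & forall w, root (map_poly iota p) w -> exists y, j y = w].
Proof.
move=> nzp.
have [ws Dws] := closed_field_poly_normal (map_poly iota p).
have lc0 : lead_coef (map_poly iota p) != 0.
  by rewrite lead_coef_eq0 map_poly_eq0.
have rws w : root (map_poly iota p) w = (w \in ws).
  by rewrite Dws rootZ// root_prod_XsubC.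
have [|L0 [j0 [ja0 [ys jys]]]] := @adjoin_roots_in K C iota p ws nzp.
  by move=> z; rewrite rws.
have [L1 [j1 [zs [ja1 gen jzs]]]] := generated_subfield j0 ys.
have ja2 (a : K) : j1 a%:A = iota a by rewrite ja1 ja0.
have Dws' := Dws; rewrite -jys -jzs in Dws'.
have Dp := split_in lc0 ja2 Dws'.
have sL : splitting_field_axiom L1.
  exists (map_poly (in_alg L1) p); last by exists zs.
  by apply/polyOver1P; exists p.
pose LL : splittingFieldType K :=
  HB.pack L1 (FieldExt_isSplittingField.Build K L1 sL).
exists LL, j1, zs; split => //.
- by move=> z zz; rewrite (eqp_root Dp) root_prod_XsubC.
- by move=> w; rewrite rws -jys -jzs => /mapP[y yz ->]; exists y.
Qed.

Section Abelian.
Variables (R : realType) (K : fieldType) (iota : {rmorphism K -> R[i]}).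
Hypothesis pK : [pchar K] =i pred0.

Lemma char0_galois (L : splittingFieldType K) : galois 1 {:L}.
Proof.
rewrite /galois sub1v normalFieldf andbT /=.
by apply/separableP => x _; apply: pcharf0_separable => q; rewrite pchar_lalg.
Qed.

(** An automorphism is determined by its values on generators, so commutation can
    be tested there. *)
Lemma galois_comm_gen (L : splittingFieldType K) (zs : seq L) :
  <<1 & zs>>%VS = fullv ->
  (forall z (s t : gal_of {:L}), z \in zs -> s (t z) = t (s z)) ->
  abelian 'Gal({:L} / 1).
Proof.
move=> gen com; apply/centsP => s _ t _.
pose c := ((s * t) * (t * s)^-1)%g.
suff c1 : c = 1%g by apply: (mulIg ((t * s)^-1)%g); rewrite mulgV -c1.
have sub : (<<1 & zs>> <= fixedSpace c)%VS.
  apply/Fadjoin_seqP; split; first exact: sub1v.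
  move=> z zz; apply/fixedSpaceP.
  have e : (s * t)%g z = (t * s)%g z by rewrite !galM ?memvf// com.
  by rewrite /c galM ?memvf// e -galM ?memvf// mulgV gal_id.
apply/eqP/gal_eqP => x xL; rewrite gal_id; apply/fixedSpaceP.
by apply: (subvP sub); rewrite gen.
Qed.

Lemma max_abelian_range (L : splittingFieldType K) (j : {rmorphism L -> R[i]})
    (zs : seq L) : (forall a, j a%:A = iota a) ->
  <<1 & zs>>%VS = fullv ->
  (forall z (s t : gal_of {:L}), z \in zs -> s (t z) = t (s z)) ->
  forall x, max_abelian iota (j x).
Proof.
move=> ja gen com x; exists L, j; split => //.
- exact: char0_galois.
- exact: galois_comm_gen gen com.
Qed.

Lemma prim_root_complex (n : nat) : (0 < n)%N ->
  exists w : R[i], n.-primitive_root w.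
Proof.
move=> n0; pose p : {poly R[i]} := 'X^n - 1.
have [r Dp] := closed_field_poly_normal p.
have sz_p : size p = n.+1 by rewrite size_XnsubC.
have lp : lead_coef p = 1 by apply/eqP; rewrite -[_ == _]monicE monicXnsubC.
rewrite lp scale1r in Dp.
have Ur : uniq r.
  rewrite -separable_prod_XsubC -Dp separable_Xn_sub_1//.
  by rewrite pnatr_eq0 -lt0n.
have szr : size r = n by move: sz_p; rewrite Dp size_prod_XsubC => -[].
have : has n.-primitive_root r.
  apply: has_prim_root => //; last by rewrite szr.
  apply/allP => z; rewrite -root_prod_XsubC -Dp unity_rootE.
  by rewrite /root !hornerE subr_eq0.
by case/hasP => w _ wp; exists w.
Qed.

(** An automorphism of the splitting field of X^2 - a multiplies a root by 1 or
    -1, so any two of them commute. *)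
Lemma max_abelian_sqrt (a : K) (x : R[i]) : x ^+ 2 = iota a ->
  max_abelian iota x.
Proof.
move=> xa; pose p : {poly K} := 'X^2 - a%:P.
have szp : size p = 3%N by rewrite size_polyDl size_polyXn// size_polyN size_polyC; case: (a != 0).
have p0 : p != 0 by rewrite -size_poly_eq0 szp.
have [L [j [zs [ja gen rz rj]]]] := splitting_field_in iota p0.
have [|y <-] := rj x.
  by rewrite /root rmorphB /= map_polyXn map_polyC /= !hornerE xa subrr.
apply: (max_abelian_range ja gen) => z s t /rz.
have rE (w : L) : root (map_poly (in_alg L) p) w = (w ^+ 2 == a%:A).
  by rewrite /root rmorphB /= map_polyXn map_polyC /= !hornerE subr_eq0.
rewrite rE => /eqP za.
have pm (u : gal_of {:L}) : u z = z \/ u z = - z.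
  have : (u z) ^+ 2 == z ^+ 2.
    by rewrite -rmorphXn za /= rmorph_alg.
  by rewrite eqf_sqr => /orP[]/eqP ->; [left|right].
by case: (pm s) => Hs; case: (pm t) => Ht; rewrite Hs Ht ?rmorphN /= ?Hs ?Ht ?opprK.
Qed.

(** An automorphism of a cyclotomic extension raises a primitive root of unity to
    a power, so any two of them commute. *)
Lemma max_abelian_root1 (n : nat) (x : R[i]) : (0 < n)%N -> x ^+ n = 1 ->
  max_abelian iota x.
Proof.
move=> n0 xn; pose p : {poly K} := 'X^n - 1.
have p0 : p != 0 by rewrite monic_neq0// monicXnsubC.
have [L [j [zs [ja gen rz rj]]]] := splitting_field_in iota p0.
have rC (w : R[i]) : root (map_poly iota p) w = (w ^+ n == 1).
  by rewrite /root rmorphB /= map_polyXn rmorph1 !hornerE subr_eq0.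
have rE (w : L) : root (map_poly (in_alg L) p) w = (w ^+ n == 1).
  by rewrite /root rmorphB /= map_polyXn rmorph1 !hornerE subr_eq0.
have [w wprim] : exists w : R[i], n.-primitive_root w by exact: prim_root_complex.
have [|z0 jz0] := rj w; first by rewrite rC prim_expr_order.
have z0prim : n.-primitive_root z0 by rewrite -(fmorph_primitive_root j) jz0.
have [|y <-] := rj x; first by rewrite rC xn.
apply: (max_abelian_range ja gen) => z s t /rz.
rewrite rE => /eqP /(prim_rootP z0prim)[i ->].
have pm (u : gal_of {:L}) : exists k, u z0 = z0 ^+ k.
  have : (u z0) ^+ n = 1 by rewrite -rmorphXn (prim_expr_order z0prim) rmorph1.
  by move/(prim_rootP z0prim) => [k ->]; exists k.
have [k Hk] := pm s; have [l Hl] := pm t.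
by rewrite !rmorphXn /= Hk Hl !rmorphXn /= Hk Hl -!exprM mulnCA.
Qed.

(** Two abelian extensions embed in a common one, the splitting field of the
    product of the minimal polynomials of primitive elements: an automorphism of
    it acts on a root of one of these polynomials as an automorphism of the
    corresponding abelian extension does. *)
Lemma max_abelian_compositum (x y : R[i]) :
  max_abelian iota x -> max_abelian iota y ->
  exists (L : splittingFieldType K) (j : {rmorphism L -> R[i]}),
    (forall z, max_abelian iota (j z)) /\ exists a b, j a = x /\ j b = y.
Proof.
have key (L1 : splittingFieldType K) (j1 : {rmorphism L1 -> R[i]}) :
    (forall a, j1 a%:A = iota a) -> abelian 'Gal({:L1} / 1) ->
    exists p : {poly K}, p != 0 /\
    forall (L : splittingFieldType K) (j : {rmorphism L -> R[i]}),
      (forall a, j a%:A = iota a) ->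
      (forall w, root (map_poly iota p) w -> exists y, j y = w) ->
      (forall z, exists y, j y = j1 z) /\
      (forall z (s t : gal_of {:L}), root (map_poly (in_alg L) p) z ->
         s (t z) = t (s z)).
  move=> ja1 ab1; have gal1 := char0_galois L1.
  have sep1 : separable 1%VS {:L1} by case/and3P: gal1.
  pose prim_elt := separable_generator 1 {:L1}.
  have thgen (z : L1) : exists q : {poly K}, z = (map_poly (in_alg L1) q).[prim_elt].
    have : z \in <<1; prim_elt>>%VS by rewrite -eq_adjoin_separable_generator ?memvf ?sub1v.
    by case/Fadjoin_polyP => q' /polyOver1P[q ->] ->; exists q.
  have [q Dq] : exists q : {poly K}, minPoly 1 prim_elt = map_poly (in_alg L1) q.
    by apply/polyOver1P; exact: minPolyOver.
  exists q; split.
    by rewrite -(map_poly_eq0 (in_alg L1)) -Dq monic_neq0// monic_minPoly.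
  move=> L j ja rj.
  have hornj (r : {poly K}) (w : L) : j (map_poly (in_alg L) r).[w] = (map_poly iota r).[j w].
    by rewrite -horner_map -map_poly_comp (eq_map_poly (g := iota)).
  have hornj1 (r : {poly K}) (w : L1) : j1 (map_poly (in_alg L1) r).[w] = (map_poly iota r).[j1 w].
    by rewrite -horner_map -map_poly_comp (eq_map_poly (g := iota)).
  have hors (L' : splittingFieldType K) (u : gal_of {:L'}) (r : {poly K}) (w : L') :
      u (map_poly (in_alg L') r).[w] = (map_poly (in_alg L') r).[u w].
    rewrite -horner_map -map_poly_comp; congr (_.[_]).
    by apply: eq_map_poly => a /=; rewrite rmorph_alg.
  have exk (z : L1) : exists y, j y = j1 z.
    have [r ->] := thgen z.
    have [|y0 jy0] := rj (j1 prim_elt).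
      by rewrite /root -hornj1 -Dq minPolyxx rmorph0.
    by exists (map_poly (in_alg L) r).[y0]; rewrite hornj hornj1 jy0.
  split => //.
  have [k jk] := choice exk.
  have kq (r : {poly K}) (w : L1) :
      k (map_poly (in_alg L1) r).[w] = (map_poly (in_alg L) r).[k w].
    by apply: (fmorph_inj j); rewrite jk hornj1 hornj jk.
  have k0 : k 0 = 0 by apply: (fmorph_inj j); rewrite jk !rmorph0.
  (* The roots of [q] in [L] are the images of the conjugates of [prim_elt]. *)
  have rootk (z : L) : root (map_poly (in_alg L) q) z ->
      exists2 s, s \in 'Gal({:L1} / 1)%g & z = k (s prim_elt).
    have [r [/fintype.subsetP rG _ Dm]] := galois_factors (sub1v _) gal1 prim_elt (memvf _).
    rewrite /root => /eqP qz.
    have : root (map_poly j1 (minPoly 1 prim_elt)) (j z).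
      rewrite Dq -map_poly_comp (eq_map_poly (g := iota))// /root -hornj qz rmorph0 //.
    rewrite Dm rmorph_prod /= big_map (eq_bigr (fun s : gal_of {:L1} => 'X - (j1 (s prim_elt))%:P)); last first.
      by move=> i _; rewrite /= map_polyXsubC.
    rewrite -(big_map (fun s : gal_of {:L1} => j1 (s prim_elt)) xpredT (fun w => 'X - w%:P)).
    rewrite root_prod_XsubC => /mapP[s sr jz].
    by exists s; [exact: rG | apply: (fmorph_inj j); rewrite jk].
  have act (s : gal_of {:L}) : exists2 s1, s1 \in 'Gal({:L1} / 1)%g &
      forall z, s (k z) = k (s1 z).
    have [|s1 s1G Hs1] := rootk (s (k prim_elt)).
      by rewrite /root -hors -kq -Dq minPolyxx k0 rmorph0.
    exists s1 => // z; have [r ->] := thgen z.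
    by rewrite kq hors Hs1 -kq hors.
  move=> z s t /rootk [u _ ->].
  have [s1 s1G Hs] := act s; have [t1 t1G Ht] := act t.
  have com : (s1 * t1 = t1 * s1)%g by exact: (centsP ab1).
  by rewrite Ht Hs Hs Ht -!galM ?memvf// com.
move=> [L1 [j1 [ja1 _ ab1 [a1 _ xa]]]] [L2 [j2 [ja2 _ ab2 [a2 _ ya]]]].
have [p1 [p10 key1]] := key L1 j1 ja1 ab1.
have [p2 [p20 key2]] := key L2 j2 ja2 ab2.
have [L [j [zs [ja gen rz rj]]]] := splitting_field_in iota (mulf_neq0 p10 p20).
have [|r1 c1] := key1 L j ja.
  by move=> w rw; apply: rj; rewrite rmorphM rootM rw.
have [|r2 c2] := key2 L j ja.
  by move=> w rw; apply: rj; rewrite rmorphM rootM rw orbT.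
exists L, j; split.
  apply: (max_abelian_range ja gen) => z s t /rz.
  by rewrite rmorphM rootM => /orP[]; [exact: c1|exact: c2].
have [a ja1'] := r1 a1; have [b jb] := r2 a2.
by exists a, b; rewrite ja1' jb.
Qed.

Lemma max_abelianD (x y : R[i]) :
  max_abelian iota x -> max_abelian iota y -> max_abelian iota (x + y).
Proof.
move=> hx hy; have [L [j [jm [a [b [<- <-]]]]]] := max_abelian_compositum hx hy.
by rewrite -rmorphD.
Qed.

Lemma max_abelianM (x y : R[i]) :
  max_abelian iota x -> max_abelian iota y -> max_abelian iota (x * y).
Proof.
move=> hx hy; have [L [j [jm [a [b [<- <-]]]]]] := max_abelian_compositum hx hy.
by rewrite -rmorphM.
Qed.

Lemma max_abelianV (x : R[i]) : max_abelian iota x -> max_abelian iota x^-1.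
Proof.
move=> hx; have [L [j [jm [a [b [<- _]]]]]] := max_abelian_compositum hx hx.
by rewrite -fmorphV.
Qed.

Lemma max_abelian_base (a : K) : max_abelian iota (iota a).
Proof. by apply: (@max_abelian_sqrt (a ^+ 2)); rewrite rmorphXn. Qed.

Lemma max_abelian_sum (I : Type) (r : seq I) (f : I -> R[i]) :
  (forall i, max_abelian iota (f i)) -> max_abelian iota (\sum_(i <- r) f i).
Proof.
move=> hf; elim/big_ind: _ => //; last exact: max_abelianD.
by rewrite -(rmorph0 iota); exact: max_abelian_base.
Qed.

End Abelian.

(** * Real parts, norms and the complex exponential *)

Section ComplexExp.
Variable R : realType.
Implicit Types z w : R[i].

Lemma complexP z w : Re z = Re w -> Im z = Im w -> z = w.
Proof. by case: z w => [a b] [c d] /= -> ->. Qed.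

Lemma cReD z w : Re (z + w) = Re z + Re w. Proof. by case: z w => [a b] [c d]. Qed.
Lemma cImD z w : Im (z + w) = Im z + Im w. Proof. by case: z w => [a b] [c d]. Qed.
Lemma cReN z : Re (- z) = - Re z. Proof. by case: z. Qed.
Lemma cImN z : Im (- z) = - Im z. Proof. by case: z. Qed.
Lemma cReB z w : Re (z - w) = Re z - Re w. Proof. by rewrite cReD cReN. Qed.
Lemma cImB z w : Im (z - w) = Im z - Im w. Proof. by rewrite cImD cImN. Qed.
Lemma cReM z w : Re (z * w) = Re z * Re w - Im z * Im w.
Proof. by case: z w => [a b] [c d]. Qed.
Lemma cImM z w : Im (z * w) = Re z * Im w + Im z * Re w.
Proof. by case: z w => [a b] [c d]. Qed.
Lemma Re_sum (I : Type) (r : seq I) (P : pred I) (f : I -> R[i]) :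
  Re (\sum_(i <- r | P i) f i) = \sum_(i <- r | P i) Re (f i).
Proof. by apply: (big_morph _ cReD). Qed.
Lemma Im_sum (I : Type) (r : seq I) (P : pred I) (f : I -> R[i]) :
  Im (\sum_(i <- r | P i) f i) = \sum_(i <- r | P i) Im (f i).
Proof. by apply: (big_morph _ cImD). Qed.

Lemma nc_ge0 z : 0 <= nc z. Proof. by case: z => a b; exact: sqrtr_ge0. Qed.
Lemma ncD z w : nc (z + w) <= nc z + nc w. Proof. exact: le_normcD. Qed.
Lemma ncM z w : nc (z * w) = nc z * nc w. Proof. exact: Normc.normcM. Qed.
Lemma ncN z : nc (- z) = nc z. Proof. exact: normcN. Qed.
Lemma ncB z w : nc (z - w) <= nc z + nc w. Proof. by rewrite -(ncN w) ncD. Qed.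
Lemma nc0 : nc (0 : R[i]) = 0. Proof. exact: Normc.normc0. Qed.
Lemma nc_eq0 z : nc z = 0 -> z = 0. Proof. exact: Normc.eq0_normc. Qed.
Lemma nc_real (x : R) : nc x%:C = `|x|.
Proof. by rewrite /= expr0n/= addr0 sqrtr_sqr. Qed.
Lemma ncJ z : nc z^*%C = nc z.
Proof. by case: z => a b /=; rewrite sqrrN. Qed.
Lemma Re_le_nc z : `|Re z| <= nc z.
Proof.
case: z => a b /=; rewrite -sqrtr_sqr ler_wsqrtr// lerDl sqr_ge0//.
Qed.
Lemma Im_le_nc z : `|Im z| <= nc z.
Proof.
case: z => a b /=; rewrite -sqrtr_sqr ler_wsqrtr// lerDr sqr_ge0//.
Qed.
Lemma nc_le z : nc z <= `|Re z| + `|Im z|.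
Proof.
have -> : z = (Re z)%:C + 'i%C * (Im z)%:C by exact: complexE.
rewrite (le_trans (ncD _ _))// ncM !nc_real.
have -> : nc ('i%C : R[i]) = 1 by rewrite /= expr0n expr1n add0r sqrtr1.
by rewrite mul1r cReD cImD !cReM !cImM /= !(mul0r, mulr0, mul1r, subr0, addr0, add0r).
Qed.
Lemma nc_i : nc ('i%C : R[i]) = 1.
Proof. by rewrite /= expr0n expr1n add0r sqrtr1. Qed.

Lemma cexpD z w : cexp (z + w) = cexp z * cexp w.
Proof.
rewrite /cexp cReD cImD expRD cosD sinD; apply: complexP; rewrite !(cReM, cImM) /=; ring.
Qed.
Lemma cexp0 : cexp (0 : R[i]) = 1.
Proof. by rewrite /cexp /= expR0 cos0 sin0 mul1r. Qed.
Lemma nc_cexp z : nc (cexp z) = expR (Re z).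
Proof.
rewrite /cexp ncM nc_real ger0_norm ?expR_ge0//= cos2Dsin2 sqrtr1 mulr1//.
Qed.
Lemma cexp_neq0 z : cexp z != 0.
Proof.
apply/eqP => h; have := nc_cexp z; rewrite h nc0 => /eqP.
by rewrite eq_sym gt_eqF ?expR_gt0.
Qed.
Lemma cexpN z : cexp (- z) = (cexp z)^-1.
Proof.
apply: (mulfI (cexp_neq0 z)); rewrite -cexpD subrr cexp0 divff ?cexp_neq0//.
Qed.
Lemma cexpX z n : cexp (n%:R * z) = cexp z ^+ n.
Proof.
elim: n => [|n IH]; first by rewrite mul0r cexp0.
by rewrite -addn1 natrD mulrDl mul1r cexpD IH exprD expr1.
Qed.
Lemma cexpXz z (n : int) : cexp (n%:~R * z) = cexp z ^ n.
Proof.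
case: n => n; first exact: cexpX.
by rewrite NegzE mulrNz mulNr cexpN -[n.+1%:~R]/(n.+1%:R) cexpX -invr_expz.
Qed.

Lemma expR1D_le (x : R) : `|expR x - 1 - x| <= x ^+ 2 * expR `|x|.
Proof.
have h1 : expR x - 1 <= x * expR x.
  have := expR_ge1Dx (- x); rewrite expRN -(ler_pM2r (expR_gt0 x)).
  rewrite mulVf ?gt_eqF ?expR_gt0//; lra.
have h2 := expR_ge1Dx x.
rewrite ger0_norm; last by lra.
have h3 : `|expR x - 1| <= `|x| * expR `|x|.
  have [x0|x0] := leP 0 x.
    by rewrite (ger0_norm x0) ger0_norm//; lra.
  rewrite (ltr0_norm x0) ler0_norm; last first.
    by rewrite subr_le0 expR_le1 ltW.
  have h := expR_ge1Dx (- x).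
  have : - x * 1 <= - x * expR (- x) by apply: ler_wpM2l; lra.
  lra.
apply: (@le_trans _ _ (x * (expR x - 1))); first by nra.
apply: (le_trans (ler_norm _)); rewrite normrM -(real_normK (num_real x)).
by rewrite expr2 -mulrA ler_wpM2l.
Qed.

Lemma abs_sin_le (y : R) : `|sin y| <= `|y|.
Proof.
wlog y0 : y / 0 < y.
  move=> H; have [y0|y0|<-] := ltgtP 0 y; [exact: H| |by rewrite sin0 normr0].
  by rewrite -normrN -sinN -(normrN y) H// oppr_gt0.
have [|c _] := @MVT _ sin cos 0 y y0.
- by apply: continuous_subspaceT => x; exact: continuous_sin.
rewrite sin0 !subr0 => ->; rewrite normrM ler_piMl//; exact: cos_max.
Qed.

Lemma cos1_le (y : R) : `|cos y - 1| <= `|y| /\ `|cos y - 1| <= y ^+ 2.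
Proof.
have e : cos y - 1 = - 2 * sin (y / 2) ^+ 2.
  have {1}-> : y = (y / 2) *+ 2 by rewrite -mulr_natr -mulrA mulVf ?mulr1.
  rewrite cos_mulr2n cos2sin2; ring.
have h := abs_sin_le (y / 2); have h1 := sin_max (y / 2).
have n2 : `|y / 2| = `|y| / 2 by rewrite normrM [`|2^-1|]ger0_norm.
rewrite e normrM normrN [`|2|]ger0_norm// normrX.
have s0 := normr_ge0 (sin (y/2)); have y0 := normr_ge0 y.
rewrite -(real_normK (num_real y)).
rewrite n2 in h.
split; nra.
Qed.

Lemma sin1_le (y : R) : `|sin y - y| <= y ^+ 2.
Proof.
wlog y0 : y / 0 < y.
  move=> H; have [y0|y0|<-] := ltgtP 0 y; [exact: H| |by rewrite sin0 subr0 normr0 expr0n].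
  rewrite -normrN opprB addrC -sinN -(sqrrN y).
  by have := H (- y); rewrite opprK; apply; rewrite oppr_gt0.
have [|c] := @MVT _ (fun x => sin x - x) (fun x => cos x - 1) 0 y y0.
- apply: continuous_subspaceT => x; apply: cvgB; last exact: cvg_id.
  exact: continuous_sin.
rewrite sin0 !subr0 in_itv /= => /andP[c0 cy] ->.
rewrite normrM (gtr0_norm y0) expr2; apply: ler_wpM2r; first exact: ltW.
by rewrite (le_trans (cos1_le c).1)// gtr0_norm// ltW.
Qed.

(** The remainder from which theta functions get their derivatives; the constant 5
    is not sharp. *)
Lemma cexp1D_le z : nc (cexp z - 1 - z) <= 5 * nc z ^+ 2 * expR (nc z).
Proof.
set x := Re z; set y := Im z.
have -> : cexp z - 1 - z = (expR x - 1 - x)%:C + (expR x * (cos y - 1))%:C +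
    'i%C * (expR x * (sin y - y) + (expR x - 1 - x) * y + x * y)%:C.
  apply: complexP; rewrite /cexp !(cReB, cImB, cReD, cImD, cReM, cImM) /= -/x -/y; ring.
have hx : `|x| <= nc z := Re_le_nc z; have hy : `|y| <= nc z := Im_le_nc z.
have z0 := nc_ge0 z; have x0 := normr_ge0 x; have y0 := normr_ge0 y.
apply: (le_trans (ncD _ _)); rewrite ncM nc_i mul1r.
apply: (le_trans (lerD (ncD _ _) (lexx _))); rewrite !nc_real.
have e1 : 1 <= expR (nc z) by rewrite -expR0 ler_expR.
have ex : expR x <= expR (nc z) by rewrite ler_expR (le_trans (ler_norm _)).
have ex' : expR `|x| <= expR (nc z) by rewrite ler_expR.
have ex0 := expR_ge0 x.
set e := expR (nc z) in e1 ex ex' *.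
have z2 : 0 <= nc z ^+ 2 by rewrite sqr_ge0.
have x2 : x ^+ 2 <= nc z ^+ 2.
  by rewrite -(real_normK (num_real x)) lerXn2r// nnegrE.
have y2 : y ^+ 2 <= nc z ^+ 2.
  by rewrite -(real_normK (num_real y)) lerXn2r// nnegrE.
have A : `|expR x - 1 - x| <= nc z ^+ 2 * e.
  apply: (le_trans (expR1D_le x)); by apply: ler_pM => //; rewrite ?sqr_ge0 ?expR_ge0.
have B : `|expR x * (cos y - 1)| <= nc z ^+ 2 * e.
  rewrite normrM (ger0_norm ex0) mulrC; apply: ler_pM => //.
  exact: le_trans (cos1_le y).2 _.
have C : `|expR x * (sin y - y)| <= nc z ^+ 2 * e.
  rewrite normrM (ger0_norm ex0) mulrC; apply: ler_pM => //.
  exact: le_trans (sin1_le y) _.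
have D : `|(expR x - 1) * y| <= nc z ^+ 2 * e.
  rewrite normrM mulrC expr2 -mulrA; apply: ler_pM => //.
  have h1 : expR x - 1 <= x * expR x.
    have := expR_ge1Dx (- x); rewrite expRN -(ler_pM2r (expR_gt0 x)).
    rewrite mulVf ?gt_eqF ?expR_gt0//; lra.
  have h2 := expR_ge1Dx x.
  rewrite ler_norml; apply/andP; split.
    by have := ler_norm (- x); rewrite normrN; nra.
  apply: (le_trans h1); apply: (le_trans (ler_norm _)); rewrite normrM.
  by rewrite (ger0_norm ex0); apply: ler_pM.
have -> : expR x * (sin y - y) + (expR x - 1 - x) * y + x * y =
   expR x * (sin y - y) + (expR x - 1) * y by ring.
have := ler_normD (expR x * (sin y - y)) ((expR x - 1) * y).
have : 0 <= nc z ^+ 2 * e by apply: mulr_ge0 => //; lra.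
lra.
Qed.

End ComplexExp.

(** * Series over the integers *)

Section Zsum.
Variable R : realType.
Implicit Types (a b : int -> R[i]) (z : R[i]).

(** Partial sum over the integers from - m to n - 1.  The two ends are independent,
    so that a shift of the index preserves the limit. *)
Definition tsum a (m n : nat) : R[i] :=
  \sum_(k < n) a (Posz k) + \sum_(k < m) a (Negz k).

(** Convergence of the partial sums as both ends go to infinity independently; it
    implies convergence of the symmetric partial sums in the definition of zsum. *)
Definition sums_to a z := forall eps : R, 0 < eps -> exists N0 : nat,
  forall m n, (N0 <= m)%N -> (N0 <= n)%N -> nc (tsum a m n - z) <= eps.

Definition geo_bounded a (C : R) := forall n : int, nc (a n) <= C * expR (- `|n|%N%:R).

(** The value of the geometric series of ratio exp (-1). *)
Definition geo_const : R := (1 - expR (-1))^-1.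

Lemma geo_const_gt0 : 0 < geo_const.
Proof. by rewrite invr_gt0 subr_gt0 expR_lt1 ltrN10. Qed.

Lemma expRN_small (eps : R) : 0 < eps -> exists N0 : nat, forall n, (N0 <= n)%N ->
  expR (- n%:R) <= eps.
Proof.
move=> e0; have ei : 0 <= eps^-1 by rewrite invr_ge0 ltW.
have hN := archi_boundP ei; exists (Num.bound eps^-1) => n hn; rewrite expRN -[eps]invrK lef_pV2 ?posrE ?invr_gt0 ?expR_gt0//.
rewrite (le_trans (ltW hN))// (le_trans _ (expR_ge1Dx _))//.
by rewrite ler_wpDl// ler_nat.
Qed.

Lemma sum_expRN (N M : nat) : (N <= M)%N ->
  \sum_(N <= k < M) expR (- k%:R) <= geo_const * expR (- N%:R) :> R.
Proof.
move=> NM; apply: (@le_trans _ _ (geo_const * (expR (- N%:R) - expR (- M%:R)))); last first.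
  by rewrite ler_wpM2l ?(ltW geo_const_gt0)// gerBl expR_ge0.
elim: M NM => [|M IH] NM; first by move: NM; rewrite leqn0 => /eqP ->; rewrite big_geq// subrr mulr0.
move: NM; rewrite leq_eqVlt => /predU1P[<-|]; first by rewrite big_geq// subrr mulr0.
rewrite ltnS => NM; rewrite big_nat_recr//=.
apply: (le_trans (lerD (IH NM) (lexx _))).
have gke : geo_const * (1 - expR (-1)) = 1.
  by rewrite /geo_const mulVf// gt_eqF// subr_gt0 expR_lt1 ltrN10.
rewrite -(natr1 M) opprD expRD.
rewrite le_eqVlt; apply/orP; left; apply/eqP.
have h : geo_const * (1 - expR (-1)) * expR (- M%:R) = expR (- M%:R) by rewrite gke mul1r.
by rewrite -[X in _ + X]h; ring.
Qed.

Lemma real_tail (u : nat -> R) (C : R) : (forall k, `|u k| <= C * expR (- k%:R)) ->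
  forall N, `|limn (series u) - \sum_(k < N) u k| <= C * geo_const * expR (- N%:R).
Proof.
move=> hu N.
have C0 : 0 <= C.
  by have := le_trans (normr_ge0 _) (hu 0%N); rewrite oppr0 expR0 mulr1.
have bnd M : (N <= M)%N -> `|series u M - \sum_(k < N) u k| <= C * geo_const * expR (- N%:R).
  move=> NM; rewrite -(big_mkord xpredT u) /series /= (big_cat_nat (leq0n N) NM)/= addrAC subrr add0r.
  apply: (le_trans (ler_norm_sum _ _ _)).
  apply: (le_trans (ler_sum _ (fun k _ => hu k))).
  by rewrite -mulr_sumr -mulrA ler_wpM2l// sum_expRN.
have cu : cvgn (series u).
  apply: normed_cvg; apply: (@series_le_cvg _ _ (fun k => C * expR (- k%:R))).
  - by move=> n; exact: normr_ge0.
  - by move=> n; rewrite mulr_ge0// expR_ge0.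
  - exact: hu.
  - have -> : (fun k : nat => C * expR (- k%:R)) = geometric C (expR (-1)).
      by apply/funext => k; rewrite /= -expRM_natl mulrN1.
    apply: is_cvg_geometric_series; rewrite ger0_norm ?expR_ge0//.
have cl : `|series u M - \sum_(k < N) u k| @[M --> \oo] -->
    `|limn (series u) - \sum_(k < N) u k|.
  by apply: cvg_norm; apply: cvgB => //; exact: cvg_cst.
rewrite -(cvg_lim _ cl)//; apply: limr_le; first by apply/cvg_ex; eexists; exact: cl.
by exists N => // M /= NM; exact: bnd.
Qed.

Definition nsum (u : nat -> R[i]) : R[i] :=
  limn (series (fun k => Re (u k))) +i* limn (series (fun k => Im (u k))).

Lemma nsum_tail (u : nat -> R[i]) (C : R) :
  (forall k, nc (u k) <= C * expR (- k%:R)) ->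
  forall N, nc (nsum u - \sum_(k < N) u k) <= 2 * C * geo_const * expR (- N%:R).
Proof.
move=> hu N; apply: (le_trans (nc_le _)).
rewrite cReB cImB Re_sum Im_sum /=.
have h1 := @real_tail (fun k => Re (u k)) C (fun k => le_trans (Re_le_nc _) (hu k)) N.
have h2 := @real_tail (fun k => Im (u k)) C (fun k => le_trans (Im_le_nc _) (hu k)) N.
by apply: (le_trans (lerD h1 h2)); rewrite -!mulrA mulr_natl mulr2n.
Qed.

Lemma geo_bounded_ge0 a C : geo_bounded a C -> 0 <= C.
Proof. by move/(_ 0) => h; have := le_trans (nc_ge0 _) h; rewrite oppr0 expR0 mulr1. Qed.

Lemma sums_to_uniq a z w : sums_to a z -> sums_to a w -> z = w.
Proof.
move=> hz hw; apply/eqP; rewrite -subr_eq0; apply/eqP/nc_eq0/eqP.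
rewrite -[_ == 0]negbK; apply/negP => n0.
have e0 : 0 < nc (z - w) by rewrite lt_neqAle eq_sym n0 nc_ge0.
have e3 : 0 < nc (z - w) / 3 by lra.
have [N1 H1] := hz _ e3; have [N2 H2] := hw _ e3.
have := H1 (maxn N1 N2) (maxn N1 N2) (leq_maxl _ _) (leq_maxl _ _).
have := H2 (maxn N1 N2) (maxn N1 N2) (leq_maxr _ _) (leq_maxr _ _).
set t := tsum _ _ _ => h2 h1.
have : nc (z - w) <= nc (t - w) + nc (t - z).
  have -> : z - w = (t - w) - (t - z) by ring.
  exact: ncB.
lra.
Qed.

Lemma nsum_geo_bounded_tail a C : geo_bounded a C -> forall m n,
  nc (nsum (a \o Posz) + nsum (a \o Negz) - tsum a m n) <=
    2 * C * geo_const * (expR (- n%:R) + expR (- m%:R)).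
Proof.
move=> ha m n.
have h1 := @nsum_tail (a \o Posz) C (fun k => ha (Posz k)) n.
have ha' k : nc ((a \o Negz) k) <= C * expR (- k%:R).
  apply: (le_trans (ha (Negz k))); apply: ler_wpM2l; first exact: geo_bounded_ge0 ha.
  by rewrite ler_expR lerN2 ler_nat.
have h2 := @nsum_tail (a \o Negz) C ha' m.
rewrite mulrDr; apply: le_trans (lerD h1 h2); apply: le_trans (ncD _ _).
by rewrite /tsum le_eqVlt; apply/orP; left; apply/eqP; congr nc; rewrite opprD addrACA.
Qed.

Lemma geo_bounded_sums_to a C : geo_bounded a C -> sums_to a (nsum (a \o Posz) + nsum (a \o Negz)).
Proof.
move=> ha eps e0; have C0 := geo_bounded_ge0 ha; have g0 := geo_const_gt0.
have K0 : 0 < 2 * C * geo_const * 2 + 1 by have := mulr_ge0 C0 (ltW g0); lra.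
have [N0 hN] := expRN_small (divr_gt0 e0 K0).
exists N0 => m n hm hn; rewrite -ncN opprB; apply: (le_trans (nsum_geo_bounded_tail ha m n)).
have := hN _ hm; have := hN _ hn; rewrite !ler_pdivlMr//.
have := expR_ge0 (- m%:R : R); have := expR_ge0 (- n%:R : R); have := mulr_ge0 C0 (ltW g0).
set x := expR _; set y := expR _; set c := C * geo_const => c0 x0 y0.
rewrite -/c in K0 *.
by rewrite -(mulrA 2) -/c; nra.
Qed.

Lemma tsum_sym a N : \sum_(0 <= k < N.*2.+1) a (k%:Z - N%:Z) = tsum a N N.+1.
Proof.
rewrite /tsum -addnn -addnS (big_cat_nat _ (n := N))//= ?leq_addr// addrC; congr +%R.
  rewrite -{1}[N]add0n big_addn addnC addnK big_mkord; apply: eq_bigr => i _.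
  by congr a; rewrite PoszD addrK.
rewrite big_nat_rev /= add0n big_mkord; apply: eq_bigr => i _; congr a.
rewrite NegzE; have := ltn_ord i; lia.
Qed.

Lemma sums_to_zsum a z : sums_to a z -> zsum a = z.
Proof.
move=> ha; rewrite /zsum; apply: (@cvg_lim R[i]^o (@norm_hausdorff R[i] R[i]^o)).
apply/cvgrPdist_le => eps; rewrite ltcE => /andP[/eqP/= ei e0].
have [N0 hN] := ha _ e0; exists N0 => // N /= NN; rewrite tsum_sym.
rewrite -normrN opprB lecE; apply/andP; split; first by rewrite ei.
exact: hN (NN) (leqW NN).
Qed.

Lemma geo_bounded_zsum a C : geo_bounded a C -> sums_to a (zsum a).
Proof. by move=> ha; rewrite (sums_to_zsum (geo_bounded_sums_to ha)); exact: geo_bounded_sums_to ha. Qed.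

Lemma zsum_tail a C : geo_bounded a C -> forall m n,
  nc (zsum a - tsum a m n) <= 2 * C * geo_const * (expR (- n%:R) + expR (- m%:R)).
Proof. by move=> ha m n; rewrite (sums_to_zsum (geo_bounded_sums_to ha)); exact: nsum_geo_bounded_tail. Qed.

Lemma zsum_le a C : geo_bounded a C -> nc (zsum a) <= 4 * C * geo_const.
Proof.
move=> /zsum_tail /(_ 0%N 0%N); rewrite /tsum !big_ord0 addr0 subr0 oppr0 expR0.
by move=> h; apply: (le_trans h); lra.
Qed.

Lemma sums_to_ext_tsum a b z (s t : nat) :
  (forall m n, tsum b (m + s) (n + t) = tsum a (m + t) (n + s)) -> sums_to a z -> sums_to b z.
Proof.
move=> h ha eps e0; have [N0 hN] := ha _ e0; exists (N0 + s + t)%N => m n hm hn.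
have -> : m = (m - s + s)%N by rewrite subnK// (leq_trans _ hm)// -addnA addnCA leq_addr.
have -> : n = (n - t + t)%N by rewrite subnK// (leq_trans _ hn)// leq_addl.
by rewrite h; apply: hN; rewrite -?addnBAC; lia.
Qed.

Lemma sums_toD a b z w : sums_to a z -> sums_to b w -> sums_to (fun n => a n + b n) (z + w).
Proof.
move=> ha hb eps e0; have e2 : 0 < eps / 2 by lra.
have [N1 h1] := ha _ e2; have [N2 h2] := hb _ e2.
exists (N1 + N2)%N => m n hm hn.
have -> : tsum (fun n => a n + b n) m n - (z + w) = (tsum a m n - z) + (tsum b m n - w).
  by rewrite /tsum !big_split /=; ring.
apply: (le_trans (ncD _ _)); rewrite [leRHS]splitr; apply: lerD.
  by apply: h1; lia.
by apply: h2; lia.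
Qed.

Lemma sums_toZ a z (c : R[i]) : sums_to a z -> sums_to (fun n => c * a n) (c * z).
Proof.
move=> ha eps e0; have c0 := nc_ge0 c; have c1 : 0 < nc c + 1 by lra.
have [N1 h1] := ha _ (divr_gt0 e0 c1).
exists N1 => m n hm hn.
have -> : tsum (fun n => c * a n) m n - c * z = c * (tsum a m n - z).
  by rewrite /tsum -!mulr_sumr; ring.
rewrite ncM; have := h1 m n hm hn; rewrite ler_pdivlMr//.
have := nc_ge0 (tsum a m n - z); nra.
Qed.

Lemma sums_to_sum (I : Type) (r : seq I) (a : I -> int -> R[i]) (z : I -> R[i]) :
  (forall i, sums_to (a i) (z i)) -> sums_to (fun n => \sum_(i <- r) a i n) (\sum_(i <- r) z i).
Proof.
move=> ha; elim: r => [|i r IH].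
  move=> eps e0; exists 0%N => m n _ _; rewrite /tsum big_nil !big1 ?addr0 ?subr0 ?nc0 ?ltW//.
    by move=> k _; rewrite big_nil.
  by move=> k _; rewrite big_nil.
rewrite big_cons; have := sums_toD (ha i) IH; congr sums_to.
by apply/funext => n; rewrite big_cons.
Qed.

Lemma sums_to_shift1 a z : sums_to a z -> sums_to (fun n => a (n + 1)) z.
Proof.
apply: (@sums_to_ext_tsum _ _ _ 1 0) => m n; rewrite !addn0 !addn1 /tsum.
rewrite big_ord_recl [in RHS]big_ord_recl -!addrA addrCA; congr (_ + (_ + _)).
- by apply: eq_bigr => k _; congr a; rewrite /= /bump /=; lia.
- by apply: eq_bigr => k _; congr a; rewrite /= /bump /=; lia.
Qed.

Lemma sums_to_opp a z : sums_to a z -> sums_to (fun n => a (- n)) z.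
Proof.
move=> ha eps e0; have [N0 hN] := ha _ e0; exists N0.+1 => m n hm hn.
case: n hn => // n hn.
have -> : tsum (fun n => a (- n)) m n.+1 = tsum a n m.+1.
  rewrite /tsum big_ord_recl [in RHS]big_ord_recl -!addrA; congr (_ + _); rewrite ?oppr0//.
  rewrite addrC; congr (_ + _).
by apply: hN; lia.
Qed.

Lemma sums_to_shiftN1 a z : sums_to a z -> sums_to (fun n => a (n - 1)) z.
Proof.
move=> /sums_to_opp/sums_to_shift1/sums_to_opp; congr sums_to; apply/funext => n; congr a; lia.
Qed.

Lemma sums_to_shift a z (p : int) : sums_to a z -> sums_to (fun n => a (n + p)) z.
Proof.
elim/int_rect: p a => [|p IH|p IH] a ha.
- by move: ha; congr sums_to; apply/funext => n; rewrite addr0.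
- have := sums_to_shift1 (IH _ ha); congr sums_to; apply/funext => n; congr a; lia.
- have := sums_to_shiftN1 (IH _ ha); congr sums_to; apply/funext => n; congr a; lia.
Qed.

Lemma Negz_regroup (d l m : nat) :
  (d + l.+1)%N%:Z * Negz m + d%:Z = Negz ((d + l.+1) * m + l).
Proof.
have e : ((d + l.+1) * m.+1 = ((d + l.+1) * m + l).+1 + d)%N by rewrite mulnSr; lia.
move: e; set A := (_ * m.+1)%N; set B := (_ * m + l)%N => e.
have -> : (d + l.+1)%N%:Z * Negz m = - A%:Z by rewrite [Negz m]NegzE mulrN -PoszM.
by rewrite [Negz B]NegzE e PoszD opprD addrNK.
Qed.

Lemma tsum_regroup a (q m n : nat) :
  \sum_(l < q) tsum (fun k => a (q%:Z * k + l%:Z)) m n = tsum a (q * m) (q * n).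
Proof.
rewrite /tsum big_split /=; congr (_ + _).
- rewrite exchange_big /=; elim: n => [|n IH]; first by rewrite muln0 !big_ord0.
  rewrite big_ord_recr IH /= mulnSr big_split_ord /=; congr (_ + _).
- rewrite exchange_big /=; elim: m => [|m IH]; first by rewrite muln0 !big_ord0.
  rewrite big_ord_recr IH /= mulnSr big_split_ord /=; congr +%R.
  rewrite (reindex_inj rev_ord_inj) /=; apply: eq_bigr => l _; congr a.
  by have := Negz_regroup (q - l.+1) l m; rewrite subnK.
Qed.

Lemma tsum_sum (I : finType) (f : I -> int -> R[i]) m n :
  tsum (fun k => \sum_(l : I) f l k) m n = \sum_(l : I) tsum (f l) m n.
Proof. by rewrite /tsum big_split /=; congr (_ + _); exact: exchange_big. Qed.

(** A convergent series over the integers may be summed by residue classes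
    modulo q. *)
Lemma sums_to_regroup a (q : nat) (z0 : R[i]) (z : 'I_q -> R[i]) : (0 < q)%N -> sums_to a z0 ->
  (forall l : 'I_q, sums_to (fun k => a (q%:Z * k + (l : nat)%:Z)) (z l)) ->
  z0 = \sum_(l < q) z l.
Proof.
move=> q0 ha hz; apply: (@sums_to_uniq (fun k => \sum_(l < q) a (q%:Z * k + (l : nat)%:Z))); last exact: sums_to_sum.
move=> eps e0; have [N0 hN] := ha _ e0; exists N0 => m n hm hn.
have -> : tsum (fun k => \sum_(l < q) a (q%:Z * k + (l : nat)%:Z)) m n = tsum a (q * m) (q * n).
  by rewrite tsum_sum -(tsum_regroup a).
by apply: hN; nia.
Qed.

End Zsum.

(** * Real integrals *)

Section RealInt.
Variable R : realType.
Local Notation mu := (@lebesgue_measure R).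
Implicit Types (f g G : R -> R).

(** A remainder that is quadratic near x determines the derivative at x. *)
Lemma quad_is_derive (f : R -> R) (x d C r : R) : 0 < r ->
  (forall h, `|h| <= r -> `|f (x + h) - f x - h * d| <= C * h ^+ 2) ->
  is_derive x 1 f d.
Proof.
move=> r0 H.
have cv : h^-1 *: ((f \o shift x) (h *: (1 : R)) - f x) @[h --> 0^'] --> d.
  apply/cvgrPdist_le => e e0.
  have C0 : 0 < `|C| + 1 by have := normr_ge0 C; lra.
  have m0 : 0 < Num.min r (e / (`|C| + 1)) by rewrite lt_min r0 divr_gt0.
  near=> h.
  have h0 : h != 0 by near: h; exact: nbhs_dnbhs_neq.
  have hm : `|h| <= Num.min r (e / (`|C| + 1)).
    near: h; apply: dnbhs0_le => //.
  move: hm; rewrite le_min => /andP[hr he].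
  rewrite /= /GRing.scale /= mulr1 (addrC h).
  have n0 : 0 < `|h| by rewrite normr_gt0.
  have -> : d - h^-1 * (f (x + h) - f x) = - (h^-1 * (f (x + h) - f x - h * d)).
    by field.
  rewrite normrN normrM normfV ler_pdivrMl//.
  apply: (le_trans (H _ hr)); rewrite -(real_normK (num_real h)).
  move: he; rewrite ler_pdivlMr// => he.
  have := ler_norm C; nra.
apply: DeriveDef; first by apply/cvg_ex; exists d.
by rewrite /derive; apply/cvg_lim.
Unshelve. all: by end_near. Qed.

Lemma is_derive_cont (f : R -> R) (x d : R) : is_derive x 1 f d ->
  {for x, continuous f}.
Proof. by move=> [h _]; apply: differentiable_continuous; apply/derivable1_diffP. Qed.

Definition expm (x : R) : R := expR (- `|x|).

Lemma continuous_expm : continuous expm.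
Proof.
move=> x; apply: continuous_comp; last exact: continuous_expR.
by apply: continuousN; exact: norm_continuous.
Qed.

Lemma cont_meas f (D : set R) : continuous f -> measurable_fun D f.
Proof. by move=> cf; apply: measurable_funTS; exact: continuous_measurable_fun. Qed.

Lemma integrable_expm : mu.-integrable setT (EFin \o expm).
Proof.
apply/integrableP; split; first by apply/measurable_EFinP; exact: cont_meas continuous_expm.
rewrite (_ : (fun x => _) = fun x => (expm x)%:E); last first.
  by apply/funext => x /=; rewrite ger0_norm// expR_ge0.
rewrite (@ge0_symfun_integralT _ expm); first last.
- by move=> x; rewrite /expm /= normrN.
- exact: continuous_expm.
- by move=> x; exact: expR_ge0.
rewrite (_ : [set x | 0 <= x] = `[0, +oo[%classic); last first.
  by apply/seteqP; split => x /=; rewrite in_itv /= andbT.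
have dF (x : R) : is_derive x 1 (fun y : R => - expR (- y)) (expR (- x)).
  apply: (@quad_is_derive _ _ _ (expR (- x) * expR 1) 1) => // h h1.
  have -> : - expR (- (x + h)) - - expR (- x) - h * expR (- x) =
      - (expR (- x) * (expR (- h) - 1 - - h)) by rewrite opprD expRD; ring.
  rewrite normrN normrM (ger0_norm (expR_ge0 _)) -mulrA ler_wpM2l ?expR_ge0//.
  apply: (le_trans (expR1D_le _)); rewrite sqrrN mulrC ler_wpM2r ?sqr_ge0//.
  by rewrite ler_expR normrN.
rewrite (@ge0_continuous_FTC2y _ expm (fun x => - expR (- x)) 0 0).
- by rewrite oppr0 expR0 -EFinB -EFinM ltry.
- by move=> x _; exact: expR_ge0.
- by apply: continuous_subspaceT; exact: continuous_expm.
- by rewrite -[X in _ --> X]oppr0; apply: cvgN; apply: cvgr_expR.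
- by move=> x _; have [] := dF x.
- apply: cvg_at_right_filter; exact: (is_derive_cont (dF 0)).
- move=> x; rewrite in_itv /= andbT => x0; have [_ dFx] := dF x.
  by rewrite derive1E dFx /expm gtr0_norm.
Qed.

Lemma is_derive_affine (k c x : R) : is_derive x 1 (fun y : R => k * y + c) k.
Proof.
apply: (@quad_is_derive _ _ _ 0 1) => // h _.
have -> : k * (x + h) + c - (k * x + c) - h * k = 0 by ring.
by rewrite normr0 mul0r.
Qed.

Lemma derive1_affine (k c : R) : (fun y : R => k * y + c)^`()%classic = cst k.
Proof. by apply/funext => x; rewrite derive1E; have [_ ->] := is_derive_affine k c x. Qed.

Lemma continuous_affine (k c : R) : continuous (fun y : R => k * y + c).
Proof.
by move=> x; exact: (is_derive_cont (is_derive_affine k c x)).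
Qed.

Lemma ge0_integral_affine G (k c : R) : 0 < k -> continuous G -> (forall x, 0 <= G x) ->
  (\int[mu]_x (G x)%:E = \int[mu]_x (k * G (k * x + c))%:E)%E.
Proof.
move=> k0 cG G0.
rewrite (@increasing_ge0_integration_by_substitutionT _ (fun y => k * y + c) G)//.
- by apply: eq_integral => x _ /=; rewrite derive1_affine /= mulrC.
- by move=> x y xy; rewrite ltrD2r ltr_pM2l.
- by rewrite derive1_affine; move=> x; exact: cvg_cst.
- by rewrite derive1_affine; exact: is_cvg_cst.
- by rewrite derive1_affine; exact: is_cvg_cst.
- apply/cvgrNyPle => A; near=> x.
  have : x <= (A - c) / k by near: x; apply: nbhs_ninfty_le; exact: num_real.
  by rewrite ler_pdivlMr// mulrC; lra.
- apply/cvgryPge => A; near=> x.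
  have : (A - c) / k <= x by near: x; apply: nbhs_pinfty_ge; exact: num_real.
  by rewrite ler_pdivrMr// mulrC; lra.
Unshelve. all: by end_near. Qed.

Lemma continuous_normf G : continuous G -> continuous (fun x => `|G x|).
Proof. by move=> cG x; apply: cvg_norm; exact: cG. Qed.

Lemma integrable_affine G (k c : R) : 0 < k -> continuous G ->
  mu.-integrable setT (EFin \o G) ->
  mu.-integrable setT (EFin \o (fun x => G (k * x + c))).
Proof.
move=> k0 cG /integrableP[mG iG].
have cGa : continuous (fun x => G (k * x + c)).
  by move=> x; apply: continuous_comp; [exact: continuous_affine|exact: cG].
apply/integrableP; split; first by apply/measurable_EFinP; exact: cont_meas.
move: iG; rewrite [X in (X < _)%E](_ : _ = \int[mu]_x (`|G x|)%:E)%E//.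
rewrite (@ge0_integral_affine _ k c)//; last exact: continuous_normf.
under eq_integral do rewrite EFinM.
rewrite ge0_integralZl//; last 2 first.
- by apply/measurable_EFinP; exact: cont_meas (continuous_normf cGa).
- by rewrite lee_fin ltW.
move=> h; rewrite ltey; apply/eqP => e; move: h; rewrite e mulry gtr0_sg// mul1e.
by rewrite ltxx.
Qed.

Lemma integral_affine G (k c : R) : 0 < k -> continuous G ->
  mu.-integrable setT (EFin \o G) ->
  \int[mu]_x G (k * x + c) = k^-1 * \int[mu]_x G x.
Proof.
move=> k0 cG iG.
have cN := continuous_normf cG.
have iN : mu.-integrable setT (EFin \o (fun x => `|G x|)).
  apply: (le_integrable measurableT _ _ iG) => /=.
    by apply/measurable_EFinP; exact: cont_meas cN.
  by move=> x _; rewrite lee_fin normr_id.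
pose P : R -> R := fun x => `|G x| + G x.
have cP : continuous P by move=> x; apply: cvgD; [exact: cN|exact: cG].
have P0 x : 0 <= P x by rewrite /P; have := ler_norm (- G x); rewrite normrN; lra.
have iP : mu.-integrable setT (EFin \o P).
  by rewrite (_ : EFin \o P = fun x => (`|G x|)%:E + (G x)%:E)%E//; exact: integrableD.
have key (H : R -> R) : continuous H -> (forall x, 0 <= H x) -> mu.-integrable setT (EFin \o H) ->
    \int[mu]_x H (k * x + c) = k^-1 * \int[mu]_x H x.
  move=> cH H0 iH; rewrite {2}/Rintegral (ge0_integral_affine c k0 cH H0).
  rewrite -/(Rintegral _ _ _) RintegralZl//; last exact: integrable_affine.
  by rewrite mulrA mulVf ?mul1r// gt_eqF.
have eG x : G x = P x - `|G x| by rewrite /P; ring.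
under [LHS]eq_Rintegral do rewrite eG.
under [in RHS]eq_Rintegral do rewrite eG.
rewrite !RintegralB//; last 2 first.
- exact: (integrable_affine c k0 cP iP).
- exact: (integrable_affine c k0 cN iN).
have kN := key _ cN (fun x => normr_ge0 (G x)) iN.
by rewrite (key P)// kN mulrBr.
Qed.

Lemma integral_shift01 G (n : R) : continuous G ->
  \int[mu]_(x in `[n, n + 1]) G x = \int[mu]_(t in `[0, 1]) G (t + n).
Proof.
move=> cG; rewrite /Rintegral; congr fine.
have := @integration_by_substitution_increasing _ (fun y : R => 1 * y + n) G 0 1 ler01.
rewrite derive1_affine mulr0 add0r mulr1 (addrC n) => ->.
- by apply: eq_integral => x _; rewrite !fctE /= mulr1 mul1r.
- by move=> x y _ _ xy; rewrite !mul1r ltrD2r.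
- by move=> x _; exact: cvg_cst.
- exact: is_cvg_cst.
- exact: is_cvg_cst.
- split.
  + by move=> x _; have [] := is_derive_affine 1 n x.
  + by apply: cvg_at_right_filter; exact: (is_derive_cont (is_derive_affine 1 n 0)).
  + by apply: cvg_at_left_filter; exact: (is_derive_cont (is_derive_affine 1 n 1)).
- exact: continuous_subspaceT.
Qed.

End RealInt.

(** * Integrals of complex-valued functions *)

Section ComplexInt.
Variable R : realType.
Local Notation mu := (@lebesgue_measure R).
Implicit Types (f g : R -> R[i]) (D : set (measurableTypeR R)).

Definition cint D f : R[i] :=
  (\int[mu]_(t in D) Re (f t)) +i* (\int[mu]_(t in D) Im (f t)).

Definition cmeasurable D f := measurable_fun D (fun t => Re (f t)) /\
  measurable_fun D (fun t => Im (f t)).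

Definition cintegrable D f := mu.-integrable D (EFin \o (fun t => Re (f t))) /\
  mu.-integrable D (EFin \o (fun t => Im (f t))).

Definition ccont f := continuous (fun t => Re (f t)) /\ continuous (fun t => Im (f t)).

Lemma ccont_cmeasurable D f : ccont f -> cmeasurable D f.
Proof. by case=> h1 h2; split; exact: cont_meas. Qed.

Lemma ccont_cst (c : R[i]) : ccont (fun=> c).
Proof. by split; move=> x; exact: cvg_cst. Qed.

Lemma ccontD f g : ccont f -> ccont g -> ccont (fun t => f t + g t).
Proof.
move=> [f1 f2] [g1 g2]; split => x.
  by under eq_fun do rewrite cReD; apply: cvgD; [exact: f1|exact: g1].
by under eq_fun do rewrite cImD; apply: cvgD; [exact: f2|exact: g2].
Qed.

Lemma ccontM f g : ccont f -> ccont g -> ccont (fun t => f t * g t).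
Proof.
move=> [f1 f2] [g1 g2]; split => x.
  under eq_fun do rewrite cReM; apply: cvgB; apply: cvgM;
    [exact: f1|exact: g1|exact: f2|exact: g2].
under eq_fun do rewrite cImM; apply: cvgD; apply: cvgM;
  [exact: f1|exact: g2|exact: f2|exact: g1].
Qed.

Lemma ccont_real (h : R -> R) : continuous h -> ccont (fun t => (h t)%:C).
Proof. by move=> ch; split => //= x; exact: cvg_cst. Qed.

Lemma ccont_cexp f : ccont f -> ccont (fun t => cexp (f t)).
Proof.
move=> [f1 f2]; apply: ccontM.
  by apply: ccont_real => x; apply: continuous_comp; [exact: f1|exact: continuous_expR].
by split => x /=; apply: continuous_comp; [exact: f2|exact: continuous_cos|exact: f2|exact: continuous_sin].
Qed.

Lemma cmeasurableM D f g : measurable D -> cmeasurable D f -> cmeasurable D g -> cmeasurable D (fun t => f t * g t).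
Proof.
move=> mD [f1 f2] [g1 g2]; split.
  by under eq_fun do rewrite cReM; apply: measurable_funB => //; apply: measurable_funM.
by under eq_fun do rewrite cImM; apply: measurable_funD => //; apply: measurable_funM.
Qed.

Lemma cmeasurable_sum D (I : Type) (r : seq I) (f : I -> R -> R[i]) : (forall i, cmeasurable D (f i)) ->
  cmeasurable D (fun t => \sum_(i <- r) f i t).
Proof.
move=> H; split.
  under eq_fun do rewrite Re_sum; apply: measurable_sum => i; exact: (H i).1.
under eq_fun do rewrite Im_sum; apply: measurable_sum => i; exact: (H i).2.
Qed.

Lemma cintegrable_dom D f (g : R -> R) : measurable D -> cmeasurable D f ->
  mu.-integrable D (EFin \o g) -> (forall t, D t -> nc (f t) <= g t) -> cintegrable D f.
Proof.
move=> mD [m1 m2] ig H; split; apply: (le_integrable mD _ _ ig) => /=.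
- exact/measurable_EFinP.
- move=> t Dt; rewrite lee_fin; apply: le_trans (Re_le_nc _) _.
  exact: le_trans (H t Dt) (ler_norm _).
- exact/measurable_EFinP.
- move=> t Dt; rewrite lee_fin; apply: le_trans (Im_le_nc _) _.
  exact: le_trans (H t Dt) (ler_norm _).
Qed.

Lemma cintD D f g : measurable D -> cintegrable D f -> cintegrable D g ->
  cint D (fun t => f t + g t) = cint D f + cint D g.
Proof.
move=> mD [f1 f2] [g1 g2]; rewrite /cint; apply: complexP => /=.
  by under eq_Rintegral do rewrite cReD; rewrite RintegralD.
by under eq_Rintegral do rewrite cImD; rewrite RintegralD.
Qed.

Lemma cintegrableD D f g : measurable D -> cintegrable D f -> cintegrable D g -> cintegrable D (fun t => f t + g t).
Proof.
move=> mD [f1 f2] [g1 g2]; split.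
  rewrite (_ : _ \o _ = fun x => (Re (f x))%:E + (Re (g x))%:E)%E; first exact: integrableD.
  by apply/funext => x /=; rewrite cReD EFinD.
rewrite (_ : _ \o _ = fun x => (Im (f x))%:E + (Im (g x))%:E)%E; first exact: integrableD.
by apply/funext => x /=; rewrite cImD EFinD.
Qed.

Lemma integrableZ D (h : R -> R) (k : R) : measurable D -> mu.-integrable D (EFin \o h) ->
  mu.-integrable D (EFin \o (fun t => k * h t)).
Proof.
move=> mD ih; rewrite (_ : _ \o _ = fun x => k%:E * (h x)%:E)%E; first exact: integrableZl.
by apply/funext => x.
Qed.

Lemma integrable_B D (h k : R -> R) : measurable D -> mu.-integrable D (EFin \o h) ->
  mu.-integrable D (EFin \o k) -> mu.-integrable D (EFin \o (fun t => h t - k t)).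
Proof.
move=> mD ih ik; rewrite (_ : _ \o _ = fun x => (h x)%:E - (k x)%:E)%E; first exact: integrableB.
by apply/funext => x /=; rewrite EFinB.
Qed.

Lemma integrable_D D (h k : R -> R) : measurable D -> mu.-integrable D (EFin \o h) ->
  mu.-integrable D (EFin \o k) -> mu.-integrable D (EFin \o (fun t => h t + k t)).
Proof.
move=> mD ih ik; rewrite (_ : _ \o _ = fun x => (h x)%:E + (k x)%:E)%E; first exact: integrableD.
by apply/funext => x /=; rewrite EFinD.
Qed.

Lemma cintZ D f (c : R[i]) : measurable D -> cintegrable D f ->
  cint D (fun t => c * f t) = c * cint D f.
Proof.
move=> mD [f1 f2]; rewrite /cint; apply: complexP; rewrite ?cReM ?cImM /=.
  under eq_Rintegral do rewrite cReM; rewrite RintegralB ?RintegralZl//; exact: integrableZ.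
under eq_Rintegral do rewrite cImM; rewrite RintegralD ?RintegralZl//; exact: integrableZ.
Qed.

Lemma cintegrableZ D f (c : R[i]) : measurable D -> cintegrable D f -> cintegrable D (fun t => c * f t).
Proof.
move=> mD [f1 f2]; split.
  rewrite (_ : (fun t => Re (c * f t)) = fun t => Re c * Re (f t) - Im c * Im (f t)).
    by apply: integrable_B => //; exact: integrableZ.
  by apply/funext => t; rewrite cReM.
rewrite (_ : (fun t => Im (c * f t)) = fun t => Re c * Im (f t) + Im c * Re (f t)).
  by apply: integrable_D => //; exact: integrableZ.
by apply/funext => t; rewrite cImM.
Qed.

Lemma eq_cint D f g : (forall t, D t -> f t = g t) -> cint D f = cint D g.
Proof.
move=> H; rewrite /cint; congr (_ +i* _); apply: eq_Rintegral => t /set_mem Dt;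
  by rewrite H.
Qed.

Lemma cint0 D : cint D (fun=> 0) = 0.
Proof.
rewrite /cint /Rintegral; apply: complexP => /=;
  by rewrite (_ : (fun=> _) = cst 0%E) ?integral0.
Qed.

Lemma cintegrable0 D : measurable D -> cintegrable D (fun=> 0).
Proof.
by move=> mD; split; rewrite (_ : _ \o _ = cst 0%E) //; exact: integrable0.
Qed.

Lemma cintegrable_sum D (I : Type) (r : seq I) (f : I -> R -> R[i]) : measurable D ->
  (forall i, cintegrable D (f i)) -> cintegrable D (fun t => \sum_(i <- r) f i t).
Proof.
move=> mD H; elim: r => [|i r IH].
  by rewrite (_ : (fun t => _) = fun=> 0); [exact: cintegrable0 | apply/funext => t; rewrite big_nil].
rewrite (_ : (fun t => _) = fun t => f i t + \sum_(j <- r) f j t); first exact: cintegrableD.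
by apply/funext => t; rewrite big_cons.
Qed.

Lemma cint_sum D (I : Type) (r : seq I) (f : I -> R -> R[i]) : measurable D ->
  (forall i, cintegrable D (f i)) ->
  cint D (fun t => \sum_(i <- r) f i t) = \sum_(i <- r) cint D (f i).
Proof.
move=> mD H; elim: r => [|i r IH].
  by rewrite big_nil -[RHS](cint0 D); apply: eq_cint => t _; rewrite big_nil.
rewrite big_cons -IH -cintD//; last exact: cintegrable_sum.
by apply: eq_cint => t _; rewrite big_cons.
Qed.

Lemma cint_le D f (g : R -> R) : measurable D -> cmeasurable D f ->
  mu.-integrable D (EFin \o g) -> (forall t, D t -> nc (f t) <= g t) ->
  nc (cint D f) <= 2 * \int[mu]_(t in D) g t.
Proof.
move=> mD mf ig H; have [i1 i2] := cintegrable_dom mD mf ig H.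
have aux (h : R -> R) : mu.-integrable D (EFin \o h) -> (forall t, D t -> `|h t| <= g t) ->
    `|\int[mu]_(t in D) h t| <= \int[mu]_(t in D) g t.
  move=> ih hg; apply: (le_trans (le_normr_Rintegral _ ih)) => //.
  apply: le_Rintegral => //.
  exact: (integrable_abse ih).
apply: (le_trans (nc_le _)); rewrite mulr_natl mulr2n /=; apply: lerD; apply: aux => // t Dt.
  exact: le_trans (Re_le_nc _) (H t Dt).
exact: le_trans (Im_le_nc _) (H t Dt).
Qed.

End ComplexInt.

(** * Termwise integration *)

Section Termwise.
Variable R : realType.
Local Notation mu := (@lebesgue_measure R).
Implicit Types (f : R -> R[i]) (D : set (measurableTypeR R)).

Lemma sums_to_cvg (b : int -> R[i]) (z : R[i]) : sums_to b z ->
  (Re (tsum b N N) @[N --> \oo] --> Re z) /\ (Im (tsum b N N) @[N --> \oo] --> Im z).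
Proof.
move=> H; split; apply/cvgrPdist_le => e e0; have [N0 hN] := H _ e0;
  exists N0 => // N /= NN; rewrite -normrN opprB.
  by rewrite -cReB; apply: le_trans (Re_le_nc _) _; exact: hN.
by rewrite -cImB; apply: le_trans (Im_le_nc _) _; exact: hN.
Qed.

Lemma cmeasurableD D (f g : R -> R[i]) : cmeasurable D f -> cmeasurable D g -> cmeasurable D (fun t => f t + g t).
Proof.
move=> [f1 f2] [g1 g2]; split.
  by under eq_fun do rewrite cReD; apply: measurable_funD.
by under eq_fun do rewrite cImD; apply: measurable_funD.
Qed.

Lemma cmeasurable_tsum D (a : int -> R -> R[i]) m n : (forall n, cmeasurable D (a n)) ->
  cmeasurable D (fun t => tsum (a^~ t) m n).
Proof. by move=> H; apply: cmeasurableD; apply: cmeasurable_sum => i; exact: H. Qed.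

Lemma cmeasurable_zsum D (a : int -> R -> R[i]) : measurable D -> (forall n, cmeasurable D (a n)) ->
  (forall t, D t -> exists C, geo_bounded (a^~ t) C) -> cmeasurable D (fun t => zsum (a^~ t)).
Proof.
move=> mD ma H; split.
  apply: (@measurable_fun_cvg _ _ _ _ (fun N t => Re (tsum (a^~ t) N N))).
    by move=> N; exact: (cmeasurable_tsum _ _ ma).1.
  by move=> t Dt; have [C hC] := H t Dt; exact: (sums_to_cvg (geo_bounded_zsum hC)).1.
apply: (@measurable_fun_cvg _ _ _ _ (fun N t => Im (tsum (a^~ t) N N))).
  by move=> N; exact: (cmeasurable_tsum _ _ ma).2.
by move=> t Dt; have [C hC] := H t Dt; exact: (sums_to_cvg (geo_bounded_zsum hC)).2.
Qed.

Lemma tail_arith (G I x y e : R) : 0 <= G * I -> 0 <= x -> 0 <= y ->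
  x * (2 * (4 * G * I) + 1) <= e -> y * (2 * (4 * G * I) + 1) <= e ->
  2 * (2 * G * (x + y) * I) <= e.
Proof.
move=> w0 x0 y0; have -> : 2 * (2 * G * (x + y) * I) = 4 * (G * I) * (x + y) by ring.
have -> : 2 * (4 * G * I) + 1 = 8 * (G * I) + 1 by ring.
by move: (G * I) w0 => w w0; nra.
Qed.

(** Termwise integration of a series dominated by g t * exp (- |n|): the geometric
    tail bounds make the partial sums converge in the mean. *)
Lemma cint_zsum D (a : int -> R -> R[i]) (g : R -> R) : measurable D ->
  mu.-integrable D (EFin \o g) -> (forall n, cmeasurable D (a n)) ->
  (forall n t, D t -> nc (a n t) <= g t * expR (- `|n|%N%:R)) ->
  sums_to (fun n => cint D (a n)) (cint D (fun t => zsum (a^~ t))).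
Proof.
move=> mD ig ma H.
have gz t : D t -> geo_bounded (a^~ t) (g t) by move=> Dt n; exact: H.
have g0 t : D t -> 0 <= g t by move=> Dt; exact: geo_bounded_ge0 (gz t Dt).
have ia n : cintegrable D (a n).
  apply: (cintegrable_dom mD (ma n) ig) => t Dt; apply: (le_trans (H n t Dt)).
  by rewrite ler_piMr ?g0// expR_le1 oppr_le0.
have mz : cmeasurable D (fun t => zsum (a^~ t)).
  by apply: cmeasurable_zsum => // t Dt; exists (g t); exact: gz.
have igk (k : R) : mu.-integrable D (EFin \o (fun t => k * g t)) by exact: integrableZ.
have iz : cintegrable D (fun t => zsum (a^~ t)).
  apply: (cintegrable_dom mD mz (igk (4 * geo_const R))) => t Dt.
  by apply: le_trans (zsum_le (gz t Dt)) _; rewrite mulrAC.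
have it m n : cintegrable D (fun t => tsum (a^~ t) m n).
  by apply: cintegrableD => //; apply: cintegrable_sum.
have ct m n : cint D (fun t => tsum (a^~ t) m n) = tsum (fun n => cint D (a n)) m n.
  by rewrite /tsum cintD ?cint_sum//; exact: cintegrable_sum.
move=> eps e0.
pose K := 2 * (4 * geo_const R * \int[mu]_(t in D) g t) + 1.
have int0 : 0 <= \int[mu]_(t in D) g t by apply: Rintegral_ge0.
have K0 : 0 < K by rewrite /K ltr_wpDl// !mulr_ge0// ltW// geo_const_gt0.
have [N0 hN] := expRN_small (divr_gt0 e0 K0).
exists N0 => m n hm hn; rewrite -ct.
have -> : cint D (fun t => tsum (a^~ t) m n) - cint D (fun t => zsum (a^~ t)) =
    cint D (fun t => tsum (a^~ t) m n + (-1) * zsum (a^~ t)).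
  by rewrite cintD ?cintZ ?mulN1r//; exact: cintegrableZ.
have mm : cmeasurable D (fun t => tsum (a^~ t) m n + (-1) * zsum (a^~ t)).
  apply: cmeasurableD; first exact: cmeasurable_tsum.
  by apply: cmeasurableM => //; split; exact: measurable_cst.
pose k := 2 * geo_const R * (expR (- n%:R) + expR (- m%:R)).
apply: le_trans (cint_le mD mm (igk k) _) _.
  move=> t Dt; rewrite mulN1r -ncN opprB; apply: le_trans (zsum_tail (gz t Dt) m n) _.
  by rewrite le_eqVlt; apply/orP; left; apply/eqP; rewrite /k; ring.
rewrite RintegralZl//; apply: tail_arith; rewrite ?mulr_ge0 ?expR_ge0 ?(ltW (geo_const_gt0 R))//.
  by have := hN _ hn; rewrite ler_pdivlMr.
by have := hN _ hm; rewrite ler_pdivlMr.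
Qed.

Lemma sums_to_single (a : int -> R[i]) (n0 : int) : (forall n, n != n0 -> a n = 0) ->
  sums_to a (a n0).
Proof.
move=> H; have : sums_to (fun n => a (n + n0)) (a n0).
  move=> eps e0; exists 1%N => m [//|n] _ _.
  rewrite /tsum big_ord_recl /= add0r !big1 ?addr0 ?subrr ?nc0 ?(ltW e0)//.
    by move=> k _; apply: H; lia.
  by move=> k _; apply: H; rewrite /= /bump /=; lia.
move=> /(sums_to_shift (- n0)); congr sums_to; apply/funext => n; congr a; lia.
Qed.

End Termwise.

(** * Unfolding of integrals over the unit interval *)

Section Unfold.
Variable R : realType.
Local Notation mu := (@lebesgue_measure R).
Implicit Types (A f : R -> R[i]) (D : set (measurableTypeR R)).

(** The rate 2 leaves room to split off a factor exp (- |n|) for a series of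
    translates and a factor exp (- |x|) for integrability. *)
Definition decays A (C : R) := forall x, nc (A x) <= C * expR (- (2 * `|x|)).

Lemma abszR (n : int) : (`|n|%N%:R : R) = `|n%:~R|.
Proof. by rewrite natr_absz intr_norm. Qed.

Lemma decays_ge0 A C : decays A C -> 0 <= C.
Proof.
move=> /(_ 0) h; have := le_trans (nc_ge0 _) h.
by rewrite normr0 mulr0 oppr0 expR0 mulr1.
Qed.

Lemma decays_split A C (n : int) (x : R) : decays A C -> `|n%:~R - x| <= 1 ->
  nc (A x) <= C * expR 1 * expR (- `|x|) * expR (- `|n|%N%:R).
Proof.
move=> dA hn; apply: (le_trans (dA x)); rewrite -!mulrA ler_wpM2l ?(decays_ge0 dA)//.
rewrite -!expRD ler_expR abszR; have := ler_normD (n%:~R - x) x; rewrite subrK; lra.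
Qed.

Lemma decays_le A C x : decays A C -> nc (A x) <= C * expm x.
Proof.
move=> dA; apply: (le_trans (dA x)); rewrite ler_wpM2l ?(decays_ge0 dA)//.
by rewrite ler_expR; have := normr_ge0 x; lra.
Qed.

Lemma cintegrable_decays A C : ccont A -> decays A C -> cintegrable setT A.
Proof.
move=> cA dA; apply: (@cintegrable_dom _ _ _ (fun x => C * expm x)) => //.
- exact: ccont_cmeasurable.
- by apply: integrableZ => //; exact: integrable_expm.
- by move=> x _; exact: decays_le.
Qed.

Lemma ccont_affine A (k c : R) : ccont A -> ccont (fun x => A (k * x + c)).
Proof.
move=> [c1 c2]; split => x.
  by apply: (@continuous_comp _ _ _ (fun x => k * x + c) (fun x => Re (A x))); [exact: continuous_affine|exact: c1].
by apply: (@continuous_comp _ _ _ (fun x => k * x + c) (fun x => Im (A x))); [exact: continuous_affine|exact: c2].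
Qed.

Lemma ccont_shift A (c : R) : ccont A -> ccont (fun x => A (x + c)).
Proof.
by move=> /(ccont_affine 1 c); congr ccont; apply/funext => x; rewrite mul1r.
Qed.

Lemma cint_affine A C (k c : R) : 0 < k -> ccont A -> decays A C ->
  cint setT (fun x => A (k * x + c)) = (k^-1)%:C * cint setT A.
Proof.
move=> k0 cA dA; have [i1 i2] := cintegrable_decays cA dA; rewrite /cint.
rewrite (integral_affine c k0 cA.1 i1) (integral_affine c k0 cA.2 i2).
by apply: complexP; rewrite ?cReM ?cImM /= ?mul0r ?subr0 ?addr0.
Qed.

Lemma integrable_cst01 (C : R) : mu.-integrable `[0%R, 1%R] (EFin \o (fun=> C)).
Proof.
apply: continuous_compact_integrable; first exact: segment_compact.
by apply: continuous_subspaceT => x; exact: cvg_cst.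
Qed.

(** The integral over the line is the sum of the integrals over the unit
    intervals [n, n + 1]; it is obtained by integrating termwise the series of the
    restrictions of A to these intervals. *)
Lemma cint_unfold_sums_to A C : ccont A -> decays A C ->
  sums_to (fun n => cint `[0%R, 1%R] (fun t => A (t + n%:~R))) (cint setT A).
Proof.
move=> cA dA; have C0 := decays_ge0 dA.
pose a (n : int) (x : R) : R[i] :=
  ((fun x => Re (A x)) \_ `[n%:~R, n%:~R + 1[) x +i* ((fun x => Im (A x)) \_ `[n%:~R, n%:~R + 1[) x.
have aE (n : int) x : a n x = if n%:~R <= x < n%:~R + 1 then A x else 0.
  rewrite /a /patch mem_setE in_itv /=; case: ifP => _; last exact: complexP.
  by case: (A x).
have az x : sums_to (a^~ x) (A x).
  have -> : A x = a (Num.floor x) x by rewrite aE -intrD1 floor_itv.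
  apply: (@sums_to_single _ (a^~ x)) => n nf; rewrite aE; case: ifP => // h.
  by case/eqP: nf; apply/esym/floor_def; rewrite intrD1.
have H2 : sums_to (fun n => cint setT (a n)) (cint setT A).
  have -> : cint setT A = cint setT (fun x => zsum (a^~ x)).
    by apply: eq_cint => x _; rewrite (sums_to_zsum (az x)).
  apply: (@cint_zsum _ _ a (fun x => C * expR 1 * expm x)) => //.
  - by apply: integrableZ => //; exact: integrable_expm.
  - move=> n; split.
      apply/(@measurable_restrictT _ _ _ _ _ _ _).1 => //; exact: cont_meas cA.1.
    apply/(@measurable_restrictT _ _ _ _ _ _ _).1 => //; exact: cont_meas cA.2.
  - move=> n x _; rewrite aE; case: ifP => [/andP[h1 h2]|_].
      by apply: decays_split => //; rewrite ler_norml; apply/andP; split; lra.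
    by rewrite nc0 !mulr_ge0 ?expR_ge0.
move: H2; congr sums_to; apply/funext => n.
rewrite /cint; congr (_ +i* _).
  rewrite -(integral_shift01 _ cA.1) /a /= -Rintegral_mkcond Rintegral_itv_bndo_bndc//.
  by apply: integrableS (cintegrable_decays cA dA).1.
rewrite -(integral_shift01 _ cA.2) /a /= -Rintegral_mkcond Rintegral_itv_bndo_bndc//.
by apply: integrableS (cintegrable_decays cA dA).2.
Qed.

Lemma cint_unfold A C : ccont A -> decays A C ->
  cint `[0%R, 1%R] (fun t => zsum (fun n => A (t + n%:~R))) = cint setT A.
Proof.
move=> cA dA; have C0 := decays_ge0 dA.
apply: sums_to_uniq (cint_unfold_sums_to cA dA).
apply: (@cint_zsum _ _ (fun n t => A (t + n%:~R)) (fun=> C * expR 1)) => //.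
- exact: integrable_cst01.
- by move=> n; apply: ccont_cmeasurable; exact: ccont_shift.
- move=> n t; rewrite /= in_itv /= => /andP[t0 t1].
  have hn : `|n%:~R - (t + n%:~R)| <= 1 by rewrite opprD addrCA subrr addr0 normrN ger0_norm.
  apply: (le_trans (decays_split dA hn)).
  rewrite ler_wpM2r ?expR_ge0// ler_piMr ?mulr_ge0 ?expR_ge0//.
Qed.

(** Dominated convergence, the bound being uniform in the parameter; this allows one
    to unfold in the two variables one after the other. *)
Lemma cint_param (Phi : R -> R -> R[i]) (C : R) :
  (forall s, ccont (Phi s)) -> (forall t, ccont (Phi^~ t)) ->
  (forall s t, nc (Phi s t) <= C * expR (- (2 * `|s|)) * expR (- (2 * `|t|))) ->
  ccont (fun s => cint setT (Phi s)) /\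
  decays (fun s => cint setT (Phi s)) (2 * C * \int[mu]_x expm x).
Proof.
move=> c1 c2 H.
have C0 : 0 <= C.
  by have := le_trans (nc_ge0 _) (H 0 0); rewrite normr0 mulr0 oppr0 expR0 !mulr1.
have dP s : decays (Phi s) (C * expR (- (2 * `|s|))) by move=> t; exact: H.
have ub s t : nc (Phi s t) <= C * expm t.
  apply: (le_trans (decays_le t (dP s))); rewrite ler_wpM2r ?expR_ge0//.
  by rewrite ler_piMr// expR_le1 oppr_le0 mulr_ge0.
have ie (c : R) : mu.-integrable setT (EFin \o (fun x => c * expm x)).
  by apply: integrableZ => //; exact: integrable_expm.
split.
  split => s; rewrite /cint /=.
    apply: (@continuity_under_integral _ _ _ mu (fun l x => Re (Phi l x)) setT measurableT
      (s - 1) (s + 1) _ _ (fun x => C * expm x)) => //.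
    - by move=> x _; exact: (cintegrable_decays (c1 x) (dP x)).1.
    - by apply: aeW => y _ x _; exact: (c2 y).1.
    - by move=> x _; apply: aeW => y _; exact: le_trans (Re_le_nc _) (ub _ _).
    - by rewrite inE /= in_itv /=; apply/andP; split; lra.
  apply: (@continuity_under_integral _ _ _ mu (fun l x => Im (Phi l x)) setT measurableT
    (s - 1) (s + 1) _ _ (fun x => C * expm x)) => //.
  - by move=> x _; exact: (cintegrable_decays (c1 x) (dP x)).2.
  - by apply: aeW => y _ x _; exact: (c2 y).2.
  - by move=> x _; apply: aeW => y _; exact: le_trans (Im_le_nc _) (ub _ _).
  - by rewrite inE /= in_itv /=; apply/andP; split; lra.
move=> s; apply: le_trans (cint_le _ (ccont_cmeasurable _ (c1 s)) (ie (C * expR (- (2 * `|s|)))) _) _ => //.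
  by move=> t _; exact: decays_le.
rewrite RintegralZl//; last exact: integrable_expm.
by rewrite le_eqVlt; apply/orP; left; apply/eqP; ring.
Qed.

End Unfold.

(** * Theta series in real coordinates *)

Section Theta.
Variable R : realType.
Local Notation toC := (real_complex R).

(** exp (2 pi i z) *)
Definition e2 (z : R[i]) : R[i] := cexp (2 * pii * z).

Lemma e2D z w : e2 (z + w) = e2 z * e2 w.
Proof. by rewrite /e2 mulrDr cexpD. Qed.
Lemma e20 : e2 0 = 1. Proof. by rewrite /e2 mulr0 cexp0. Qed.
Lemma e2N z : e2 (- z) = (e2 z)^-1. Proof. by rewrite /e2 mulrN cexpN. Qed.
Lemma e2_neq0 z : e2 z != 0. Proof. exact: cexp_neq0. Qed.
Lemma e21 : e2 1 = 1.
Proof.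
have -> : e2 1 = cexp (0 +i* (pi *+ 2)).
  by rewrite /e2 mulr1; congr cexp; rewrite /pii; apply: complexP;
    rewrite !(cReM, cImM) /=; ring.
by rewrite /cexp /= expR0 cos2pi sin2pi mul1r.
Qed.
Lemma e2_nat (n : nat) : e2 n%:R = 1.
Proof. by elim: n => [|n IH]; rewrite ?e20// -natr1 e2D IH e21 mulr1. Qed.
Lemma e2_int (n : int) : e2 n%:~R = 1.
Proof.
case: n => n; first exact: e2_nat.
by rewrite NegzE mulrNz e2N -[_%:~R]/(n.+1%:R) e2_nat invr1.
Qed.
Lemma e2Z (n : int) z : e2 (n%:~R * z) = e2 z ^ n.
Proof. by rewrite /e2 mulrCA cexpXz. Qed.
Lemma nc_e2 z : nc (e2 z) = expR (- (2 * pi * Im z)).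
Proof.
rewrite /e2 nc_cexp; congr expR.
by rewrite !(cReM, cImM) /= !(mulr0, mul0r, mulr1, addr0, subr0, oppr0, sub0r, add0r); ring.
Qed.

(** A term of the theta series with characteristics, in the coordinates x, y of
    u = x om1 + y om2 and multiplied by exp (- pi lambda |u|^2).  This factor
    makes the modulus independent of y.  The index of the series is n and
    N = n + rho. *)
Definition theta_term (tau : R[i]) (mu sg N x y : R) : R[i] :=
  e2 (toC (mu / 2 * (N + x) ^+ 2) * tau + toC (N * (mu * y + sg) + mu / 2 * x * y)).

Definition theta_twist tau (mu rho sg x y : R) : R[i] :=
  zsum (fun n => theta_term tau mu sg (n%:~R + rho) x y).

Lemma nc_theta_term tau mu sg N x y :
  nc (theta_term tau mu sg N x y) = expR (- (pi * mu * Im tau * (N + x) ^+ 2)).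
Proof.
rewrite /theta_term nc_e2 cImD cImM /= mul0r addr0; congr expR.
by rewrite addr0; field.
Qed.

Lemma quad_ge (a b z : R) : 0 < a -> - (a * z ^+ 2) <= b ^+ 2 / (4 * a) - b * `|z|.
Proof.
move=> a0; rewrite -subr_ge0.
have -> : b ^+ 2 / (4 * a) - b * `|z| - - (a * z ^+ 2) = a * (`|z| - b / (2 * a)) ^+ 2.
  by rewrite -(real_normK (num_real z)); field; rewrite gt_eqF.
by rewrite mulr_ge0 ?sqr_ge0// ltW.
Qed.

(** A Gaussian decays faster than any exponential; completing the square gives the
    constant. *)
Lemma gauss_geo (a B x : R) (n : int) : 0 < a -> `|x| <= B ->
  expR (- (a * (n%:~R + x) ^+ 2)) <= expR (1 / (4 * a) + B) * expR (- `|n|%N%:R).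
Proof.
move=> a0 xB; rewrite -expRD ler_expR abszR.
apply: (le_trans (quad_ge 1 _ a0)); rewrite expr1n mul1r.
by have := ler_normB (n%:~R + x) x; rewrite addrK; lra.
Qed.

Section Fixed.
Variables (tau : R[i]) (mu : nat).
Hypotheses (mu0 : (0 < mu)%N) (tau0 : 0 < Im tau).

Let a := pi * mu%:R * Im tau.
Lemma theta_term_rate_gt0 : 0 < pi * mu%:R * Im tau.
Proof. by rewrite !mulr_gt0 ?pi_gt0 ?ltr0n. Qed.

Lemma theta_term_geo_bounded (sg rho x y B : R) : `|rho + x| <= B ->
  geo_bounded (fun n => theta_term tau mu%:R sg (n%:~R + rho) x y) (expR (1 / (4 * a) + B)).
Proof. by move=> h n; rewrite nc_theta_term -addrA; apply: gauss_geo => //; exact: theta_term_rate_gt0. Qed.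

Lemma e2_muZ (k n : int) : e2 (toC (k%:~R * mu%:R * n%:~R)) = 1.
Proof.
have -> : toC (k%:~R * mu%:R * n%:~R) = (k * mu%:Z * n)%:~R.
  by rewrite !rmorphM /= !rmorph_int rmorph_nat.
exact: e2_int.
Qed.

(** The constant part, in units of 2 pi i, of the phase by which the series is
    multiplied under (x, y) |-> (x + p, y + p'): modulo 1 it is the logarithm of
    psi at p om1 + p' om2. *)
Definition thchar (rho sg : R) (p p' : int) : R :=
  - (p%:~R * sg) + p'%:~R * mu%:R * rho - mu%:R / 2 * p%:~R * p'%:~R.

(** Shifting the summation index by p absorbs the translation of x; the translation
    of y gives a phase that is the same for all terms, as mu is an integer. *)
Lemma theta_twist_auto (rho sg x y : R) (p p' : int) :
  theta_twist tau mu%:R rho sg (x + p%:~R) (y + p'%:~R) =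
  e2 (toC (mu%:R / 2 * (p'%:~R * x - p%:~R * y) + thchar rho sg p p')) *
    theta_twist tau mu%:R rho sg x y.
Proof.
set c := e2 _; pose b n := theta_term tau mu%:R sg (n%:~R + rho) x y.
have hb : sums_to b (theta_twist tau mu%:R rho sg x y).
  exact: (geo_bounded_zsum (theta_term_geo_bounded sg y (lexx _))).
apply: sums_to_zsum; have := sums_to_shift p (sums_toZ c hb); congr sums_to; apply/funext => n.
rewrite /b /c /theta_term -e2D.
rewrite -[LHS]mulr1 -(e2_muZ p' (n + p)) -e2D; congr e2.
by apply: complexP; rewrite !(cReD, cImD, cReM, cImM) /= /thchar intrD; field.
Qed.

(** By automorphy x may be taken in [0, 1), where the Gaussian bound is uniform. *)
Lemma theta_twist_bounded (rho sg : R) : exists K, forall x y, nc (theta_twist tau mu%:R rho sg x y) <= K.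
Proof.
exists (4 * expR (1 / (4 * a) + (`|rho| + 1)) * geo_const R) => x y.
pose p := Num.floor x; pose x0 := x - p%:~R.
have x01 : `|x0| <= 1.
  have /andP[h1 h2] := floor_itv x; rewrite intrD1 in h2.
  by rewrite /x0 ger0_norm /p; lra.
have -> : x = x0 + p%:~R by rewrite /x0 subrK.
have -> : y = y + (0 : int)%:~R by rewrite addr0.
rewrite theta_twist_auto ncM nc_e2 /= mulr0 oppr0 expR0 [leLHS]mul1r.
rewrite /theta_twist; apply: zsum_le; apply: theta_term_geo_bounded; apply: (le_trans (ler_normD _ _)); lra.
Qed.

Lemma ccont_theta_term (sg N x0 x1 y0 y1 : R) :
  ccont (fun t => theta_term tau mu%:R sg N (x0 + x1 * t) (y0 + y1 * t)).
Proof.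
have ca (k c : R) : continuous (fun t : R => c + k * t).
  rewrite (_ : (fun t : R => c + k * t) = fun t => k * t + c); first exact: continuous_affine.
  by apply/funext => t; rewrite addrC.
apply: ccont_cexp; apply: ccontM; first exact: ccont_cst.
apply: ccontD.
  apply: ccontM; last exact: ccont_cst.
  apply: ccont_real => t; apply: cvgM; first exact: cvg_cst.
  rewrite (_ : (fun t => _) = (fun t => (N + x0 + x1 * t) * (N + x0 + x1 * t))).
    by rewrite addrA expr2; apply: cvgM; exact: ca.
  by apply/funext => u; rewrite addrA expr2.
apply: ccont_real => t; apply: cvgD.
  apply: cvgM; first exact: cvg_cst.
  by apply: cvgD; last exact: cvg_cst; apply: cvgM; [exact: cvg_cst|exact: ca].
by apply: cvgM; last exact: ca; apply: cvgM; [exact: cvg_cst|exact: ca].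
Qed.

Lemma cmeasurable_theta_twist (rho sg x0 x1 y0 y1 : R) :
  cmeasurable setT (fun t => theta_twist tau mu%:R rho sg (x0 + x1 * t) (y0 + y1 * t)).
Proof.
apply: cmeasurable_zsum => //.
  by move=> n; apply: ccont_cmeasurable; exact: ccont_theta_term.
by move=> t _; eexists; apply: theta_term_geo_bounded; exact: lexx.
Qed.

End Fixed.
End Theta.

(** * The fundamental theorem of calculus for complex values *)

Section FTC.
Variable R : realType.
Local Notation mu := (@lebesgue_measure R).
Local Notation toC := (real_complex R).
Local Notation int01 := (cint (`[0%R, 1%R] : set (measurableTypeR R))).

Lemma integral01_deriv (f F : R -> R) : continuous f -> (forall x : R, is_derive x 1 F (f x)) ->
  \int[mu]_(t in `[0%R, 1%R]) f t = F 1 - F 0.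
Proof.
move=> cf dF; rewrite /Rintegral (@continuous_FTC2 _ f F 0 1 ltr01)//.
- exact: continuous_subspaceT.
- split.
  + by move=> x _; have [] := dF x.
  + by apply: cvg_at_right_filter; exact: (is_derive_cont (dF 0)).
  + by apply: cvg_at_left_filter; exact: (is_derive_cont (dF 1)).
- by move=> x _; rewrite derive1E; have [_ ->] := dF x.
Qed.

Lemma cint01_deriv (f F : R -> R[i]) : ccont f ->
  (forall x, exists C, forall h, `|h| <= 1 ->
     nc (F (x + h) - F x - toC h * f x) <= C * h ^+ 2) ->
  int01 f = F 1 - F 0.
Proof.
move=> [c1 c2] H; apply: complexP; rewrite ?cReB ?cImB /=.
  apply: (@integral01_deriv _ (fun t => Re (F t)) c1) => x; have [C hC] := H x.
  apply: (@quad_is_derive _ (fun x => Re (F x)) x _ C 1) => // h h1.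
  have := le_trans (Re_le_nc _) (hC h h1).
  by rewrite !cReB cReM /= mul0r subr0.
apply: (@integral01_deriv _ (fun t => Im (F t)) c2) => x; have [C hC] := H x.
apply: (@quad_is_derive _ (fun x => Im (F x)) x _ C 1) => // h h1.
have := le_trans (Im_le_nc _) (hC h h1).
by rewrite !cImB cImM /= mul0r addr0.
Qed.

Lemma pii_neq0 : (pii : R[i]) != 0.
Proof.
rewrite /pii mulf_neq0//; first by rewrite fmorph_eq0 gt_eqF ?pi_gt0.
by apply/eqP => -[/eqP]; rewrite oner_eq0.
Qed.

Lemma nc_e2_real (x : R) : nc (e2 (toC x)) = 1.
Proof. by rewrite nc_e2 /= mulr0 oppr0 expR0. Qed.

(** A nontrivial character of the circle integrates to zero, by the fundamental
    theorem of calculus. *)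
Lemma int01_char (k : R) : k != 0 -> e2 (toC k) = 1 -> int01 (fun t => e2 (toC (k * t))) = 0.
Proof.
move=> k0 ek.
pose w : R[i] := 2 * pii * toC k.
have w0 : w != 0.
  by apply: mulf_neq0; [apply: mulf_neq0; [rewrite pnatr_eq0|exact: pii_neq0]|rewrite fmorph_eq0].
have ce : ccont (fun t => e2 (toC (k * t))).
  apply: ccont_cexp; apply: ccontM; first exact: ccont_cst.
  apply: ccont_real => t; apply: cvgM; [exact: cvg_cst|exact: cvg_id].
have := @cint01_deriv (fun t => e2 (toC (k * t))) (fun t => w^-1 * e2 (toC (k * t))) ce.
rewrite mulr1 mulr0 ek e20 subrr; apply => x.
exists (nc w^-1 * (5 * nc w ^+ 2 * expR (nc w))) => h h1.
have -> : w^-1 * e2 (toC (k * (x + h))) - w^-1 * e2 (toC (k * x)) - toC h * e2 (toC (k * x)) =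
   w^-1 * (e2 (toC (k * x)) * (cexp (toC h * w) - 1 - toC h * w)).
  have -> : e2 (toC (k * (x + h))) = e2 (toC (k * x)) * cexp (toC h * w).
    by rewrite mulrDr rmorphD /= e2D; congr (_ * _); rewrite /e2 /w rmorphM; congr cexp; ring.
  by field.
rewrite ncM -[leRHS]mulrA ler_wpM2l ?nc_ge0// ncM nc_e2_real mul1r.
apply: (le_trans (cexp1D_le _)); rewrite ncM nc_real exprMn real_normK ?num_real//.
have e : expR (`|h| * nc w) <= expR (nc w) by rewrite ler_expR ler_piMl ?nc_ge0.
have n0 : 0 <= 5 * (h ^+ 2 * nc w ^+ 2) by apply: mulr_ge0; [exact: ler0n|apply: mulr_ge0; exact: sqr_ge0].
by apply: (le_trans (ler_wpM2l n0 e)); rewrite le_eqVlt; apply/orP; left; apply/eqP; ring.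
Qed.

End FTC.

(** * The period integral of a product of two theta series *)

Section Pairing.
Variable R : realType.
Local Notation toC := (real_complex R).
Local Notation int01 := (cint (`[0%R, 1%R] : set (measurableTypeR R))).

(** The bases are related by - conj om1' = p om1 + p' om2 and
    - conj om2' = q om1 + q' om2. *)
Variables (tau tau' : R[i]) (p p' q q' : int).
Hypotheses (tau_gt0 : 0 < Im tau) (tau'_gt0 : 0 < Im tau').
Hypothesis det : p * q' - p' * q = -1.

Let P : R := p%:~R. Let P' : R := p'%:~R. Let Q : R := q%:~R. Let Q' : R := q'%:~R.

Let detR : P' * Q = P * Q' + 1.
Proof.
rewrite /P /P' /Q /Q' -!rmorphM -[1]/(1%:~R) -rmorphD /=; congr (_%:~R); lia.
Qed.

Let itv01 (t : R) : [set` `[0%R, 1%R]] t -> 0 <= t <= 1.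
Proof. by rewrite /= in_itv. Qed.

Section FixedMu.
Variables (mu : nat) (rho sg rho' sg' : R).
Hypothesis mu0 : (0 < mu)%N.

Let F s t := theta_twist tau' mu%:R rho' sg' s t *
  theta_twist tau mu%:R rho sg (P * s + Q * t) (P' * s + Q' * t).

(** The integral over a period parallelogram that computes the Serre pairing of
    the transform of one theta function with another. *)
Definition pairing_int : R[i] := int01 (fun s => int01 (fun t => F s t)).

Hypothesis char1 : e2 (toC (sg' - thchar mu rho sg p p')) = 1.
Hypothesis char2 : e2 (toC (mu%:R * rho' + thchar mu rho sg q q')) = 1.

Let cn (n : int) (s : R) : R[i] := int01 (fun t => theta_term tau' mu%:R sg' (n%:~R + rho') s t *
  theta_twist tau mu%:R rho sg (P * s + Q * t) (P' * s + Q' * t)).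

(** The contribution of the central term of the first theta series. *)
Definition coef0 (s : R) : R[i] := int01 (fun t => theta_term tau' mu%:R sg' rho' s t *
  theta_twist tau mu%:R rho sg (P * s + Q * t) (P' * s + Q' * t)).

Let cn1 n s : cn (n + 1) s = cn n (s + 1).
Proof.
apply: eq_cint => t _.
have -> : P * (s + 1) + Q * t = (P * s + Q * t) + p%:~R by rewrite /P; ring.
have -> : P' * (s + 1) + Q' * t = (P' * s + Q' * t) + p'%:~R by rewrite /P'; ring.
rewrite (theta_twist_auto mu0 tau_gt0) mulrA; congr (_ * _).
rewrite /theta_term -e2D -[RHS]mul1r -char1 -e2D; congr e2.
have dt : (p'%:~R : R) * (P * s + Q * t) - p%:~R * (P' * s + Q' * t) = t.
  rewrite -/P -/P'; have -> : P' * (P * s + Q * t) - P * (P' * s + Q' * t) = (P' * Q - P * Q') * t by ring.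
  by rewrite detR; ring.
rewrite dt.
by apply: complexP; rewrite !(cReD, cImD, cReM, cImM) /= intrD; field.
Qed.

Let cnE n s : cn n s = coef0 (s + n%:~R).
Proof.
have c0E s1 : coef0 s1 = cn 0 s1 by rewrite /cn add0r.
elim/int_rect: n s => [|n IH|n IH] s.
- by rewrite addr0 c0E.
- by rewrite -addn1 PoszD cn1 IH; congr coef0; rewrite intrD; ring.
- have -> : cn (- n.+1%:Z) s = cn (- n.+1%:Z + 1) (s - 1) by rewrite cn1 subrK.
  have -> : - n.+1%:Z + 1 = - n%:Z by lia.
  by rewrite IH; congr coef0; rewrite -addn1 PoszD opprD intrD; ring.
Qed.

(** Unfolding in s.  The term of index n of the first series is the central term
    translated by n in s; the second series is invariant under this translation up
    to a character, which char1 says is the one of the first series.  So the sum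
    over n of integrals over [0, 1] is one integral over the line. *)
Lemma pairing_unfold C : ccont coef0 -> decays coef0 C -> pairing_int = cint setT coef0.
Proof.
move=> c0 d0; rewrite -(cint_unfold c0 d0); apply: eq_cint => s _.
have [K hK] := theta_twist_bounded mu0 tau_gt0 rho sg.
have K0 : 0 <= K := le_trans (nc_ge0 _) (hK 0 0).
have geo t := theta_term_geo_bounded mu0 tau'_gt0 sg' t (lexx `|rho' + s|).
set c := expR _ in geo.
have mF : cmeasurable setT (fun t => theta_twist tau mu%:R rho sg (P * s + Q * t) (P' * s + Q' * t)).
  exact: cmeasurable_theta_twist.
have mt n : cmeasurable setT (fun t => theta_term tau' mu%:R sg' (n%:~R + rho') s t).
  rewrite (_ : (fun t => _) = fun t => theta_term tau' mu%:R sg' (n%:~R + rho') (s + 0 * t) (0 + 1 * t)).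
    by apply: ccont_cmeasurable; exact: ccont_theta_term.
  by apply/funext => t; rewrite mul0r addr0 add0r mul1r.
have h : sums_to (fun n => cn n s) (int01 (fun t => zsum (fun n => theta_term tau' mu%:R sg' (n%:~R + rho') s t *
    theta_twist tau mu%:R rho sg (P * s + Q * t) (P' * s + Q' * t)))).
  apply: (@cint_zsum _ _ _ (fun=> c * K)) => //.
  - exact: integrable_cst01.
  - move=> n; have [h1 h2] := cmeasurableM measurableT (mt n) mF.
    by split; exact: measurable_funTS.
  - move=> n t _; rewrite ncM -mulrA (mulrC K) mulrA; apply: ler_pM; rewrite ?nc_ge0//.
    exact: geo.
transitivity (int01 (fun t => zsum (fun n => theta_term tau' mu%:R sg' (n%:~R + rho') s t *
    theta_twist tau mu%:R rho sg (P * s + Q * t) (P' * s + Q' * t)))).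
  apply: eq_cint => t _; apply/esym/sums_to_zsum; rewrite /F [X in sums_to _ X]mulrC.
  have := geo_bounded_zsum (geo t); rewrite -/(theta_twist tau' mu%:R rho' sg' s t).
  move=> /(sums_toZ (theta_twist tau mu%:R rho sg (P * s + Q * t) (P' * s + Q' * t))).
  by congr (sums_to _ _); apply/funext => n; rewrite [RHS]mulrC.
transitivity (zsum (fun n => cn n s)); first by rewrite (sums_to_zsum h).
have E : (fun n => cn n s) = (fun n => coef0 (s + n%:~R)).
  by apply/funext => n; exact: cnE.
exact: (congr1 (@zsum R) E).
Qed.

(** The quadratic part of the phase of a product of two terms. *)
Definition qform (s t : R) : R := (s * t + (P * s + Q * t) * (P' * s + Q' * t)) / 2.

(** When q is nonzero, the product of the central term of the first series with the
    term of index M of the second one is, up to a constant of modulus 1, the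
    translate of this single Gaussian by rho' in s and by (M - p rho') / q in t. *)
Definition Phi (m s t : R) : R[i] :=
  e2 (toC (m / 2 * s ^+ 2) * tau' + toC (m / 2 * (P * s + Q * t) ^+ 2) * tau +
      toC (m * qform s t)).

Definition shiftT (M : R) : R := (M - P * rho') / Q.

(** The phase of that constant; it is rational when the characteristics are. *)
Definition zeta (M : R) : R :=
  rho' * sg' + M * sg - mu%:R * qform rho' (shiftT M).

Let qform_shift (m s t T : R) :
  rho' * (m * t + sg') + m / 2 * s * t +
    ((P * rho' + Q * T) * (m * (P' * s + Q' * t) + sg) +
     m / 2 * (P * s + Q * t) * (P' * s + Q' * t)) =
  rho' * sg' + (P * rho' + Q * T) * sg - m * qform rho' T +
    m * qform (s + rho') (t + T).
Proof.
apply/eqP; rewrite -subr_eq0; apply/eqP.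
(* The two sides differ by a multiple of the determinant relation. *)
have e : m / 2 * (T * s - rho' * t) * (P' * Q - P * Q' - 1) = 0 by rewrite detR; ring.
by rewrite -[RHS]e /qform; field.
Qed.

Lemma theta_term_Phi (M s t : R) : Q != 0 ->
  theta_term tau' mu%:R sg' rho' s t * theta_term tau mu%:R sg M (P * s + Q * t) (P' * s + Q' * t) =
  e2 (toC (zeta M)) * Phi mu%:R (s + rho') (t + shiftT M).
Proof.
move=> q0.
have MT : M = P * rho' + Q * shiftT M by rewrite /shiftT; field.
have -> : zeta M = rho' * sg' + (P * rho' + Q * shiftT M) * sg - mu%:R * qform rho' (shiftT M).
  by rewrite -MT.
rewrite {1}MT; move: (shiftT M) => T.
have eX : P * rho' + Q * T + (P * s + Q * t) = P * (s + rho') + Q * (t + T) by ring.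
rewrite /theta_term /Phi -!e2D eX (addrC rho' s); congr e2.
rewrite addrACA -rmorphD /= (qform_shift mu%:R s t T) rmorphD /=.
exact: addrCA.
Qed.

(** The modulus is a positive definite Gaussian because q is nonzero: s and
    p s + q t are independent coordinates. *)
Lemma nc_Phi_le (m : R) : 0 < m -> Q != 0 -> exists C, forall s t,
  nc (Phi m s t) <= C * expR (- (2 * `|s|)) * expR (- (2 * `|t|)).
Proof.
move=> m0 q0.
have Q1 : 1 <= `|Q|.
  have qz : q != 0 by move: q0; rewrite /Q intr_eq0.
  by rewrite /Q -intr_norm -[1]/(1%:~R) ler_int; lia.
pose a := pi * m * Im tau; pose a' := pi * m * Im tau'.
have a0 : 0 < a by rewrite !mulr_gt0 ?pi_gt0.
have a'0 : 0 < a' by rewrite !mulr_gt0 ?pi_gt0.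
pose b := 2 + 2 * `|P|.
exists (expR (b ^+ 2 / (4 * a') + 2 ^+ 2 / (4 * a))) => s t.
rewrite /Phi nc_e2 -!expRD ler_expR.
rewrite !(cImD, cImM) /= !(mul0r, addr0).
have -> : - (2 * pi * (m / 2 * s ^+ 2 * Im tau' + m / 2 * (P * s + Q * t) ^+ 2 * Im tau)) =
  - (a' * s ^+ 2) + - (a * (P * s + Q * t) ^+ 2) by rewrite /a /a'; field.
apply: (le_trans (lerD (quad_ge b s a'0) (quad_ge 2 (P * s + Q * t) a0))).
have ht : `|t| <= `|P * s + Q * t| + `|P| * `|s|.
  apply: (@le_trans _ _ (`|Q| * `|t|)); first by rewrite ler_peMl.
  rewrite -!normrM; have := ler_normB (P * s + Q * t) (P * s).
  by have -> : P * s + Q * t - P * s = Q * t by ring.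
rewrite /b; lra.
Qed.

Lemma ccont_quad (m s0 s1 t0 t1 : R) : ccont (fun x => Phi m (s0 + s1 * x) (t0 + t1 * x)).
Proof.
have ca (k c : R) : continuous (fun t : R => c + k * t).
  rewrite (_ : (fun t : R => c + k * t) = fun t => k * t + c); first exact: continuous_affine.
  by apply/funext => t; rewrite addrC.
have cM (f g : R -> R) : continuous f -> continuous g -> continuous (fun x => f x * g x).
  by move=> cf cg x; apply: cvgM; [exact: cf|exact: cg].
have cD (f g : R -> R) : continuous f -> continuous g -> continuous (fun x => f x + g x).
  by move=> cf cg x; apply: cvgD; [exact: cf|exact: cg].
have cc (c : R) : continuous (fun _ : R => c) by move=> x; exact: cvg_cst.
have c2 (f : R -> R) : continuous f -> continuous (fun x => f x ^+ 2).
  by move=> cf; rewrite (_ : (fun x => _) = fun x => f x * f x); [exact: (cM)|apply/funext].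
have cX (u v : R) : continuous (fun x => u * (s0 + s1 * x) + v * (t0 + t1 * x)).
  by apply: (cD); apply: (cM) => //; exact: ca.
apply: ccont_cexp; apply: ccontM; first exact: ccont_cst.
apply: ccontD.
  apply: ccontD; apply: ccontM; try exact: ccont_cst; apply: ccont_real; apply: (cM) => //.
    by apply: (c2); exact: ca.
  by apply: (c2); exact: cX.
apply: ccont_real; apply: (cM) => //; apply: (cM) => //.
apply: (cD); first by apply: (cM); exact: ca.
by apply: (cM); exact: cX.
Qed.

(** By char2 the phase depends on the index only modulo q. *)
Lemma zeta_shift1 (m : int) : Q != 0 ->
  e2 (toC (zeta (m%:~R + rho + Q))) = e2 (toC (zeta (m%:~R + rho))).
Proof.
move=> q0.
have e : zeta (m%:~R + rho + Q) = zeta (m%:~R + rho) +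
    - (mu%:R * rho' + thchar mu rho sg q q') + - ((m + q)%:~R * mu%:R * q'%:~R).
  apply/eqP; rewrite -subr_eq0; apply/eqP.
  have h : - (mu%:R / 2 * rho' * (P' * Q - P * Q' - 1)) = 0 by rewrite detR; ring.
  rewrite -[RHS]h /zeta /thchar /qform /shiftT -/Q -/Q' intrD -/Q.
  by field.
rewrite e 2!rmorphD 2!rmorphN 2!e2D 2!e2N char2.
by rewrite (e2_muZ R mu (m + q) q') invr1 !mulr1.
Qed.

Lemma zeta_shift (m n : int) : Q != 0 ->
  e2 (toC (zeta ((m + q * n)%:~R + rho))) = e2 (toC (zeta (m%:~R + rho))).
Proof.
move=> q0.
have h1 k : e2 (toC (zeta ((k + q)%:~R + rho))) = e2 (toC (zeta (k%:~R + rho))).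
  by rewrite intrD addrAC zeta_shift1.
elim/int_rect: n m => [|n IH|n IH] m; first by rewrite mulr0 addr0.
  have -> : m + q * n.+1%:Z = (m + q * n%:Z) + q by lia.
  by rewrite h1 IH.
have -> : m + q * - n.+1%:Z = (m - q) + q * - n%:Z by lia.
by rewrite IH -(h1 (m - q)) subrK.
Qed.

Definition Iint (m s : R) : R[i] := cint setT (Phi m s).

Lemma ccont_Phi_t (m s : R) : ccont (Phi m s).
Proof.
have := ccont_quad m s 0 0 1; congr ccont; apply/funext => t.
by rewrite mul0r addr0 add0r mul1r.
Qed.

Lemma ccont_Phi_s (m t : R) : ccont (Phi m ^~ t).
Proof.
have := ccont_quad m 0 1 t 0; congr ccont; apply/funext => s.
by rewrite mul0r addr0 add0r mul1r.
Qed.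

Lemma Iint_regular (m : R) : 0 < m -> Q != 0 ->
  ccont (Iint m) /\ exists C, decays (Iint m) C.
Proof.
move=> m0 q0; have [C hC] := nc_Phi_le m0 q0.
have [h1 h2] := cint_param (ccont_Phi_t m) (ccont_Phi_s m) hC.
by split => //; eexists; exact: h2.
Qed.

Definition Zsum : R[i] := \sum_(l < `|q|%N) e2 (toC (zeta ((l : nat)%:Z%:~R + rho))).

Lemma coef0_sums_to (s : R) : sums_to (fun m : int => int01 (fun t =>
  theta_term tau' mu%:R sg' rho' s t *
  theta_term tau mu%:R sg (m%:~R + rho) (P * s + Q * t) (P' * s + Q' * t))) (coef0 s).
Proof.
have geo t : 0 <= t <= 1 -> geo_bounded (fun n => theta_term tau mu%:R sg (n%:~R + rho) (P * s + Q * t) (P' * s + Q' * t))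
  (expR (1 / (4 * (pi * mu%:R * Im tau)) + (`|rho| + (`|P * s| + `|Q|)))).
  move=> /andP[t0 t1]; apply: theta_term_geo_bounded => //.
  apply: (le_trans (ler_normD _ _)); rewrite lerD2l.
  apply: (le_trans (ler_normD _ _)); rewrite lerD2l normrM ler_piMr//.
  by rewrite ger0_norm.
have th1 t : nc (theta_term tau' mu%:R sg' rho' s t) <= 1.
  rewrite nc_theta_term expR_le1 oppr_le0 mulr_ge0 ?sqr_ge0//.
  by rewrite !mulr_ge0 ?pi_ge0 ?(ltW tau'_gt0).
rewrite (_ : coef0 s = int01 (fun t => zsum (fun m => theta_term tau' mu%:R sg' rho' s t *
  theta_term tau mu%:R sg (m%:~R + rho) (P * s + Q * t) (P' * s + Q' * t)))).
  apply: (@cint_zsum _ _ _ (fun=> expR (1 / (4 * (pi * mu%:R * Im tau)) + (`|rho| + (`|P * s| + `|Q|))))) => //.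
  - exact: integrable_cst01.
  - move=> n; apply: ccont_cmeasurable; apply: ccontM; last exact: ccont_theta_term.
    have := ccont_theta_term tau' mu sg' rho' s 0 0 1; congr ccont; apply/funext => t.
    by rewrite mul0r addr0 add0r mul1r.
  - move=> n t /itv01 t01; rewrite ncM.
    apply: le_trans (geo t t01 n); rewrite ler_piMl ?nc_ge0//.
  apply: eq_cint => t /itv01 t01; apply/esym/sums_to_zsum.
  by apply: sums_toZ; exact: geo_bounded_zsum (geo t t01).
Qed.

(** Unfolding in t.  The indices congruent to l modulo q give the translates of one
    function of t by all integers, so their integrals over [0, 1] add up to an
    integral over the line; there are |q| classes. *)
Lemma coef0_Iint (s : R) : Q != 0 -> coef0 s = Zsum * Iint mu%:R (s + rho').
Proof.
move=> q0.
have mR : 0 < mu%:R :> R by rewrite ltr0n.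
have qz : q != 0 by move: q0; rewrite /Q intr_eq0.
have [C hC] := nc_Phi_le mR q0.
pose b (m : int) := int01 (fun t => theta_term tau' mu%:R sg' rho' s t *
  theta_term tau mu%:R sg (m%:~R + rho) (P * s + Q * t) (P' * s + Q' * t)).
have hb : sums_to b (coef0 s) := coef0_sums_to s.
rewrite /Zsum mulr_suml; apply: (sums_to_regroup _ hb); first by rewrite absz_gt0.
move=> l; set M := (l : nat)%:Z%:~R + rho.
pose A x := Phi mu%:R (s + rho') (x + shiftT M).
have dA0 : decays (Phi mu%:R (s + rho')) (C * expR (- (2 * `|s + rho'|))) by move=> t; exact: hC.
have IA : cint setT A = Iint mu%:R (s + rho').
  have := cint_affine (shiftT M) ltr01 (ccont_Phi_t mu%:R (s + rho')) dA0.
  rewrite invr1 mul1r /Iint => <-; apply: eq_cint => t _.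
  by rewrite /A mul1r.
have cA : ccont A by exact: ccont_shift (ccont_Phi_t _ _).
have [C' dA] : exists C', decays A C'.
  exists (C * expR (- (2 * `|s + rho'|)) * expR (2 * `|shiftT M|)) => x.
  apply: (le_trans (dA0 _)); rewrite -!mulrA -!expRD ler_wpM2l//.
    have := le_trans (nc_ge0 _) (dA0 0); rewrite pmulr_lge0 ?expR_gt0// pmulr_lge0 ?expR_gt0//.
  rewrite ler_expR; have := ler_normB (x + shiftT M) (shiftT M); rewrite addrK; lra.
have hA := sums_toZ (e2 (toC (zeta M))) (cint_unfold_sums_to cA dA).
rewrite IA in hA.
have igA (n : int) : cintegrable `[0%R, 1%R] (fun t => A (t + n%:~R)).
  have cAn := ccont_cmeasurable `[0%R, 1%R] (ccont_shift n%:~R cA).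
  apply: (cintegrable_dom (measurable_itv _) cAn (integrable_cst01 C')) => t _.
  by apply: (le_trans (dA _)); rewrite ler_piMr ?(decays_ge0 dA).
have bE n : b (q * n + (l : nat)%:Z) = e2 (toC (zeta M)) * int01 (fun t => A (t + n%:~R)).
  rewrite -(cintZ _ (measurable_itv _) (igA n)).
  apply: eq_cint => t _; rewrite theta_term_Phi// (addrC (q * n)) zeta_shift//; congr (_ * _).
  rewrite /A; congr Phi; rewrite -addrA; congr (_ + _).
  by rewrite /M /shiftT addrC intrD intrM -/Q; field.
have qE : (`|q|%N%:Z = q) \/ (`|q|%N%:Z = - q) by lia.
case: qE => qE.
  by move: hA; congr sums_to; apply/funext => n; rewrite qE bE.
have := sums_to_opp hA; congr sums_to; apply/funext => n.
by rewrite qE mulNr -mulrN bE.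
Qed.

(** For q nonzero both series unfold, and the integral over the unit square becomes
    a sum of |q| phases times one Gaussian integral over the plane. *)
Lemma pairing_Iint : Q != 0 -> pairing_int = Zsum * cint setT (Iint mu%:R).
Proof.
move=> q0; have mR : 0 < mu%:R :> R by rewrite ltr0n.
have [cI [C dI]] := Iint_regular mR q0.
have [c0 [C0 d0]] : ccont coef0 /\ exists C0, decays coef0 C0.
  have eC : coef0 = (fun s => Zsum * Iint mu%:R (s + rho')).
    by apply/funext => s; exact: coef0_Iint.
  rewrite eC; split; first by apply: ccontM; [exact: ccont_cst|exact: ccont_shift].
  exists (nc Zsum * (C * expR (2 * `|rho'|))) => x; rewrite ncM -!mulrA ler_wpM2l ?nc_ge0//.
  apply: (le_trans (dI _)); rewrite -expRD ler_wpM2l ?(decays_ge0 dI)// ler_expR.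
  by have := ler_normB (x + rho') rho'; rewrite addrK; lra.
rewrite (pairing_unfold c0 d0).
have dI' : decays (fun s => Iint mu%:R (1 * s + rho')) (C * expR (2 * `|rho'|)).
  move=> x; rewrite mul1r; apply: (le_trans (dI _)).
  rewrite -mulrA -expRD ler_wpM2l ?(decays_ge0 dI)// ler_expR.
  by have := ler_normB (x + rho') rho'; rewrite addrK; lra.
have igI := cintegrable_decays (ccont_affine 1 rho' cI) dI'.
have e1 := cintZ Zsum measurableT igI.
rewrite (cint_affine rho' ltr01 cI dI) invr1 mul1r in e1.
apply: etrans e1; apply: eq_cint => s _.
by rewrite mul1r; exact: coef0_Iint.
Qed.

(** Rescaling both variables by the square root of mu: the degree enters the
    Gaussian integral over the plane only through the factor 1 / mu. *)
Lemma Iint_scale : Q != 0 -> cint setT (Iint mu%:R) = toC (mu%:R^-1) * cint setT (Iint 1).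
Proof.
move=> q0; pose k : R := Num.sqrt mu%:R.
have mR : 0 < mu%:R :> R by rewrite ltr0n.
have k0 : 0 < k by rewrite sqrtr_gt0.
have k2 : k ^+ 2 = mu%:R by rewrite sqr_sqrtr// ltW.
have PE s t : Phi mu%:R s t = Phi 1 (k * s + 0) (k * t + 0).
  rewrite /Phi !addr0; congr e2; rewrite -k2; congr (_ + _); [congr (_ + _)|];
    [congr (toC _ * _); ring|congr (toC _ * _); ring|congr toC; rewrite /qform; ring].
have [C hC] := nc_Phi_le (@ltr01 R) q0.
have [cI [C1 dI]] := Iint_regular (@ltr01 R) q0.
have IE s : Iint mu%:R s = toC k^-1 * Iint 1 (k * s + 0).
  rewrite /Iint; have d1 : decays (Phi 1 (k * s + 0)) (C * expR (- (2 * `|k * s + 0|))) by move=> t; exact: hC.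
  rewrite -(cint_affine 0 k0 (ccont_Phi_t 1 (k * s + 0)) d1).
  by apply: eq_cint => t _; exact: PE.
transitivity (cint setT (fun s => toC k^-1 * Iint 1 (k * s + 0))).
  by apply: eq_cint => s _; exact: IE.
have igI : cintegrable setT (fun s => Iint 1 (k * s + 0)).
  have [cM [CM dM]] := Iint_regular mR q0.
  have := cintegrableZ (toC k) measurableT (cintegrable_decays cM dM); congr cintegrable; apply/funext => s.
  by rewrite IE mulrA -rmorphM mulfV ?mul1r// gt_eqF.
apply: etrans (cintZ (toC k^-1) measurableT igI) _.
rewrite (cint_affine 0 k0 cI dI) mulrA -rmorphM /= -k2; congr (toC _ * _).
by rewrite expr2 invfM.
Qed.

End FixedMu.
End Pairing.

(** * The period integral when the second periods are parallel *)

Section ParallelPairing.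
Variable R : realType.
Local Notation toC := (real_complex R).
Local Notation int01 := (cint (`[0%R, 1%R] : set (measurableTypeR R))).

Variables (tau tau' : R[i]) (p p' q' : int).
Hypotheses (tau_gt0 : 0 < Im tau) (tau'_gt0 : 0 < Im tau').
Hypothesis det : p * q' - p' * 0 = -1.

Let P : R := p%:~R. Let P' : R := p'%:~R. Let Q' : R := q'%:~R.

Let PQ : P * Q' = -1.
Proof. by rewrite /P /Q' -intrM (_ : p * q' = -1)//; lia. Qed.

Let Q'E : Q' = - P.
Proof.
have pq : p * q' = -1 by lia.
have : (`|p| * `|q'|)%N == 1%N by rewrite -abszM pq.
rewrite muln_eq1 => /andP[/eqP p1 _].
have : p = 1 \/ p = -1 by lia.
rewrite /Q' /P => -[e|e]; move: pq; rewrite e => h.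
  by rewrite (_ : q' = -1)//; lia.
by rewrite (_ : q' = 1) ?opprK//; lia.
Qed.

Let P2 : P ^+ 2 = 1.
Proof. by move: PQ; rewrite Q'E mulrN => /oppr_inj; rewrite expr2. Qed.

(** The Gaussian that remains when q = 0, in which case p = - q' is 1 or -1. *)
Definition Psi (m s : R) : R[i] :=
  e2 (toC (m / 2 * s ^+ 2) * (tau' + tau + toC (P * P'))).

Let tau2_gt0 : 0 < Im (tau' + tau + toC (P * P')).
Proof. by rewrite !cImD /= addr0 addr_gt0. Qed.

Lemma Psi_regular (m : R) : 0 < m -> ccont (Psi m) /\ exists C, decays (Psi m) C.
Proof.
move=> m0; split.
  apply: ccont_cexp; apply: ccontM; first exact: ccont_cst.
  apply: ccontM; last exact: ccont_cst.
  apply: ccont_real => x; apply: cvgM; first exact: cvg_cst.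
  by apply: cvgM; exact: cvg_id.
pose a := pi * m * Im (tau' + tau + toC (P * P')).
have a0 : 0 < a by rewrite !mulr_gt0 ?pi_gt0.
exists (expR (2 ^+ 2 / (4 * a))) => s.
rewrite nc_e2 -expRD ler_expR cImM mul0r addr0.
apply: le_trans (quad_ge 2 s a0).
by rewrite le_eqVlt; apply/orP; left; apply/eqP; rewrite /a /=; field.
Qed.

Section FixedMu.
Variables (mu : nat) (rho sg rho' sg' : R).
Hypothesis mu0 : (0 < mu)%N.
Hypothesis char1 : e2 (toC (sg' - thchar mu rho sg p p')) = 1.
Hypothesis char2 : e2 (toC (mu%:R * rho' + thchar mu rho sg 0 q')) = 1.

Let zeta0 : R := rho' * sg' + P * rho' * sg - mu%:R / 2 * P * P' * rho' ^+ 2.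

Let kf (m : int) : R := mu%:R * (rho' + (m%:~R + rho) * Q').

Let term_kf (m : int) : e2 (toC (kf m)) = 1.
Proof.
have -> : kf m = (mu%:R * rho' + thchar mu rho sg 0 q') + m%:~R * mu%:R * q'%:~R.
  by rewrite /kf /thchar /Q'; ring.
by rewrite rmorphD e2D char2 e2_muZ mulr1.
Qed.

Let kappa (M s : R) : R[i] := e2 (toC (mu%:R / 2 * (rho' + s) ^+ 2) * tau' +
  toC (mu%:R / 2 * (M + P * s) ^+ 2) * tau +
  toC (rho' * sg' + M * (mu%:R * P' * s + sg) + mu%:R / 2 * P * P' * s ^+ 2)).

Let coef_term (m : int) (s : R) : int01 (fun t => theta_term tau' mu%:R sg' rho' s t *
  theta_term tau mu%:R sg (m%:~R + rho) (P * s + 0%:~R * t) (P' * s + Q' * t)) =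
  kappa (m%:~R + rho) s * int01 (fun t => e2 (toC (kf m * t))).
Proof.
rewrite -cintZ//; last first.
  have ce : ccont (fun t => e2 (toC (kf m * t))).
    apply: ccont_cexp; apply: ccontM; first exact: ccont_cst.
    apply: ccont_real => t; apply: cvgM; [exact: cvg_cst|exact: cvg_id].
  apply: (@cintegrable_dom _ _ _ (fun=> 1)) => //; first exact: ccont_cmeasurable.
    exact: integrable_cst01.
  by move=> t _; rewrite nc_e2_real.
apply: eq_cint => t _; rewrite /theta_term /kappa -!e2D; congr e2.
rewrite mul0r addr0.
set M := m%:~R + rho.
have e : rho' * (mu%:R * t + sg') + mu%:R / 2 * s * t +
   (M * (mu%:R * (P' * s + Q' * t) + sg) + mu%:R / 2 * (P * s) * (P' * s + Q' * t)) =
   rho' * sg' + M * (mu%:R * P' * s + sg) + mu%:R / 2 * P * P' * s ^+ 2 + kf m * t.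
  apply/eqP; rewrite -subr_eq0; apply/eqP.
  have h : mu%:R / 2 * s * t * (P * Q' + 1) = 0 by rewrite PQ; ring.
  by rewrite -[RHS]h /kf -/M; field.
by rewrite addrACA -rmorphD /= e rmorphD /= addrA.
Qed.

Let kf_eq0 (m : int) : kf m = 0 -> m%:~R + rho = P * rho'.
Proof.
move/eqP; rewrite mulf_eq0 pnatr_eq0 -[X in X || _]negbK -lt0n mu0 /= => /eqP h.
have : P * (rho' + (m%:~R + rho) * Q') = 0 by rewrite h mulr0.
rewrite Q'E; have -> : P * (rho' + (m%:~R + rho) * - P) = P * rho' - P ^+ 2 * (m%:~R + rho) by ring.
by rewrite P2 mul1r => /eqP; rewrite subr_eq0 => /eqP ->.
Qed.

Let term0 (m : int) (s : R) : kf m != 0 -> int01 (fun t => theta_term tau' mu%:R sg' rho' s t *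
  theta_term tau mu%:R sg (m%:~R + rho) (P * s + 0%:~R * t) (P' * s + Q' * t)) = 0.
Proof. by move=> k0; rewrite coef_term int01_char ?mulr0. Qed.

Let kappaE (s : R) : kappa (P * rho') s = e2 (toC zeta0) * Psi mu%:R (s + rho').
Proof.
rewrite /kappa /Psi -e2D; congr e2.
have -> : (P * rho' + P * s) ^+ 2 = (s + rho') ^+ 2.
  by rewrite -mulrDr exprMn P2 mul1r (addrC rho').
rewrite (addrC rho' s); set X := (s + rho') ^+ 2.
have -> : toC (mu%:R / 2 * X) * (tau' + tau + toC (P * P')) =
    toC (mu%:R / 2 * X) * tau' + toC (mu%:R / 2 * X) * tau + toC (mu%:R / 2 * X * (P * P')).
  by rewrite (rmorphM toC (mu%:R / 2 * X) (P * P')) 2!mulrDr.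
have -> : rho' * sg' + P * rho' * (mu%:R * P' * s + sg) + mu%:R / 2 * P * P' * s ^+ 2 =
   zeta0 + mu%:R / 2 * X * (P * P') by rewrite /zeta0 /X; field.
by rewrite rmorphD /=; rewrite addrCA.
Qed.

(** When q = 0 the second series is, as a function of t, a series of characters of
    the circle times those of the central term of the first one.  At most one
    product of terms has trivial character, and the others integrate to zero; the
    survivor is a Gaussian integral over the line, where rescaling by the square
    root of mu gives the factor 1 / sqrt mu. *)
Lemma pairing_parallel :
  pairing_int tau tau' p p' 0 q' mu rho sg rho' sg' = 0 \/
  pairing_int tau tau' p p' 0 q' mu rho sg rho' sg' =
    e2 (toC zeta0) * (toC (Num.sqrt mu%:R)^-1 * cint setT (Psi 1)).
Proof.
have mR : 0 < mu%:R :> R by rewrite ltr0n.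
have [[m0 hm0]|hm0] := pselect (exists m : int, kf m = 0); last first.
  left.
  have c0 : coef0 tau tau' p p' 0 q' mu rho sg rho' sg' = fun=> 0.
    apply/funext => s; apply: sums_to_uniq (coef0_sums_to p p' 0 q' tau_gt0 tau'_gt0 rho sg rho' sg' mu0 s) _.
    have k0 m : kf m != 0 by apply/eqP => h; apply: hm0; exists m.
    rewrite -[X in sums_to _ X](term0 s (k0 0)).
    apply: (@sums_to_single R (fun m => int01 (fun t => theta_term tau' mu%:R sg' rho' s t *
      theta_term tau mu%:R sg (m%:~R + rho) (P * s + 0%:~R * t) (P' * s + Q' * t)))) => m _.
    exact: term0.
  rewrite (pairing_unfold tau_gt0 tau'_gt0 det mu0 char1 (C := 0)) ?c0 ?cint0//.
  - exact: ccont_cst.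
  - by move=> x; rewrite nc0 mul0r.
right.
have km m : m != m0 -> kf m != 0.
  move=> mm; apply/eqP => /kf_eq0; rewrite -(kf_eq0 hm0) => /addIr /eqP.
  by rewrite eqr_int (negbTE mm).
have int1 : int01 (fun t => e2 (toC (kf m0 * t))) = 1.
  rewrite hm0; transitivity (int01 (fun=> 1)); first by apply: eq_cint => t _; rewrite mul0r e20.
  apply: (@etrans _ _ (1 - 0)); last by rewrite subr0.
  have := @cint01_deriv R (fun=> 1) toC (ccont_cst 1); apply => x.
  exists 0 => h _; have -> : toC (x + h) - toC x - toC h * 1 = 0 by rewrite rmorphD /=; ring.
  by rewrite nc0 mul0r.
have c0 s : coef0 tau tau' p p' 0 q' mu rho sg rho' sg' s = e2 (toC zeta0) * Psi mu%:R (s + rho').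
  apply: sums_to_uniq (coef0_sums_to p p' 0 q' tau_gt0 tau'_gt0 rho sg rho' sg' mu0 s) _.
  rewrite -kappaE -(kf_eq0 hm0) -[X in sums_to _ X]mulr1 -int1 -coef_term.
  apply: (@sums_to_single R (fun m => int01 (fun t => theta_term tau' mu%:R sg' rho' s t *
    theta_term tau mu%:R sg (m%:~R + rho) (P * s + 0%:~R * t) (P' * s + Q' * t)))) => m mm.
  by rewrite term0// km.
have [cP [C dP]] := Psi_regular mR.
have dP' : decays (fun s => Psi mu%:R (1 * s + rho')) (C * expR (2 * `|rho'|)).
  move=> x; rewrite mul1r; apply: (le_trans (dP _)).
  rewrite -mulrA -expRD ler_wpM2l ?(decays_ge0 dP)// ler_expR.
  by have := ler_normB (x + rho') rho'; rewrite addrK; lra.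
have cP' := ccont_affine 1 rho' cP.
have c0' : coef0 tau tau' p p' 0 q' mu rho sg rho' sg' = fun s => e2 (toC zeta0) * Psi mu%:R (1 * s + rho').
  by apply/funext => s; rewrite c0 mul1r.
have cc : ccont (coef0 tau tau' p p' 0 q' mu rho sg rho' sg').
  by rewrite c0'; apply: ccontM => //; exact: ccont_cst.
have dc : decays (coef0 tau tau' p p' 0 q' mu rho sg rho' sg') (C * expR (2 * `|rho'|)).
  by move=> s; rewrite c0' ncM nc_e2_real mul1r; exact: dP'.
rewrite (pairing_unfold tau_gt0 tau'_gt0 det mu0 char1 cc dc) c0'.
rewrite (cintZ _ measurableT (cintegrable_decays cP' dP')); congr (_ * _).
rewrite (cint_affine rho' ltr01 cP dP) invr1 mul1r.
pose k : R := Num.sqrt mu%:R.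
have k0 : 0 < k by rewrite sqrtr_gt0.
have [cP1 [C1 dP1]] := Psi_regular (@ltr01 R).
rewrite -(cint_affine 0 k0 cP1 dP1); apply: eq_cint => s _.
have kk : mu%:R / 2 * s ^+ 2 = 1 / 2 * (k * s + 0) ^+ 2.
  by rewrite addr0 exprMn sqr_sqrtr ?ler0n//; ring.
by rewrite /Psi kk.
Qed.

End FixedMu.
End ParallelPairing.

(** * Differentiability with quadratic remainder *)

Section Smooth.
Variable R : realType.
Local Notation toC := (real_complex R).
Implicit Types (f g : R[i] -> R[i]) (v h : R[i]) (C r : R).

(** Real differentiability of a function of a complex variable, with partial
    derivatives fx, fy and a quadratic remainder that is uniform on each ball
    around a point, so that the remainders of the terms of a series can be summed. *)
Definition rdiff f fx fy := forall v r, exists2 C, 0 <= C & forall h, nc h <= r ->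
  nc (f (v + h) - f v - (toC (Re h) * fx v + toC (Im h) * fy v)) <= C * nc h ^+ 2.

Definition Lip f := forall v r, exists2 C, 0 <= C & forall h, nc h <= r ->
  nc (f (v + h) - f v) <= C * nc h.

(** n-fold differentiability in this sense, the last derivatives being Lipschitz. *)
Fixpoint diff_upto (n : nat) f : Prop :=
  if n is m.+1 then exists fx fy, [/\ rdiff f fx fy, diff_upto m fx & diff_upto m fy] else Lip f.

Lemma nc_lin_le (a b h : R[i]) : nc (toC (Re h) * a + toC (Im h) * b) <= (nc a + nc b) * nc h.
Proof.
apply: (le_trans (ncD _ _)); rewrite !ncM !nc_real mulrDl.
by apply: lerD; rewrite mulrC ler_wpM2l ?nc_ge0 ?Re_le_nc ?Im_le_nc.
Qed.

Lemma rdiff_Lip f fx fy : rdiff f fx fy -> Lip f.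
Proof.
move=> H v r; have [C C0 hC] := H v r.
have n0 : 0 <= nc (fx v) + nc (fy v) by rewrite addr_ge0 ?nc_ge0.
exists (C * `|r| + (nc (fx v) + nc (fy v))); first by rewrite addr_ge0// mulr_ge0.
move=> h hr; set L := toC (Re h) * fx v + toC (Im h) * fy v.
have -> : f (v + h) - f v = (f (v + h) - f v - L) + L by rewrite subrK.
apply: (le_trans (ncD _ _)); rewrite [leRHS]mulrDl; apply: lerD; last exact: nc_lin_le.
apply: (le_trans (hC h hr)); rewrite expr2 mulrA; apply: ler_wpM2r; first exact: nc_ge0.
by apply: ler_wpM2l => //; apply: (le_trans hr); exact: ler_norm.
Qed.

Lemma diff_upto_Lip n f : diff_upto n f -> Lip f.
Proof. by case: n => [//|n] [fx [fy [H _ _]]]; exact: rdiff_Lip H. Qed.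

Lemma diff_uptoS n f : diff_upto n.+1 f -> diff_upto n f.
Proof.
elim: n f => [|n IH] f; first exact: (@diff_upto_Lip 1).
by move=> [fx [fy [H hx hy]]]; exists fx, fy; split => //; exact: IH.
Qed.

Lemma rdiff_add f fx fy g gx gy : rdiff f fx fy -> rdiff g gx gy ->
  rdiff (fun u => f u + g u) (fun u => fx u + gx u) (fun u => fy u + gy u).
Proof.
move=> F G v r; have [C C0 hC] := F v r; have [D D0 hD] := G v r.
exists (C + D); first exact: addr_ge0.
move=> h hr; set a := f (v + h); set b := g (v + h).
have -> : a + b - (f v + g v) - (toC (Re h) * (fx v + gx v) + toC (Im h) * (fy v + gy v)) =
  (a - f v - (toC (Re h) * fx v + toC (Im h) * fy v)) +
  (b - g v - (toC (Re h) * gx v + toC (Im h) * gy v)) by ring.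
by apply: (le_trans (ncD _ _)); rewrite [leRHS]mulrDl lerD ?hC ?hD.
Qed.

Lemma diff_uptoD n f g : diff_upto n f -> diff_upto n g -> diff_upto n (fun u => f u + g u).
Proof.
elim: n f g => [|n IH] f g.
  move=> hf hg v r; have [C C0 hC] := hf v r; have [D D0 hD] := hg v r.
  exists (C + D); first exact: addr_ge0.
  move=> h hr; have -> : f (v + h) + g (v + h) - (f v + g v) =
    (f (v + h) - f v) + (g (v + h) - g v) by ring.
  by apply: (le_trans (ncD _ _)); rewrite [leRHS]mulrDl lerD ?hC ?hD.
move=> [fx [fy [F hfx hfy]]] [gx [gy [G hgx hgy]]].
exists (fun u => fx u + gx u), (fun u => fy u + gy u).
by split; [exact: rdiff_add|exact: IH|exact: IH].
Qed.

Lemma rdiff_mul f fx fy g gx gy : rdiff f fx fy -> rdiff g gx gy ->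
  rdiff (fun u => f u * g u) (fun u => fx u * g u + f u * gx u)
     (fun u => fy u * g u + f u * gy u).
Proof.
move=> F G v r; have [C C0 hC] := F v r; have [D D0 hD] := G v r.
have [A A0 hA] := rdiff_Lip F v r; have [B B0 hB] := rdiff_Lip G v r.
exists (C * nc (g v) + nc (f v) * D + A * B).
  by rewrite !addr_ge0// mulr_ge0// nc_ge0.
move=> h hr; set a := f (v + h); set b := g (v + h).
set x := toC (Re h); set y := toC (Im h).
have -> : a * b - f v * g v - (x * (fx v * g v + f v * gx v) + y * (fy v * g v + f v * gy v)) =
  (a - f v - (x * fx v + y * fy v)) * g v + f v * (b - g v - (x * gx v + y * gy v)) +
  (a - f v) * (b - g v) by ring.
apply: (le_trans (ncD _ _)); rewrite [leRHS]mulrDl; apply: lerD.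
  apply: (le_trans (ncD _ _)); rewrite [leRHS]mulrDl; apply: lerD; rewrite ncM.
    by rewrite mulrAC ler_wpM2r ?nc_ge0// hC.
  by rewrite -mulrA ler_wpM2l ?nc_ge0// hD.
rewrite ncM expr2 mulrACA; apply: ler_pM; rewrite ?nc_ge0//; [exact: hA|exact: hB].
Qed.

Lemma diff_uptoM n f g : diff_upto n f -> diff_upto n g -> diff_upto n (fun u => f u * g u).
Proof.
elim: n f g => [|n IH] f g.
  move=> hf hg v r; have [C C0 hC] := hf v r; have [D D0 hD] := hg v r.
  exists (C * (nc (g v) + D * `|r|) + nc (f v) * D).
    by rewrite addr_ge0 ?mulr_ge0 ?addr_ge0 ?nc_ge0// mulr_ge0.
  move=> h hr; set a := f (v + h); set b := g (v + h).
  have -> : a * b - f v * g v = (a - f v) * b + f v * (b - g v) by ring.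
  apply: (le_trans (ncD _ _)); rewrite [leRHS]mulrDl !ncM; apply: lerD; last first.
    by rewrite -mulrA ler_wpM2l ?nc_ge0// hD.
  rewrite mulrAC; apply: ler_pM; rewrite ?nc_ge0//; first exact: hC.
  have -> : b = g v + (b - g v) by ring.
  apply: (le_trans (ncD _ _)); rewrite lerD2l; apply: (le_trans (hD h hr)).
  by rewrite ler_wpM2l// (le_trans hr)// ler_norm.
move=> hf hg; have [fx [fy [F hfx hfy]]] := hf; have [gx [gy [G hgx hgy]]] := hg.
exists (fun u => fx u * g u + f u * gx u), (fun u => fy u * g u + f u * gy u).
by split; [exact: rdiff_mul|apply: diff_uptoD; apply: IH => //; exact: diff_uptoS|apply: diff_uptoD; apply: IH => //; exact: diff_uptoS].
Qed.

Lemma diff_upto_affine n f (a b : R[i]) :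
  (forall v h, f (v + h) = f v + (toC (Re h) * a + toC (Im h) * b)) -> diff_upto n f.
Proof.
elim: n f a b => [|n IH] f a b H.
  move=> v r; exists (nc a + nc b); first by rewrite addr_ge0 ?nc_ge0.
  by move=> h _; rewrite H addrAC subrr add0r nc_lin_le.
exists (fun=> a), (fun=> b); split.
- move=> v r; exists 0 => // h _.
  rewrite H; set L := _ + _ * b; have -> : f v + L - f v - L = 0 by ring.
  by rewrite nc0 mul0r.
- by apply: (IH _ 0 0) => v h; rewrite !mulr0 !addr0.
- by apply: (IH _ 0 0) => v h; rewrite !mulr0 !addr0.
Qed.

Lemma diff_upto_cst n (c : R[i]) : diff_upto n (fun=> c).
Proof. by apply: (@diff_upto_affine _ _ (0) (0)) => v h; rewrite !mulr0 !addr0. Qed.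

Lemma diff_upto_id n : diff_upto n (fun u => u).
Proof.
apply: (@diff_upto_affine _ _ (1) ('i%C)) => v h.
by rewrite mulr1 (mulrC _ 'i%C) -complexE.
Qed.

Lemma diff_upto_conj n : diff_upto n (fun u => u^*%C).
Proof.
apply: (@diff_upto_affine _ _ (1) (- 'i%C)) => v h.
by apply: complexP; rewrite !(cReD, cImD, cReM, cImM) /=; case: v => ? ?; case: h => ? ? /=; ring.
Qed.

Lemma rdiff_cexp f fx fy : rdiff f fx fy ->
  rdiff (fun u => cexp (f u)) (fun u => fx u * cexp (f u)) (fun u => fy u * cexp (f u)).
Proof.
move=> F v r; have [C C0 hC] := F v r; have [A A0 hA] := rdiff_Lip F v r.
exists (nc (cexp (f v)) * (5 * A ^+ 2 * expR (A * `|r|) + C)).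
  by rewrite mulr_ge0 ?nc_ge0// addr_ge0// mulr_ge0 ?expR_ge0// mulr_ge0// sqr_ge0.
move=> h hr; set x := toC (Re h); set y := toC (Im h).
pose d := f (v + h) - f v.
have -> : f (v + h) = f v + d by rewrite /d addrCA subrr addr0.
have -> : cexp (f v + d) - cexp (f v) - (x * (fx v * cexp (f v)) + y * (fy v * cexp (f v))) =
  cexp (f v) * ((cexp d - 1 - d) + (d - (x * fx v + y * fy v))) by rewrite cexpD; ring.
rewrite ncM -mulrA ler_wpM2l ?nc_ge0//; apply: (le_trans (ncD _ _)).
rewrite [leRHS]mulrDl; apply: lerD; last exact: hC.
have d1 : nc d <= A * nc h by exact: hA.
apply: (le_trans (cexp1D_le d)).
have e1 : expR (nc d) <= expR (A * `|r|).
  by rewrite ler_expR (le_trans d1)// ler_wpM2l// (le_trans hr)// ler_norm.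
have e2 : nc d ^+ 2 <= A ^+ 2 * nc h ^+ 2.
  by rewrite -exprMn lerXn2r// ?nnegrE ?nc_ge0// mulr_ge0// nc_ge0.
rewrite (mulrAC (5 * _)) -!(mulrA 5) ler_wpM2l//.
by apply: ler_pM; rewrite ?expR_ge0 ?sqr_ge0.
Qed.

Lemma diff_upto_cexp n f : diff_upto n f -> diff_upto n (fun u => cexp (f u)).
Proof.
elim: n f => [|n IH] f.
  move=> hf v r; have [A A0 hA] := hf v r.
  exists (nc (cexp (f v)) * ((5 * (A * `|r|) * expR (A * `|r|) + 1) * A)).
    by rewrite mulr_ge0 ?nc_ge0// mulr_ge0// addr_ge0// mulr_ge0 ?expR_ge0// mulr_ge0// mulr_ge0.
  move=> h hr; pose d := f (v + h) - f v.
  have -> : f (v + h) = f v + d by rewrite /d addrCA subrr addr0.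
  have -> : cexp (f v + d) - cexp (f v) = cexp (f v) * ((cexp d - 1 - d) + d) by rewrite cexpD; ring.
  rewrite ncM -mulrA ler_wpM2l ?nc_ge0//; apply: (le_trans (ncD _ _)).
  have d1 : nc d <= A * nc h by exact: hA.
  have d2 : nc d <= A * `|r| by rewrite (le_trans d1)// ler_wpM2l// (le_trans hr)// ler_norm.
  rewrite -mulrA mulrDl mul1r; apply: lerD => //.
  apply: (le_trans (cexp1D_le d)).
  rewrite expr2 mulrA mulrAC; apply: ler_pM; rewrite ?nc_ge0 ?mulr_ge0 ?expR_ge0 ?nc_ge0//.
  apply: ler_pM; rewrite ?mulr_ge0 ?expR_ge0 ?nc_ge0 ?ler_expR//.
  by rewrite ler_wpM2l.
move=> hf; have [fx [fy [F hfx hfy]]] := hf.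
exists (fun u => fx u * cexp (f u)), (fun u => fy u * cexp (f u)).
by split; [exact: rdiff_cexp|apply: diff_uptoM => //; apply: IH; exact: diff_uptoS|apply: diff_uptoM => //; apply: IH; exact: diff_uptoS].
Qed.

Lemma diff_upto_negconj n f : diff_upto n f -> diff_upto n (fun u => f (- u^*%C)).
Proof.
have E v h : - (v + h)^*%C = - v^*%C + - h^*%C by rewrite rmorphD opprD.
have N h : nc (- h^*%C) = nc h by rewrite ncN ncJ.
elim: n f => [|n IH] f.
  move=> hf v r; have [C C0 hC] := hf (- v^*%C) r; exists C => // h hr.
  by rewrite E -(N h); apply: hC; rewrite N.
move=> [fx [fy [F hfx hfy]]].
exists (fun u => (-1) * fx (- u^*%C)), (fun u => fy (- u^*%C)); split.
- move=> v r; have [C C0 hC] := F (- v^*%C) r; exists C => // h hr.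
  have := hC (- h^*%C); rewrite N E => /(_ hr); apply: le_trans.
  rewrite le_eqVlt; apply/orP; left; apply/eqP; congr (nc (_ - (_ + _))).
    by rewrite mulrA; congr (_ * _); apply: complexP; case: h {hr} => a b /=; ring.
  by congr (_ * _); apply: complexP; case: h {hr} => a b /=; ring.
- by apply: diff_uptoM; [exact: diff_upto_cst|exact: IH].
- exact: IH.
Qed.

End Smooth.

(** * Series of exponentials *)

Section Exponential_series.
Variable R : realType.
Local Notation toC := (real_complex R).
Variables (w : int -> R[i]) (W : R).
Hypothesis wW : forall n, nc (w n) <= W * (1 + `|n|%N%:R).
Implicit Types (c : int -> R[i]) (u v h : R[i]).

(** Faster decay than any exponential; it is stable under multiplication by the
    frequencies w n, that is, under termwise differentiation. *)
Definition rapid c := forall B : R, exists2 C, 0 <= C & forall n, nc (c n) <= C * expR (- (B * `|n|%N%:R)).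

Definition eseries c u : R[i] := zsum (fun n => c n * cexp (w n * u)).

Let W0 : 0 <= W.
Proof. by have := le_trans (nc_ge0 _) (wW 0); rewrite addr0 mulr1. Qed.

(** The coefficients beat the growth of all the exponentials exp (w n * u) with
    |u| <= L. *)
Lemma rapid_bound c (L : R) : rapid c -> 0 <= L -> exists2 C, 0 <= C &
  forall n, nc (c n) * expR (L * nc (w n)) <= C * expR (- `|n|%N%:R).
Proof.
move=> rc L0; have [C C0 hC] := rc (L * W + 1).
exists (C * expR (L * W)); first by rewrite mulr_ge0// expR_ge0.
move=> n; apply: (@le_trans _ _ (C * expR (- ((L * W + 1) * `|n|%N%:R)) * expR (L * (W * (1 + `|n|%N%:R))))).
  apply: ler_pM; rewrite ?nc_ge0 ?expR_ge0 ?hC// ler_expR.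
  by rewrite ler_wpM2l.
rewrite -!mulrA ler_wpM2l// -!expRD ler_expR le_eqVlt; apply/orP; left; apply/eqP; ring.
Qed.

Lemma cexp_le u v : nc (cexp (u * v)) <= expR (nc v * nc u).
Proof. by rewrite nc_cexp ler_expR mulrC -ncM (le_trans (ler_norm _))// Re_le_nc. Qed.

Lemma eseries_geo_bounded c u : rapid c -> exists C, geo_bounded (fun n => c n * cexp (w n * u)) C.
Proof.
move=> rc; have [C C0 hC] := rapid_bound rc (nc_ge0 u).
exists C => n; apply: le_trans (hC n); rewrite ncM ler_wpM2l ?nc_ge0//.
exact: cexp_le.
Qed.

Lemma rapid_deriv c : rapid c -> rapid (fun n => w n * c n).
Proof.
move=> rc B; have [C C0 hC] := rc (B + 1).
exists (W * C); first by rewrite mulr_ge0.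
move=> n; rewrite ncM.
apply: (@le_trans _ _ (W * (1 + `|n|%N%:R) * (C * expR (- ((B + 1) * `|n|%N%:R))))).
  by apply: ler_pM; rewrite ?nc_ge0 ?wW ?hC.
have e := expR_ge1Dx (`|n|%N%:R : R).
have -> : - ((B + 1) * `|n|%N%:R) = - (B * `|n|%N%:R) + - `|n|%N%:R :> R by ring.
rewrite expRD (expRN `|n|%N%:R).
have p0 := expR_gt0 (`|n|%N%:R : R); have q0 := expR_ge0 (- (B * `|n|%N%:R)).
have : (1 + `|n|%N%:R) * (expR `|n|%N%:R)^-1 <= 1 :> R.
  by rewrite -(ler_pM2r p0) -mulrA mulVf ?gt_eqF// mulr1 mul1r.
move: (1 + `|n|%N%:R) (expR `|n|%N%:R)^-1 (expR (- _)) q0 => x y z z0 xy.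
have WC : 0 <= W * C by rewrite mulr_ge0.
have -> : W * x * (C * (z * y)) = W * C * z * (x * y) by ring.
by rewrite -[leRHS]mulr1; apply: ler_wpM2l => //; rewrite mulr_ge0.
Qed.

(** Termwise differentiation: the remainders of the exponentials, summed, stay
    quadratic. *)
Lemma eseries_rdiff c : rapid c ->
  rdiff (eseries c) (eseries (fun n => w n * c n)) (fun u => 'i%C * eseries (fun n => w n * c n) u).
Proof.
move=> rc v r.
have L0 : 0 <= 2 + nc v + `|r| by rewrite !addr_ge0 ?nc_ge0.
have [C C0 hC] := rapid_bound rc L0.
exists (4 * (5 * C) * geo_const R); first by rewrite !mulr_ge0// ltW// geo_const_gt0.
move=> h hr.
have [C1 g1] := eseries_geo_bounded (v + h) rc; have [C2 g2] := eseries_geo_bounded v rc.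
have [C3 g3] := eseries_geo_bounded v (rapid_deriv rc).
have eh : toC (Re h) * eseries (fun n => w n * c n) v + toC (Im h) * ('i%C * eseries (fun n => w n * c n) v) =
   h * eseries (fun n => w n * c n) v.
  by rewrite [in RHS](complexE h); ring.
rewrite eh.
have hs := sums_toD (sums_toD (geo_bounded_zsum g1) (sums_toZ (-1) (geo_bounded_zsum g2))) (sums_toZ (- h) (geo_bounded_zsum g3)).
have -> : eseries c (v + h) - eseries c v - h * eseries (fun n => w n * c n) v =
  eseries c (v + h) + -1 * eseries c v + - h * eseries (fun n => w n * c n) v by ring.
rewrite -(sums_to_zsum hs).
have tE n : c n * cexp (w n * (v + h)) + -1 * (c n * cexp (w n * v)) + - h * (w n * c n * cexp (w n * v)) =
   c n * cexp (w n * v) * (cexp (w n * h) - 1 - w n * h) by rewrite mulrDr cexpD; ring.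
have gz : geo_bounded (fun n => c n * cexp (w n * (v + h)) + -1 * (c n * cexp (w n * v)) + - h * (w n * c n * cexp (w n * v)))
    (5 * C * nc h ^+ 2).
  move=> n; rewrite tE ncM (ncM (c n)).
  apply: (@le_trans _ _ (nc (c n) * expR (nc v * nc (w n)) * (5 * nc (w n * h) ^+ 2 * expR (nc (w n * h))))).
    apply: ler_pM; [exact: (mulr_ge0 (nc_ge0 _) (nc_ge0 _))|exact: nc_ge0| |exact: cexp1D_le].
    by apply: ler_wpM2l; [exact: nc_ge0|exact: cexp_le].
  rewrite ncM; set x := nc (w n); set y := nc h.
  have x0 : 0 <= x := nc_ge0 _; have y0 : 0 <= y := nc_ge0 _; have c0 := nc_ge0 (c n).
  have x2 : x ^+ 2 <= expR (2 * x).
    have -> : expR (2 * x) = expR x ^+ 2 by rewrite -expRM_natl.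
    rewrite lerXn2r ?nnegrE ?expR_ge0//.
    by apply: le_trans (expR_ge1Dx x); rewrite lerDr.
  have xy : expR (x * y) <= expR (`|r| * x).
    by rewrite ler_expR mulrC ler_wpM2r// (le_trans hr)// ler_norm.
  apply: (@le_trans _ _ (nc (c n) * expR (nc v * x) * (5 * (expR (2 * x) * y ^+ 2) * expR (`|r| * x)))).
    apply: ler_wpM2l; first by rewrite mulr_ge0 ?expR_ge0.
    apply: ler_pM; rewrite ?expR_ge0//; first by rewrite mulr_ge0// sqr_ge0.
    by rewrite ler_wpM2l// exprMn ler_wpM2r// sqr_ge0.
  have -> : nc (c n) * expR (nc v * x) * (5 * (expR (2 * x) * y ^+ 2) * expR (`|r| * x)) =
    5 * y ^+ 2 * (nc (c n) * expR ((2 + nc v + `|r|) * x)).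
    by rewrite !mulrDl !expRD; ring.
  have -> : 5 * C * y ^+ 2 * expR (- `|n|%N%:R) = 5 * y ^+ 2 * (C * expR (- `|n|%N%:R)) by ring.
  by apply: ler_wpM2l; [rewrite mulr_ge0// sqr_ge0|exact: hC].
apply: (le_trans (zsum_le gz)).
by rewrite le_eqVlt; apply/orP; left; apply/eqP; ring.
Qed.

Lemma eseries_diff_upto n c : rapid c -> diff_upto n (eseries c).
Proof.
elim: n c => [|n IH] c rc; first exact: rdiff_Lip (eseries_rdiff rc).
exists (eseries (fun n => w n * c n)), (fun u => 'i%C * eseries (fun n => w n * c n) u).
have h := IH _ (rapid_deriv rc).
by split; [exact: eseries_rdiff|exact: h|apply: diff_uptoM => //; exact: diff_upto_cst].
Qed.

End Exponential_series.

(** * Comparison with partial derivatives *)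

Section Smooth_real.
Variable R : realType.
Local Notation toC := (real_complex R).
Implicit Types (f : R[i] -> R[i]) (v h : R[i]).

Lemma Lip_cont2 f : Lip f ->
  continuous (fun p : R * R => Re (f (p.1 +i* p.2))) /\
  continuous (fun p : R * R => Im (f (p.1 +i* p.2))).
Proof.
move=> Hf.
suff H (p : R * R) (e : R) : 0 < e -> \forall q \near p, nc (f (q.1 +i* q.2) - f (p.1 +i* p.2)) <= e.
  split=> p; apply/cvgrPdist_le => e e0; have := H p e e0; apply: filterS => q hq.
    by rewrite distrC -cReB (le_trans (Re_le_nc _)).
  by rewrite distrC -cImB (le_trans (Im_le_nc _)).
move=> e0; have [C C0 hC] := Hf (p.1 +i* p.2) 2.
pose d := Num.min 1 (e / (2 * (C + 1))).
have C1 : 0 < 2 * (C + 1) by rewrite mulr_gt0// ltr_wpDl.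
have d0 : 0 < d by rewrite lt_min ltr01 divr_gt0.
near=> q.
have h1 : `|p.1 - q.1| <= d.
  near: q; have h : (fun q : R * R => q.1) @ p --> p.1 by exact: cvg_fst.
  by move/cvgrPdist_le: h; exact.
have h2 : `|p.2 - q.2| <= d.
  near: q; have h : (fun q : R * R => q.2) @ p --> p.2 by exact: cvg_snd.
  by move/cvgrPdist_le: h; exact.
have hn : nc ((q.1 - p.1) +i* (q.2 - p.2)) <= 2 * d.
  apply: (le_trans (nc_le _)) => /=; rewrite mulr_natl mulr2n.
  by apply: lerD; rewrite distrC.
have d1 : d <= 1 by rewrite ge_min lexx.
have d2 : d <= e / (2 * (C + 1)) by rewrite ge_min lexx orbT.
have := hC _ (le_trans hn _); rewrite -[leRHS]mulr1 ler_pM2l// => /(_ d1).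
have -> : p.1 +i* p.2 + ((q.1 - p.1) +i* (q.2 - p.2)) = q.1 +i* q.2.
  by apply: complexP => /=; ring.
move=> h; apply: (le_trans h).
apply: (@le_trans _ _ ((C + 1) * (2 * d))); last first.
  by move: d2; rewrite ler_pdivlMr//; apply: le_trans; rewrite le_eqVlt; apply/orP; left; apply/eqP; ring.
apply: ler_pM => //; rewrite ?nc_ge0//; lra.
Unshelve. all: by end_near. Qed.

Lemma rdiff_dx f fx fy (x y : R) : rdiff f fx fy ->
  is_derive x (1 : R) (fun t => Re (f (t +i* y))) (Re (fx (x +i* y))) /\
  is_derive x (1 : R) (fun t => Im (f (t +i* y))) (Im (fx (x +i* y))).
Proof.
move=> F; have [C C0 hC] := F (x +i* y) 1.
have H k : `|k| <= 1 -> nc (f ((x + k) +i* y) - f (x +i* y) - toC k * fx (x +i* y)) <= C * k ^+ 2.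
  move=> k1; have := hC (toC k); rewrite nc_real real_normK ?num_real// => /(_ k1).
  have -> : x +i* y + toC k = (x + k) +i* y by apply: complexP => /=; ring.
  by rewrite [Im _]/= [Re _]/= mul0r addr0.
split; apply: (@quad_is_derive _ _ _ _ C 1) => // k k1; apply: le_trans (H k k1).
  by apply: le_trans (Re_le_nc _); rewrite !cReB cReM /= mul0r subr0.
by apply: le_trans (Im_le_nc _); rewrite !cImB cImM /= mul0r addr0.
Qed.

Lemma rdiff_dy f fx fy (x y : R) : rdiff f fx fy ->
  is_derive y (1 : R) (fun t => Re (f (x +i* t))) (Re (fy (x +i* y))) /\
  is_derive y (1 : R) (fun t => Im (f (x +i* t))) (Im (fy (x +i* y))).
Proof.
move=> F; have [C C0 hC] := F (x +i* y) 1.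
have H k : `|k| <= 1 -> nc (f (x +i* (y + k)) - f (x +i* y) - toC k * fy (x +i* y)) <= C * k ^+ 2.
  move=> k1; have := hC (0 +i* k).
  have -> : nc (0 +i* k) = `|k| by rewrite /ComplexField.Normc.normc expr0n /= add0r sqrtr_sqr.
  rewrite real_normK ?num_real// => /(_ k1).
  have -> : x +i* y + (0 +i* k) = x +i* (y + k) by apply: complexP => /=; ring.
  by rewrite [Im _]/= [Re _]/= mul0r add0r.
split; apply: (@quad_is_derive _ _ _ _ C 1) => // k k1; apply: le_trans (H k k1).
  by apply: le_trans (Re_le_nc _); rewrite !cReB cReM /= mul0r subr0.
by apply: le_trans (Im_le_nc _); rewrite !cImB cImM /= mul0r addr0.
Qed.

Lemma rdiff_dxE f fx fy : rdiff f fx fy -> dx f = fx /\ dy f = fy.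
Proof.
move=> F; split; apply/funext => -[x y]; rewrite /dx /dy !derive1E /=.
  by have [[_ ->] [_ ->]] := rdiff_dx x y F; apply: complexP.
by have [[_ ->] [_ ->]] := rdiff_dy x y F; apply: complexP.
Qed.

Lemma diff_upto_Ck n f : diff_upto n f ->
  Ck n (fun x y => Re (f (x +i* y))) /\ Ck n (fun x y => Im (f (x +i* y))).
Proof.
elim: n f => [|n IH] f hf.
  by have [h1 h2] := Lip_cont2 hf.
have [h1 h2] := Lip_cont2 (diff_upto_Lip hf).
have [fx [fy [F hx hy]]] := hf.
have [x1 x2] := IH _ hx; have [y1 y2] := IH _ hy.
split; split => //; split.
- by move=> x y; have [[]] := rdiff_dx x y F.
- by move=> x y; have [[]] := rdiff_dy x y F.
- rewrite (_ : (fun x y => _) = fun x y => Re (fx (x +i* y)))//.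
  by apply/funext => x; apply/funext => y; rewrite derive1E; have [[_ ->]] := rdiff_dx x y F.
- rewrite (_ : (fun x y => _) = fun x y => Re (fy (x +i* y)))//.
  by apply/funext => x; apply/funext => y; rewrite derive1E; have [[_ ->]] := rdiff_dy x y F.
- by move=> x y; have [_ []] := rdiff_dx x y F.
- by move=> x y; have [_ []] := rdiff_dy x y F.
- rewrite (_ : (fun x y => _) = fun x y => Im (fx (x +i* y)))//.
  by apply/funext => x; apply/funext => y; rewrite derive1E; have [_ [_ ->]] := rdiff_dx x y F.
- rewrite (_ : (fun x y => _) = fun x y => Im (fy (x +i* y)))//.
  by apply/funext => x; apply/funext => y; rewrite derive1E; have [_ [_ ->]] := rdiff_dy x y F.
Qed.

Lemma diff_upto_smooth f : (forall n, diff_upto n f) -> smooth f.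
Proof. by move=> H n; exact: diff_upto_Ck. Qed.

End Smooth_real.

Section From_smooth.
Variable R : realType.
Local Notation toC := (real_complex R).
Implicit Types (f : R[i] -> R[i]) (g : R -> R -> R).

Lemma mvt_abs (G g : R -> R) (x a : R) : (forall y, is_derive y (1 : R) G (g y)) ->
  exists2 k, `|k| <= `|a| & G (x + a) - G x = a * g (x + k).
Proof.
move=> dG; have cG (A : set R) : {within A, continuous G}.
  by apply: continuous_subspaceT => y; exact: is_derive_cont (dG y).
have [a0|a0] := leP 0 a.
  have xa : x <= x + a by rewrite lerDl.
  have [c] := MVT_segment xa (fun y _ => dG y) (cG _).
  rewrite in_itv /= => /andP[c1 c2] ->; exists (c - x).
    by rewrite ger0_norm ?subr_ge0// ger0_norm//; lra.
  by rewrite subrKC mulrC; congr (_ * _); ring.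
have xa : x + a <= x by rewrite gerDl ltW.
have [c] := MVT_segment xa (fun y _ => dG y) (cG _).
rewrite in_itv /= => /andP[c1 c2] E; exists (c - x).
  by rewrite ler0_norm ?subr_le0// ltr0_norm//; lra.
by rewrite subrKC -opprB E; ring.
Qed.

Lemma cont_box_bound g (x y r : R) : continuous (fun p : R * R => g p.1 p.2) ->
  exists2 C, 0 <= C & forall a b, `|a| <= r -> `|b| <= r -> `|g (x + a) (y + b)| <= C.
Proof.
move=> cg.
pose A : set (R * R) := `[x - r, x + r]%classic `*` `[y - r, y + r]%classic.
have cA : compact A by apply: compact_setX; exact: segment_compact.
have := continuous_compact (continuous_subspaceT cg) cA.
move=> /compact_bounded [M [_ /(_ (`|M| + 1))]].
have Mlt : M < `|M| + 1 by rewrite (le_lt_trans (ler_norm _))// ltrDl.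
move=> /(_ Mlt) H; exists (`|M| + 1); first by rewrite addr_ge0.
move=> a b ar br; apply: (H (g (x + a) (y + b))); exists (x + a, y + b) => //.
move: ar br; rewrite !ler_norml => /andP[a1 a2] /andP[b1 b2].
by split => /=; rewrite in_itv /=; apply/andP; split; lra.
Qed.

Lemma Ck1_is_derive g (x y : R) : Ck 1 g ->
  is_derive x (1 : R) (fun t => g t y) (derive1 (fun t => g t y) x) /\
  is_derive y (1 : R) (fun t => g x t) (derive1 (fun t => g x t) y).
Proof.
move=> [_ [h1 h2 _ _]]; split; rewrite derive1E; apply: DeriveDef => //.
Qed.

(** The mean value theorem applied along the two sides of a rectangle. *)
Lemma Ck1_mvt g (x y a b : R) : Ck 1 g ->
  exists k l, [/\ `|k| <= `|a|, `|l| <= `|b| &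
   g (x + a) (y + b) - g x y = a * derive1 (fun t => g t (y + b)) (x + k) +
                               b * derive1 (fun t => g x t) (y + l)].
Proof.
move=> H.
have [k hk ek] := mvt_abs x a (fun t => (Ck1_is_derive t (y + b) H).1).
have [l hl el] := mvt_abs y b (fun t => (Ck1_is_derive x t H).2).
exists k, l; split => //; rewrite -ek -el; ring.
Qed.

Lemma Ck1_lip g (x y r : R) : Ck 1 g -> exists2 C, 0 <= C & forall a b, `|a| <= r -> `|b| <= r ->
  `|g (x + a) (y + b) - g x y| <= C * (`|a| + `|b|).
Proof.
move=> H; have [_ [_ _ [c1 _] [c2 _]]] := H.
have [C C0 hC] := @cont_box_bound (fun x y => derive1 (fun t => g t y) x) x y r c1.
have [D D0 hD] := @cont_box_bound (fun x y => derive1 (fun t => g x t) y) x y r c2.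
exists (C + D); first exact: addr_ge0.
move=> a b ar br; have r0 : 0 <= r := le_trans (normr_ge0 _) ar.
have [k [l [hk hl ->]]] := Ck1_mvt x y a b H.
apply: (le_trans (ler_normD _ _)); rewrite !normrM.
have := hC k b (le_trans hk ar) br; have := hD 0 l; rewrite addr0 normr0 => /(_ r0 (le_trans hl br)).
have := normr_ge0 a; have := normr_ge0 b.
move: `|a| `|b| `|_| `|_| => a' b' u v b0 a0 uD vC; nra.
Qed.

Lemma Ck2_quad g (x y r : R) : Ck 2 g -> exists2 C, 0 <= C & forall a b, `|a| <= r -> `|b| <= r ->
  `|g (x + a) (y + b) - g x y -
    (a * derive1 (fun t => g t y) x + b * derive1 (fun t => g x t) y)| <= C * (`|a| + `|b|) ^+ 2.
Proof.
move=> H; have [c0 [h1 h2 cx cy]] := H.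
have H1 : Ck 1 g.
  by split => //; split => //; [have [? _] := cx|have [? _] := cy].
have [C C0 hC] := @Ck1_lip (fun x y => derive1 (fun t => g t y) x) x y r cx.
have [D D0 hD] := @Ck1_lip (fun x y => derive1 (fun t => g x t) y) x y r cy.
exists (C + D); first exact: addr_ge0.
move=> a b ar br; have r0 : 0 <= r := le_trans (normr_ge0 _) ar.
have [k [l [hk hl ->]]] := Ck1_mvt x y a b H1.
have := hC k b (le_trans hk ar) br; have := hD 0 l; rewrite addr0 normr0 add0r => /(_ r0 (le_trans hl br)).
set u := derive1 _ (y + l) - _; set v := derive1 _ (x + k) - _ => hu hv.
rewrite [X in `|X|](_ : _ = a * v + b * u); last by rewrite /u /v; ring.
apply: (le_trans (ler_normD _ _)); rewrite !normrM.
have := normr_ge0 a; have := normr_ge0 b; have := normr_ge0 u; have := normr_ge0 v.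
move: hk hl hu hv; move: `|a| `|b| `|u| `|v| `|k| `|l| => a' b' u' v' k' l'.
move=> hk hl hu hv v0 u0 b0 a0.
have e1 : v' <= C * (a' + b') by apply: (le_trans hv); rewrite ler_wpM2l// lerD2r.
have e2 : u' <= D * (a' + b') by apply: (le_trans hu); rewrite ler_wpM2l//; lra.
have ab : a' * v' <= (a' + b') * (C * (a' + b')) by apply: ler_pM => //; lra.
have bb : b' * u' <= (a' + b') * (D * (a' + b')) by apply: ler_pM => //; lra.
apply: (le_trans (lerD ab bb)); rewrite le_eqVlt; apply/orP; left; apply/eqP; ring.
Qed.

(** Conversely, continuous second partial derivatives are bounded on boxes, so
    the mean value theorem gives a quadratic remainder. *)
Lemma smooth_rdiff f : smooth f -> [/\ rdiff f (dx f) (dy f), Lip (dx f) & Lip (dy f)].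
Proof.
have split_nc (z : R[i]) (A B : R) : `|Re z| <= A -> `|Im z| <= B -> nc z <= A + B.
  by move=> h1 h2; apply: (le_trans (nc_le z)); exact: lerD.
have h2 (h : R[i]) : `|Re h| + `|Im h| <= 2 * nc h.
  by rewrite mulr_natl mulr2n lerD ?Re_le_nc ?Im_le_nc.
have lip (g1 g2 : R -> R -> R) : Ck 1 g1 -> Ck 1 g2 -> Lip (fun z => g1 (Re z) (Im z) +i* g2 (Re z) (Im z)).
  move=> H1 H2 [x y] r; have [C C0 hC] := Ck1_lip x y r H1; have [D D0 hD] := Ck1_lip x y r H2.
  exists (2 * (C + D)); first by rewrite mulr_ge0// addr_ge0.
  move=> h hr; have a := le_trans (Re_le_nc h) hr; have b := le_trans (Im_le_nc h) hr.
  apply: (@le_trans _ _ ((C + D) * (`|Re h| + `|Im h|))); last first.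
    have -> : 2 * (C + D) * nc h = (C + D) * (2 * nc h) by ring.
    by apply: ler_wpM2l; [exact: addr_ge0|exact: h2].
  rewrite mulrDl; apply: split_nc.
    by rewrite cReB /=; case: h a b {hr} => h1 h3 /= *; exact: hC.
  by rewrite cImB /=; case: h a b {hr} => h1 h3 /= *; exact: hD.
move=> sf; split.
- move=> [x y] r; have [C C0 hC] := Ck2_quad x y r (sf 2).1; have [D D0 hD] := Ck2_quad x y r (sf 2).2.
  exists (4 * (C + D)); first by rewrite mulr_ge0// addr_ge0.
  move=> h hr; have a := le_trans (Re_le_nc h) hr; have b := le_trans (Im_le_nc h) hr.
  apply: (@le_trans _ _ ((C + D) * (`|Re h| + `|Im h|) ^+ 2)); last first.
    have : (`|Re h| + `|Im h|) ^+ 2 <= (2 * nc h) ^+ 2.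
      by rewrite lerXn2r ?nnegrE ?addr_ge0 ?mulr_ge0 ?nc_ge0.
    rewrite exprMn; move: (_ ^+ 2) (nc h ^+ 2) (addr_ge0 C0 D0) => U Z' CD UZ.
    have -> : 4 * (C + D) * Z' = (C + D) * (2 ^+ 2 * Z') by ring.
    exact: ler_wpM2l.
  rewrite mulrDl; case: h a b {hr} => h1 h3 /= a b; apply: split_nc.
    rewrite !cReB cReD !cReM /= !mul0r !subr0; exact: hC.
  rewrite !cImB cImD !cImM /= !mul0r !addr0; exact: hD.
- have [_ [_ _ c1 _]] := (sf 2).1; have [_ [_ _ c2 _]] := (sf 2).2.
  exact: (lip _ _ c1 c2).
- have [_ [_ _ _ c1]] := (sf 2).1; have [_ [_ _ _ c2]] := (sf 2).2.
  exact: (lip _ _ c1 c2).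
Qed.

Lemma smooth_diff_upto n f : smooth f -> diff_upto n f.
Proof.
elim: n f => [|n IH] f sf; first by have [F _ _] := smooth_rdiff sf; exact: rdiff_Lip F.
have [F _ _] := smooth_rdiff sf; exists (dx f), (dy f); split=> //; apply: IH => m.
  by have [[_ [_ _ c1 _]] [_ [_ _ c2 _]]] := sf m.+1; split; [exact: c1|exact: c2].
by have [[_ [_ _ _ c1]] [_ [_ _ _ c2]]] := sf m.+1; split; [exact: c1|exact: c2].
Qed.

End From_smooth.

(** * Stokes' theorem on a period parallelogram *)

Section Stokes.
Variable R : realType.
Local Notation mu := (@lebesgue_measure R).
Local Notation toC := (real_complex R).
Local Notation I01 := (`[0%R, 1%R]%classic : set (measurableTypeR R)).
Local Notation int01 := (cint I01).
Implicit Types (f h : R[i] -> R[i]) (k kd : R -> R -> R).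

Lemma lip_continuous (g : R -> R) : (forall x, exists2 C, 0 <= C & forall d, `|d| <= 1 ->
  `|g (x + d) - g x| <= C * `|d|) -> continuous g.
Proof.
move=> H x; apply/cvgrPdist_le => e e0; have [C C0 hC] := H x.
have C1 : 0 < C + 1 by rewrite ltr_wpDl.
have d0 : 0 < Num.min 1 (e / (C + 1)) by rewrite lt_min ltr01 divr_gt0.
near=> y.
have xy : `|x - y| <= Num.min 1 (e / (C + 1)).
  by near: y; move/cvgrPdist_le: (@cvg_id _ (nbhs x)); exact.
move: xy; rewrite le_min => /andP[h1 h2]; rewrite distrC in h1 h2.
have := hC _ h1; rewrite subrKC => h; rewrite distrC; apply: (le_trans h).
by move: h2; rewrite ler_pdivlMr//; apply: le_trans; rewrite mulrC ler_wpM2l// lerDl.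
Unshelve. all: by end_near. Qed.

Lemma Lip_path f (a c : R[i]) : Lip f -> ccont (fun s => f (toC s * a + c)).
Proof.
move=> Hf.
have H (s : R) : exists2 C, 0 <= C & forall d, `|d| <= 1 ->
    nc (f (toC (s + d) * a + c) - f (toC s * a + c)) <= C * `|d|.
  have [C C0 hC] := Hf (toC s * a + c) (nc a).
  exists (C * nc a); first by rewrite mulr_ge0 ?nc_ge0.
  move=> d d1; have := hC (toC d * a); rewrite ncM nc_real => /(_ (ler_piMl (nc_ge0 a) d1)).
  have -> : toC s * a + c + toC d * a = toC (s + d) * a + c by rewrite rmorphD; ring.
  by rewrite mulrCA -mulrA (mulrC `|d|) mulrA mulrC mulrA.
split; apply: lip_continuous => s; have [C C0 hC] := H s; exists C => // d d1.
  by rewrite -cReB (le_trans (Re_le_nc _))// hC.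
by rewrite -cImB (le_trans (Im_le_nc _))// hC.
Qed.

Lemma rdiff_path f fx fy (a c : R[i]) (s : R) : rdiff f fx fy ->
  let d := fun s => toC (Re a) * fx (toC s * a + c) + toC (Im a) * fy (toC s * a + c) in
  is_derive s (1 : R) (fun s => Re (f (toC s * a + c))) (Re (d s)) /\
  is_derive s (1 : R) (fun s => Im (f (toC s * a + c))) (Im (d s)).
Proof.
move=> F d; have [C C0 hC] := F (toC s * a + c) (nc a).
have H e : `|e| <= 1 -> nc (f (toC (s + e) * a + c) - f (toC s * a + c) - toC e * d s) <= C * nc a ^+ 2 * e ^+ 2.
  move=> e1; have := hC (toC e * a); rewrite ncM nc_real => /(_ (ler_piMl (nc_ge0 a) e1)).
  have -> : toC s * a + c + toC e * a = toC (s + e) * a + c by rewrite rmorphD; ring.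
  have -> : toC (Re (toC e * a)) * fx (toC s * a + c) + toC (Im (toC e * a)) * fy (toC s * a + c) = toC e * d s.
    by rewrite cReM cImM [Re (toC e)]/= [Im (toC e)]/= !mul0r subr0 addr0 !rmorphM /d; ring.
  by rewrite exprMn real_normK ?num_real// (mulrC (e ^+ 2)) mulrA.
split; apply: (@quad_is_derive _ _ _ _ (C * nc a ^+ 2) 1) => // e e1; apply: le_trans (H e e1).
  by apply: le_trans (Re_le_nc _); rewrite !cReB cReM /= mul0r subr0.
by apply: le_trans (Im_le_nc _); rewrite !cImB cImM /= mul0r addr0.
Qed.

Lemma integrable01 (g : R -> R) : continuous g -> mu.-integrable I01 (EFin \o g).
Proof.
move=> cg; apply: continuous_compact_integrable; first exact: segment_compact.
exact: continuous_subspaceT.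
Qed.

Lemma local_bound kd (s : R) :
  (forall r : R, exists M, forall s t, `|s| <= r -> 0 <= t <= 1 -> `|kd s t| <= M) ->
  exists2 M, 0 <= M & forall x t, x \in `]s - 1, s + 1[%R -> I01 t -> `|kd x t| <= M.
Proof.
move=> bd; have [M hM] := bd (`|s| + 1); exists `|M| => // x t; rewrite in_itv /= => /andP[x1 x2].
rewrite /= in_itv /= => t01; apply: (le_trans _ (ler_norm _)); apply: hM => //.
rewrite -(subrK s x) (le_trans (ler_normD _ _))// addrC lerD2l ler_norml.
by apply/andP; split; lra.
Qed.

Lemma integral01_continuous kd :
  (forall s, continuous (kd s)) -> (forall t, continuous (fun s => kd s t)) ->
  (forall r : R, exists M, forall s t, `|s| <= r -> 0 <= t <= 1 -> `|kd s t| <= M) ->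
  continuous (fun s => \int[mu]_(t in I01) kd s t).
Proof.
move=> ckd ckd2 bd s; have [M M0 hM] := local_bound s bd.
apply: (@continuity_under_integral _ _ _ mu kd I01 _ (s - 1) (s + 1) _ _ (cst M)).
- exact: measurable_itv.
- by move=> x _; exact: integrable01.
- by apply: aeW => t _ x _; exact: ckd2.
- exact: integrable_cst01.
- by move=> x Ix; apply: aeW => t It; apply: hM => //.
- by rewrite inE /= in_itv /=; apply/andP; split; lra.
Qed.

(** The derivative in a variable in which a function is periodic integrates to
    zero: differentiate under the inner integral, then apply the fundamental
    theorem of calculus. *)
Lemma integral_periodic_deriv k kd :
  (forall s t, is_derive s (1 : R) (fun s => k s t) (kd s t)) ->
  (forall s, continuous (k s)) -> (forall s, continuous (kd s)) ->
  (forall t, continuous (fun s => kd s t)) ->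
  (forall r : R, exists M, forall s t, `|s| <= r -> 0 <= t <= 1 -> `|kd s t| <= M) ->
  (forall t, k 1 t = k 0 t) ->
  \int[mu]_(s in I01) (\int[mu]_(t in I01) kd s t) = 0.
Proof.
move=> dk ck ckd ckd2 bd per.
pose H s := \int[mu]_(t in I01) k s t; pose J s := \int[mu]_(t in I01) kd s t.
have Is (s : R) : `]s - 1, s + 1[%classic s by rewrite /= in_itv /=; apply/andP; split; lra.
have dH s : is_derive s (1 : R) H (J s).
  have [M M0 hM] := local_bound s bd.
  have E x t : partial1of2 k x t = kd x t by rewrite partial1of2E; have [_ ->] := dk x t.
  apply: DeriveDef.
    apply: (@derivable_under_integral _ _ _ mu k I01 _ s (s - 1) (s + 1) (Is s) _ _ (cst M)) => //.
    - by move=> x _; exact: integrable01.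
    - exact: integrable_cst01.
    - by move=> x t Ix It; rewrite E; apply: hM.
  rewrite -derive1E (@differentiation_under_integral _ _ _ mu k I01 _ s (s - 1) (s + 1) (Is s) _ _ (cst M)) => //.
  - by apply: eq_Rintegral => t _; exact: E.
  - by move=> x _; exact: integrable01.
  - exact: integrable_cst01.
  - by move=> x t Ix It; rewrite E; apply: hM.
rewrite (integral01_deriv (integral01_continuous ckd ckd2 bd) dH).
apply/eqP; rewrite subr_eq0; apply/eqP.
by apply: eq_Rintegral => t _; exact: per.
Qed.

Lemma Lip_bound f (r : R) : Lip f -> exists M, forall u, nc u <= r -> nc (f u) <= M.
Proof.
move=> Hf; have [C C0 hC] := Hf 0 r; exists (C * r + nc (f 0)) => u ur.
rewrite -(subrK (f 0) (f u)) (le_trans (ncD _ _))// lerD2r.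
by have := hC u ur; rewrite add0r => h; apply: (le_trans h); exact: ler_wpM2l.
Qed.

Lemma Lip_path_bound f (a b : R[i]) (r : R) : Lip f -> exists M, forall s t : R, `|s| <= r -> 0 <= t <= 1 ->
  nc (f (toC s * a + toC t * b)) <= M.
Proof.
move=> Lf; have [M hM] := Lip_bound (r * nc a + nc b) Lf; exists M => s t sr /andP[t0 t1]; apply: hM.
apply: (le_trans (ncD _ _)); rewrite !ncM !nc_real lerD ?ler_wpM2r ?nc_ge0//.
by rewrite ler_piMl ?nc_ge0// ger0_norm.
Qed.

Lemma Lip_path_t f (a b : R[i]) (s : R) : Lip f -> ccont (fun t => f (toC s * a + toC t * b)).
Proof. by move=> Lf; under eq_fun do rewrite addrC; exact: Lip_path. Qed.

Lemma Lip_inner_ccont f (a b : R[i]) : Lip f ->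
  ccont (fun s => int01 (fun t => f (toC s * a + toC t * b))).
Proof.
move=> Lf; have bd r := Lip_path_bound a b r Lf.
split; apply: integral01_continuous.
- by move=> s; exact: (Lip_path_t a b s Lf).1.
- by move=> t; exact: (Lip_path a (toC t * b) Lf).1.
- by move=> r; have [M hM] := bd r; exists M => s t sr t01; apply: le_trans (Re_le_nc _) (hM _ _ sr t01).
- by move=> s; exact: (Lip_path_t a b s Lf).2.
- by move=> t; exact: (Lip_path a (toC t * b) Lf).2.
- by move=> r; have [M hM] := bd r; exists M => s t sr t01; apply: le_trans (Im_le_nc _) (hM _ _ sr t01).
Qed.

Lemma ccont_cintegrable01 (g : R -> R[i]) : ccont g -> cintegrable I01 g.
Proof. by move=> [g1 g2]; split; exact: integrable01. Qed.

(** The integral over the parallelogram of sides a and b, in the coordinates of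
    the sides. *)
Definition cell_int (a b : R[i]) f : R[i] :=
  int01 (fun s => int01 (fun t => f (toC s * a + toC t * b))).

Let mI : measurable I01. Proof. exact: measurable_itv. Qed.

Lemma cell_intD (a b : R[i]) f h : Lip f -> Lip h ->
  cell_int a b (fun u => f u + h u) = cell_int a b f + cell_int a b h.
Proof.
move=> Lf Lh; rewrite -[RHS](cintD mI); try by apply: ccont_cintegrable01; exact: Lip_inner_ccont.
by apply: eq_cint => s _; rewrite -[RHS](cintD mI)//; apply: ccont_cintegrable01; exact: Lip_path_t.
Qed.

Lemma cell_intZ (a b : R[i]) f (k : R[i]) : Lip f ->
  cell_int a b (fun u => k * f u) = k * cell_int a b f.
Proof.
move=> Lf; rewrite -[RHS](cintZ _ mI); last by apply: ccont_cintegrable01; exact: Lip_inner_ccont.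
by apply: eq_cint => s _; rewrite -[RHS](cintZ _ mI)//; apply: ccont_cintegrable01; exact: Lip_path_t.
Qed.

Lemma eq_cell_int (a b : R[i]) f h : (forall u, f u = h u) -> cell_int a b f = cell_int a b h.
Proof. by move=> /funext ->. Qed.

Lemma cell_int0 (a b : R[i]) : cell_int a b (fun=> 0) = 0.
Proof. by rewrite -[RHS](cint0 I01); apply: eq_cint => s _; exact: cint0. Qed.

Lemma Lip_scale f (k : R[i]) : Lip f -> Lip (fun u => k * f u).
Proof. by apply: (@diff_uptoM _ 0); exact: (@diff_upto_cst _ 0). Qed.

Lemma Lip_dbar f : smooth f -> Lip (dbar f).
Proof.
move=> sf; have [_ Lx Ly] := smooth_rdiff sf; apply: Lip_scale.
exact: (@diff_uptoD _ 0 _ _ Lx (Lip_scale 'i%C Ly)).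
Qed.

Lemma Lip_sum (I : Type) (r : seq I) (f : I -> R[i] -> R[i]) : (forall i, Lip (f i)) ->
  Lip (fun u => \sum_(i <- r) f i u).
Proof.
move=> Lf; elim: r => [|i r IH].
  by under eq_fun do rewrite big_nil; exact: (@diff_upto_cst _ 0).
by under eq_fun do rewrite big_cons; apply: (@diff_uptoD _ 0); [exact: Lf|exact: IH].
Qed.

Lemma cell_int_sum (a b : R[i]) (I : Type) (r : seq I) (f : I -> R[i] -> R[i]) :
  (forall i, Lip (f i)) ->
  cell_int a b (fun u => \sum_(i <- r) f i u) = \sum_(i <- r) cell_int a b (f i).
Proof.
move=> Lf; elim: r => [|i r IH].
  by rewrite big_nil -[RHS](cell_int0 a b); apply: eq_cell_int => u; rewrite big_nil.
rewrite big_cons -IH -cell_intD//; last exact: Lip_sum.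
by apply: eq_cell_int => u; rewrite big_cons.
Qed.

Section Period_parallelogram.
Variables (f fx fy : R[i] -> R[i]) (a b : R[i]).
Hypotheses (F : rdiff f fx fy) (Lx : Lip fx) (Ly : Lip fy).
Hypotheses (fa : forall u, f (u + a) = f u) (fb : forall u, f (u + b) = f u).

Let dir c u := toC (Re c) * fx u + toC (Im c) * fy u.

Let Lip_dir c : Lip (dir c).
Proof. by apply: (@diff_uptoD _ 0); apply: (@diff_uptoM _ 0) => //; exact: (@diff_upto_cst _ 0). Qed.

Lemma stokes_inner : cell_int a b (dir b) = 0.
Proof.
rewrite -[RHS](cint0 I01); apply: eq_cint => s _.
have E t : toC s * a + toC t * b = toC t * b + toC s * a by rewrite addrC.
have [c1 c2] := Lip_path b (toC s * a) (Lip_dir b).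
have e1 : f (toC 1 * b + toC s * a) = f (toC 0 * b + toC s * a).
  by rewrite rmorph1 rmorph0 mul1r mul0r add0r addrC fb.
rewrite (eq_cint (g := fun t => dir b (toC t * b + toC s * a))); last by move=> t _; rewrite E.
apply: complexP => /=.
  rewrite (integral01_deriv c1 (fun t => (rdiff_path b (toC s * a) t F).1)).
  by rewrite (congr1 (@complex.Re _) e1) subrr.
rewrite (integral01_deriv c2 (fun t => (rdiff_path b (toC s * a) t F).2)).
by rewrite (congr1 (@complex.Im _) e1) subrr.
Qed.

Lemma stokes_outer : cell_int a b (dir a) = 0.
Proof.
have per t : f (toC 1 * a + toC t * b) = f (toC 0 * a + toC t * b).
  by rewrite rmorph1 rmorph0 mul1r mul0r add0r addrC fa.
have bd r := Lip_path_bound a b r (Lip_dir a).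
apply: complexP; rewrite /=.
  apply: (@integral_periodic_deriv
    (fun s t => Re (f (toC s * a + toC t * b))) (fun s t => Re (dir a (toC s * a + toC t * b)))).
  - by move=> s t; exact: (rdiff_path a (toC t * b) s F).1.
  - by move=> s; exact: (Lip_path_t a b s (rdiff_Lip F)).1.
  - by move=> s; exact: (Lip_path_t a b s (Lip_dir a)).1.
  - by move=> t; exact: (Lip_path a (toC t * b) (Lip_dir a)).1.
  - by move=> r; have [M hM] := bd r; exists M => s t sr t01; apply: le_trans (Re_le_nc _) (hM _ _ sr t01).
  - by move=> t; exact: congr1 (per t).
apply: (@integral_periodic_deriv
  (fun s t => Im (f (toC s * a + toC t * b))) (fun s t => Im (dir a (toC s * a + toC t * b)))).
- by move=> s t; exact: (rdiff_path a (toC t * b) s F).2.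
- by move=> s; exact: (Lip_path_t a b s (rdiff_Lip F)).2.
- by move=> s; exact: (Lip_path_t a b s (Lip_dir a)).2.
- by move=> t; exact: (Lip_path a (toC t * b) (Lip_dir a)).2.
- by move=> r; have [M hM] := bd r; exists M => s t sr t01; apply: le_trans (Im_le_nc _) (hM _ _ sr t01).
- by move=> t; exact: congr1 (per t).
Qed.

End Period_parallelogram.

(** Stokes' theorem on a period parallelogram.  For holomorphic f, the product of f
    with the d-bar derivative of g is the d-bar derivative of the periodic function
    f g, hence a combination of its derivatives along the two sides, which integrate
    to zero. *)
Lemma stokes_dbar f df g (a b : R[i]) :
  rdiff f df (fun u => 'i%C * df u) -> Lip df -> smooth g ->
  (forall u, f (u + a) * g (u + a) = f u * g u) ->
  (forall u, f (u + b) * g (u + b) = f u * g u) ->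
  Re a * Im b - Im a * Re b != 0 ->
  cell_int a b (fun u => f u * dbar g u) = 0.
Proof.
move=> F Ld sg fga fgb d0; have [G Lx Ly] := smooth_rdiff sg.
have Lf := rdiff_Lip F; have Lg := rdiff_Lip G.
have H := rdiff_mul F G; set hx := (fun u => df u * g u + _) in H; set hy := (fun u => _ + f u * dy g u) in H.
have LM p q : Lip p -> Lip q -> Lip (fun u => p u * q u) := @diff_uptoM R 0 p q.
have LD p q : Lip p -> Lip q -> Lip (fun u => p u + q u) := @diff_uptoD R 0 p q.
have Lhx : Lip hx.
  by rewrite /hx; apply: (LD); exact: LM.
have Lhy : Lip hy.
  rewrite /hy; apply: (LD); apply: (LM) => //.
  by apply: (LM) => //; exact: (@diff_upto_cst _ 0).
(* dir c is the derivative of f g in the direction c. *)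
pose dir c u := toC (Re c) * hx u + toC (Im c) * hy u.
have Ldir c : Lip (dir c).
  by rewrite /dir; apply: (LD); apply: (LM) => //; exact: (@diff_upto_cst _ 0).
have inner := stokes_inner a H Lhx Lhy fgb; have outer := stokes_outer b H Lhx Lhy fga.
set d := Re a * Im b - Im a * Re b in d0.
pose k1 := (toC (2 * d))^-1 * (- 'i%C * b); pose k2 := (toC (2 * d))^-1 * ('i%C * a).
have d2 : toC (2 * d) != 0 by rewrite fmorph_eq0 mulf_neq0.
have E u : f u * dbar g u = k1 * dir a u + k2 * dir b u.
  have K1 : toC (2 * d) * k1 = - 'i%C * b := mulVKf d2 _.
  have K2 : toC (2 * d) * k2 = 'i%C * a := mulVKf d2 _.
  have D2 : toC (2 * d) * 2^-1 = toC d by rewrite rmorphM rmorph_nat mulrC mulKf ?pnatr_eq0.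
  apply: (mulfI d2).
  have -> : toC (2 * d) * (f u * dbar g u) = toC (2 * d) * 2^-1 * (f u * (dx g u + 'i%C * dy g u)).
    by rewrite /dbar; ring.
  have -> : toC (2 * d) * (k1 * dir a u + k2 * dir b u) =
    toC (2 * d) * k1 * dir a u + toC (2 * d) * k2 * dir b u by ring.
  rewrite K1 K2 D2 /dir /hx /hy.
  have Ea := complexE a; have Eb := complexE b.
  have i2 : 'i%C * 'i%C = -1 :> R[i] by rewrite -expr2 sqr_i.
  have -> : toC d = toC (Re a) * toC (Im b) - toC (Im a) * toC (Re b) by rewrite /d rmorphB !rmorphM.
  move: Ea Eb i2.
  move: (toC (Re a)) (toC (Im a)) (toC (Re b)) (toC (Im b)) (f u) (df u) (g u) (dx g u) (dy g u) 'i%C.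
  by move=> a1 a2 b1 b2 f0 f1 g0 g1 g2 i -> -> i2; ring: i2.
rewrite (_ : (fun u => _) = (fun u => k1 * dir a u + k2 * dir b u)); last exact/funext.
rewrite cell_intD ?cell_intZ ?inner ?outer ?mulr0 ?addr0//.
  by apply: (LM) => //; exact: (@diff_upto_cst _ 0).
by apply: (LM) => //; exact: (@diff_upto_cst _ 0).
Qed.

End Stokes.

(** * The theta functions *)

Section Theta_function.
Variable R : realType.
Local Notation toC := (real_complex R).
Variables (fr : frame R) (mu : nat) (rho sg : R).
Hypotheses (fr_gt0 : 0 < Im (tau fr)) (mu0 : (0 < mu)%N).

Let kappa : R := pi * mu%:R / (2 * Im (tau fr)).

Let w (n : int) : R[i] := 2 * pii * (n%:~R + toC rho) * (mu%:R * (om2 fr)^-1).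
Let c (n : int) : R[i] :=
  cexp (pii * (n%:~R + toC rho) ^+ 2 * mu%:R * tau fr + 2 * pii * (n%:~R + toC rho) * toC sg).

Let W : R := nc (2 * pii * (mu%:R * (om2 fr)^-1)) * (1 + `|rho|).

Let intC (n : int) : (n%:~R : R[i]) = toC n%:~R.
Proof. by rewrite rmorph_int. Qed.

Let wW n : nc (w n) <= W * (1 + `|n|%N%:R).
Proof.
have -> : w n = 2 * pii * (mu%:R * (om2 fr)^-1) * toC (n%:~R + rho).
  by rewrite /w intC rmorphD; ring.
rewrite ncM nc_real /W -[leRHS]mulrA; apply: ler_wpM2l; first exact: nc_ge0.
apply: (le_trans (ler_normD _ _)); rewrite abszR.
have := normr_ge0 (n%:~R : R); have := normr_ge0 rho; nra.
Qed.

Let rapid_c : rapid c.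
Proof.
rewrite /rapid /c; move: (tau fr) fr_gt0 => t t0 B; pose a := pi * mu%:R * Im t.
have a0 : 0 < a by rewrite !mulr_gt0 ?pi_gt0 ?ltr0n.
exists (expR (`|B| ^+ 2 / (4 * a) + `|B| * `|rho|)); first exact: expR_ge0.
move=> n; rewrite nc_cexp -expRD ler_expR.
have -> : pii * (n%:~R + toC rho) ^+ 2 * mu%:R * t + 2 * pii * (n%:~R + toC rho) * toC sg =
   toC ((n%:~R + rho) ^+ 2 * (pi * mu%:R)) * ('i%C * t) + toC (2 * pi * (n%:~R + rho) * sg) * 'i%C.
  by rewrite intC /pii !expr2 !rmorphM !rmorphD !rmorph_nat; ring.
rewrite cReD !cReM cImM /= !(mul0r, mulr0, mul1r, mulr1, add0r, addr0, subr0, sub0r, oppr0).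
rewrite [leLHS](_ : _ = - (a * (n%:~R + rho) ^+ 2)); last by rewrite /a; ring.
apply: (le_trans (quad_ge `|B| _ a0)).
have h1 : `|n|%N%:R <= `|n%:~R + rho| + `|rho| :> R.
  by rewrite abszR -{1}(addrK rho (n%:~R)) ler_normB.
have h2 : B * `|n|%N%:R <= `|B| * (`|n%:~R + rho| + `|rho|).
  apply: (@le_trans _ _ (`|B| * `|n|%N%:R)); first by rewrite ler_wpM2r// ler_norm.
  by rewrite ler_wpM2l.
move: h2; move: (`|B| ^+ 2 / _) (`|n%:~R + rho|) => x y; lra.
Qed.

Lemma theta_funE : theta_fun fr mu (toC rho) (toC sg) =
  (fun u => cexp (toC kappa * om2 fr ^- 2 * u * u) * eseries w c u).
Proof.
apply/funext => u; rewrite /theta_fun /eseries -[in RHS]mulrA -expr2; congr (_ * zsum _).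
apply/funext => n; rewrite /c /w -cexpD; congr cexp; ring.
Qed.

(** Holomorphy in the form used in Stokes' theorem: the derivative in the direction
    of i is i times the derivative along the real axis. *)
Lemma theta_fun_rdiff : exists df, [/\ rdiff (theta_fun fr mu (toC rho) (toC sg)) df (fun u => 'i%C * df u),
  Lip df & forall n, diff_upto n (theta_fun fr mu (toC rho) (toC sg))].
Proof.
pose k := toC kappa * om2 fr ^- 2; pose dq u := k * u + k * u; pose de := eseries w (fun n => w n * c n).
pose q u := k * u * u.
have Sq n : diff_upto n q by apply: diff_uptoM; [apply: diff_uptoM; [exact: diff_upto_cst|exact: diff_upto_id]|exact: diff_upto_id].
have RDq : rdiff q dq (fun u => 'i%C * dq u).
  move=> v r; exists (nc k); first exact: nc_ge0.
  move=> h _.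
  have -> : toC (Re h) * dq v + toC (Im h) * ('i%C * dq v) = h * dq v.
    by rewrite [in RHS](complexE h); ring.
  have -> : q (v + h) - q v - h * dq v = k * (h * h) by rewrite /q /dq; ring.
  by rewrite !ncM expr2.
have := rdiff_mul (rdiff_cexp RDq) (eseries_rdiff wW rapid_c); rewrite theta_funE.
rewrite (_ : (fun u => 'i%C * _ * _ * _ + _) =
   (fun u => 'i%C * (dq u * cexp (q u) * eseries w c u + cexp (q u) * de u))); last first.
  by apply/funext => u; rewrite /de; ring.
move=> H; exists (fun u => dq u * cexp (q u) * eseries w c u + cexp (q u) * de u).
have Se n : diff_upto n (eseries w c) := eseries_diff_upto wW n rapid_c.
have Sd n : diff_upto n de := eseries_diff_upto wW n (rapid_deriv wW rapid_c).
have Sc n : diff_upto n (fun u => cexp (q u)) := diff_upto_cexp (Sq n).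
have Sdq n : diff_upto n dq by apply: diff_uptoD; apply: diff_uptoM; try exact: diff_upto_cst; exact: diff_upto_id.
split; [exact: H| |by move=> n; exact: diff_uptoM].
apply: (@diff_uptoD _ 0); last exact: (@diff_uptoM _ 0).
by apply: (@diff_uptoM _ 0); [apply: (@diff_uptoM _ 0); [exact: (Sdq 0)|exact: (Sc 0)]|exact: (Se 0)].
Qed.

Lemma nc_sqr (z : R[i]) : toC (nc z ^+ 2) = z * z^*.
Proof. by rewrite rmorphXn; exact: sqr_normc. Qed.

(** In the coordinates of the basis a theta function is exp (pi lambda |u|^2) times
    the twisted series; the quadratic exponential in the definition of theta_fun
    is what the twist requires. *)
Lemma theta_fun_theta_twist (x y : R) : om2 fr != 0 ->
  let u := toC x * om1 fr + toC y * om2 fr in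
  theta_fun fr mu (toC rho) (toC sg) u =
  cexp (toC (kappa / nc (om2 fr) ^+ 2) * (u * u^*)) * theta_twist (tau fr) mu%:R rho sg x y.
Proof.
move=> o0 u; pose v := toC x * tau fr + toC y.
have uv : u = om2 fr * v by rewrite /u /v /tau; field.
have n0 : nc (om2 fr) ^+ 2 != 0 by apply: expf_neq0; apply: contra_neq o0 => /nc_eq0.
have -> : toC (kappa / nc (om2 fr) ^+ 2) * (u * u^*) = toC kappa * (v * v^*).
  by rewrite -!nc_sqr uv ncM -!rmorphM exprMn mulrA mulfVK.
have -> : theta_fun fr mu (toC rho) (toC sg) u = cexp (toC kappa * v * v) * zsum (fun n : int =>
    cexp (pii * (n%:~R + toC rho) ^+ 2 * mu%:R * tau fr + 2 * pii * (n%:~R + toC rho) * (mu%:R * v + toC sg))).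
  have ev : (om2 fr)^-1 * u = v by rewrite uv mulKf.
  rewrite /theta_fun; congr (cexp _ * zsum _).
    by rewrite -ev -/kappa -exprVn; ring.
  by apply/funext => n; rewrite -(mulrA mu%:R) ev.
have key : toC kappa * (v * v^*) - toC kappa * v * v = - (pii * mu%:R * toC x * v).
  have -> : toC kappa * (v * v^*) - toC kappa * v * v = toC kappa * (v^* - v) * v by ring.
  rewrite -mulNr; congr (_ * v).
  have -> : (mu%:R : R[i]) = toC mu%:R by rewrite rmorph_nat.
  rewrite /v /kappa; move: (tau fr) fr_gt0 => t t0.
  apply: complexP; rewrite /pii !(cReD, cImD, cReM, cImM, cReN, cImN) /=.
    by case: t t0 => t1 t2 /= t0; field; rewrite gt_eqF.
  by case: t t0 => t1 t2 /= t0; field; rewrite gt_eqF.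
have hb := geo_bounded_zsum (theta_term_geo_bounded mu0 fr_gt0 sg y (lexx `|rho + x|)).
have hz := sums_to_zsum (sums_toZ (cexp (toC kappa * (v * v^*) - toC kappa * v * v)) hb).
have -> : (fun n : int => cexp (pii * (n%:~R + toC rho) ^+ 2 * mu%:R * tau fr +
     2 * pii * (n%:~R + toC rho) * (mu%:R * v + toC sg))) =
   (fun n => cexp (toC kappa * (v * v^*) - toC kappa * v * v) * theta_term (tau fr) mu%:R sg (n%:~R + rho) x y).
  apply/funext => n; rewrite /theta_term /e2 -cexpD key; congr cexp.
  by rewrite intC !expr2 !(rmorphD, rmorphM, rmorph_nat, fmorphV) /v; field.
rewrite hz mulrA -cexpD; congr (cexp _ * _); ring.
Qed.

End Theta_function.

(** * Rationality of the period integral *)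

Section Rational_values.
Variables (R : realType) (F : fieldExtType rat) (iota : {rmorphism F -> R[i]}).
Local Notation toC := (real_complex R).
Local Notation MA := (max_abelian iota).

Lemma fieldExt_pchar0 : [pchar F] =i pred0.
Proof. by move=> p; rewrite (pchar_lalg F) Num.Theory.pchar_num. Qed.
Local Notation pF := fieldExt_pchar0.

Lemma max_abelian_nat (n : nat) : MA n%:R.
Proof. by rewrite -(rmorph_nat iota); exact: max_abelian_base pF _. Qed.

Definition rational : {pred R} := [pred x | `[< exists y : rat, x = ratr y >]].

Lemma rationalP x : reflect (exists y : rat, x = ratr y) (x \in rational).
Proof. exact: asboolP. Qed.

Lemma rational_ratr (y : rat) : ratr y \in rational.
Proof. by apply/rationalP; exists y. Qed.
Lemma rationalD x y : x \in rational -> y \in rational -> x + y \in rational.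
Proof. by move=> /rationalP[a ->] /rationalP[b ->]; rewrite -rmorphD rational_ratr. Qed.
Lemma rationalM x y : x \in rational -> y \in rational -> x * y \in rational.
Proof. by move=> /rationalP[a ->] /rationalP[b ->]; rewrite -rmorphM rational_ratr. Qed.
Lemma rationalN x : x \in rational -> - x \in rational.
Proof. by move=> /rationalP[a ->]; rewrite -rmorphN rational_ratr. Qed.
Lemma rationalV x : x \in rational -> x^-1 \in rational.
Proof. by move=> /rationalP[a ->]; rewrite -fmorphV rational_ratr. Qed.
Lemma rational_int (n : int) : n%:~R \in rational.
Proof. by rewrite -(rmorph_int (ratr : {rmorphism rat -> R})) rational_ratr. Qed.
Lemma rational_nat (n : nat) : n%:R \in rational.
Proof. exact: (rational_int n). Qed.

(** For rational x this is a root of unity. *)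
Lemma max_abelian_e2 x : x \in rational -> MA (e2 (toC x)).
Proof.
move=> /rationalP[y ->]; apply: (@max_abelian_root1 _ _ _ pF `|denq y|%N).
  by rewrite absz_gt0 denq_neq0.
rewrite -[X in X = 1]/(exprz _ `|denq y|%N) -e2Z.
have -> : (`|denq y|%N%:~R : R[i]) * toC (ratr y) = (numq y)%:~R.
  rewrite absz_denq -(rmorph_int toC) -rmorphM -[RHS](rmorph_int toC); congr toC.
  have -> : (denq y)%:~R * ratr y = ratr ((denq y)%:~R * y) :> R by rewrite rmorphM rmorph_int.
  by rewrite mulrC -[y in y * _]divq_num_den mulfVK ?intr_eq0 ?denq_neq0// rmorph_int.
exact: e2_int.
Qed.

(** The period integral of two theta functions with rational characteristics lies
    in the line spanned by a number J that depends only on the periods: the phases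
    are roots of unity, and mu and its square root lie in the field. *)
Lemma pairing_rational (tau tau' : R[i]) (p p' q q' : int) :
  0 < Im tau -> 0 < Im tau' -> p * q' - p' * q = -1 ->
  exists J : R[i], forall (mu : nat) (rho sg rho' sg' : R), (0 < mu)%N ->
    rho \in rational -> sg \in rational -> rho' \in rational -> sg' \in rational ->
    e2 (toC (sg' - thchar mu rho sg p p')) = 1 ->
    e2 (toC (mu%:R * rho' + thchar mu rho sg q q')) = 1 ->
    exists2 a, MA a & pairing_int tau tau' p p' q q' mu rho sg rho' sg' = a * J.
Proof.
move=> t0 t0' det.
have ratE := (rationalD, rationalM, rationalN, rationalV, rational_nat, rational_int).
have [q0|q0] := eqVneq q 0.
  move: det; rewrite q0 => det; exists (cint setT (Psi tau tau' p p' 1)) => mu rho sg rho' sg' mu0 r1 r2 r3 r4 c1 c2.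
  have [->|->] := pairing_parallel t0 t0' det mu0 c1 c2.
    by exists 0; rewrite ?mul0r//; exact: (max_abelian_nat 0).
  eexists; last by rewrite mulrA.
  apply: (max_abelianM pF); first by apply: max_abelian_e2; rewrite !ratE ?(rational_nat 1).
  rewrite fmorphV; apply: (max_abelianV pF); apply: (@max_abelian_sqrt _ _ _ pF mu%:R).
  by rewrite rmorph_nat -rmorphXn sqr_sqrtr ?ler0n// rmorph_nat.
have Q0 : (q%:~R : R) != 0 by rewrite intr_eq0.
exists (cint setT (Iint tau tau' p p' q q' 1)) => mu rho sg rho' sg' mu0 r1 r2 r3 r4 c1 c2.
rewrite (pairing_Iint t0 t0' det mu0 c1 c2 Q0) (Iint_scale t0 t0' det mu0 Q0) mulrA.
eexists; last by [].
apply: (max_abelianM pF); last by rewrite fmorphV rmorph_nat; apply: (max_abelianV pF); exact: max_abelian_nat.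
apply: (max_abelian_sum pF) => l; apply: max_abelian_e2.
by rewrite /zeta /qform /shiftT !ratE ?(rational_nat 1).
Qed.

End Rational_values.

(** * Bases of the two lattices *)

Section Period_bases.
Variable R : realType.
Local Notation toC := (real_complex R).
Implicit Types (fr : frame R).

Lemma om2_neq0 fr : 0 < Im (tau fr) -> om2 fr != 0.
Proof. by apply: contraTneq => o0; rewrite /tau o0 invr0 mulr0 ltxx. Qed.

Lemma om1E fr : 0 < Im (tau fr) -> om1 fr = tau fr * om2 fr.
Proof. by move=> t0; rewrite /tau mulfVK// om2_neq0. Qed.

(** The area of the period parallelogram, with the sign of the orientation. *)
Definition area fr : R := Im (om1 fr * (om2 fr)^*).

Lemma areaE fr : 0 < Im (tau fr) -> area fr = nc (om2 fr) ^+ 2 * Im (tau fr).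
Proof.
move=> t0; rewrite /area {1}(om1E t0) -mulrA -nc_sqr mulrC cImM /= mul0r addr0.
by [].
Qed.

Lemma area_gt0 fr : 0 < Im (tau fr) -> 0 < area fr.
Proof.
move=> t0; rewrite areaE// mulr_gt0// exprn_gt0// lt_neqAle nc_ge0 andbT eq_sym.
by apply: contra_neq (om2_neq0 t0) => /nc_eq0.
Qed.

Lemma coords fr : 0 < Im (tau fr) -> forall u, exists x y : R,
  u = toC x * om1 fr + toC y * om2 fr.
Proof.
move=> t0 u; have o0 := om2_neq0 t0; pose v := u / om2 fr; pose x := Im v / Im (tau fr).
exists x, (Re v - x * Re (tau fr)).
rewrite (om1E t0) mulrA -mulrDl -[LHS](mulfVK o0) -/v; congr (_ * _).
rewrite /x; clearbody v; clear x; move: v (tau fr) t0 => [v1 v2] [t1 t2] /= t0; apply: complexP => /=.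
  by field; rewrite gt_eqF.
by field; rewrite gt_eqF.
Qed.

Lemma om_indep fr (a b : int) : 0 < Im (tau fr) ->
  a%:~R * om1 fr + b%:~R * om2 fr = 0 -> a = 0 /\ b = 0.
Proof.
move=> t0; have o0 := om2_neq0 t0; rewrite (om1E t0) mulrA -mulrDl => /eqP.
rewrite mulf_eq0 (negbTE o0) orbF => /eqP e.
have a0 : a = 0.
  have := congr1 (@complex.Im _) e.
  rewrite -!(rmorph_int toC) cImD cImM /= !(mul0r, addr0) => /eqP.
  by rewrite mulf_eq0 (gt_eqF t0) orbF intr_eq0 => /eqP.
split=> //; move: e; rewrite a0 mul0r add0r => /eqP; rewrite intr_eq0 => /eqP; exact.
Qed.

(** The map u |-> - conj u is an isomorphism of the second lattice onto the first
    one, so its matrix is invertible over the integers; as it reverses the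
    orientation, its determinant is -1 and the areas agree. *)
Lemma basis_change fr fr' (P P' : set (R[i] * R[i])) :
  0 < Im (tau fr) -> 0 < Im (tau fr') ->
  (forall m, (exists b, P (m, b)) <-> exists a b : int, m = a%:~R * om1 fr + b%:~R * om2 fr) ->
  (forall m, (exists b, P' (m, b)) <-> exists a b : int, m = a%:~R * om1 fr' + b%:~R * om2 fr') ->
  (forall m b, P' (m, b) <-> P (m^*, b)) ->
  exists p p' q q' : int, [/\ - (om1 fr')^* = p%:~R * om1 fr + p'%:~R * om2 fr,
    - (om2 fr')^* = q%:~R * om1 fr + q'%:~R * om2 fr,
    p * q' - p' * q = -1 & area fr = area fr'].
Proof.
move=> t0 t0' L L' PP'.
have neg (f : frame R) m : (exists a b : int, m = a%:~R * om1 f + b%:~R * om2 f) ->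
    exists a b : int, - m = a%:~R * om1 f + b%:~R * om2 f.
  by move=> [a [b ->]]; exists (- a), (- b); rewrite !rmorphN /= !mulNr opprD.
have to1 m : (exists a b : int, m = a%:~R * om1 fr' + b%:~R * om2 fr') ->
    exists a b : int, - m^* = a%:~R * om1 fr + b%:~R * om2 fr.
  by move=> /L'[b /PP' Pb]; apply: (neg fr); apply/L; exists b.
have to2 m : (exists a b : int, m = a%:~R * om1 fr + b%:~R * om2 fr) ->
    exists a b : int, - m^* = a%:~R * om1 fr' + b%:~R * om2 fr'.
  move=> /L[b Pb]; apply: (neg fr'); apply/L'; exists b; apply/PP'.
  by rewrite conjcK.
have b1 (f : frame R) : exists a b : int, om1 f = a%:~R * om1 f + b%:~R * om2 f.
  by exists 1, 0; rewrite mul1r mul0r addr0.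
have b2 (f : frame R) : exists a b : int, om2 f = a%:~R * om1 f + b%:~R * om2 f.
  by exists 0, 1; rewrite mul1r mul0r add0r.
have [p [p' e1]] := to1 _ (b1 fr'); have [q [q' e2]] := to1 _ (b2 fr').
have [a [a' f1]] := to2 _ (b1 fr); have [c [c' f2]] := to2 _ (b2 fr).
have conjE (m : R[i]) (i j : int) : - m^* = i%:~R * om1 fr' + j%:~R * om2 fr' ->
    m = i%:~R * (p%:~R * om1 fr + p'%:~R * om2 fr) + j%:~R * (q%:~R * om1 fr + q'%:~R * om2 fr).
  have mm (z : R[i]) : z = - (- z^*)^* by case: z => x y; apply: complexP => /=; rewrite ?opprK.
  move=> h; rewrite [LHS]mm h -e1 -e2 -!(rmorph_int toC).
  by case: (om1 fr') => x y; case: (om2 fr') => z t; apply: complexP => /=; ring.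
have ind (i j k l : int) : i%:~R * om1 fr + j%:~R * om2 fr = k%:~R * om1 fr + l%:~R * om2 fr ->
    i = k /\ j = l.
  move=> h; have [] := @om_indep fr (i - k) (j - l) t0; last by move=> *; split; lia.
  rewrite !intrB !mulrBl addrACA h -opprD; ring.
have [g1 g2] : 1 = a * p + a' * q /\ 0 = a * p' + a' * q'.
  by apply: ind; rewrite [1%:~R * _]mul1r [0%:~R * _]mul0r addr0 {1}(conjE _ _ _ f1) !(intrD, intrM); ring.
have [g3 g4] : 0 = c * p + c' * q /\ 1 = c * p' + c' * q'.
  by apply: ind; rewrite [1%:~R * _]mul1r [0%:~R * _]mul0r add0r {1}(conjE _ _ _ f2) !(intrD, intrM); ring.
(* The two matrices are inverse to each other, so the determinants are units. *)
have dd : (a * c' - a' * c) * (p * q' - p' * q) = 1.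
  have -> : (a * c' - a' * c) * (p * q' - p' * q) =
    (a * p + a' * q) * (c * p' + c' * q') - (a * p' + a' * q') * (c * p + c' * q) by ring.
  by rewrite -g1 -g2 -g3 -g4.
(* Conjugation reverses the sign of the area. *)
have ar : area fr' = - ((p * q' - p' * q)%:~R * area fr).
  have -> : area fr' = - Im ((- (om1 fr')^*) * (- (om2 fr')^*)^*).
    rewrite /area; case: (om1 fr') => x y; case: (om2 fr') => z t /=; ring.
  rewrite e1 e2 /area; congr (- _).
  rewrite -!(rmorph_int toC) !(intrB, intrM).
  move: (om1 fr) (om2 fr) => [x y] [z t]; rewrite /=; ring.
have det : p * q' - p' * q = -1.
  have A := area_gt0 t0; have A' := area_gt0 t0'.
  have : (p * q' - p' * q)%:~R < 0 :> R.
    by rewrite -(pmulr_llt0 _ A) -oppr_gt0 -ar.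
  rewrite ltrz0 => dn.
  move: dd dn; move: (_ - _) (_ - _) => D X XD D0; have X0 : X < 0 by nia.
  have [//|D2] : D = -1 \/ D <= -2 by lia.
  nia.
exists p, p', q, q'; split=> //.
by rewrite ar det mulN1r opprK.
Qed.

End Period_bases.

(** * Automorphy of the theta functions *)

Section Automorphy.
Variable R : realType.
Local Notation toC := (real_complex R).

(** Under a translation by m, the exponent pi lambda |u|^2 and the linear phase of
    the twisted series together change by the exponent of the factor of automorphy,
    up to a constant. *)
Lemma shift_exponent (o1 o2 beta u m : R[i]) (x y a b lam M c : R) :
  M = 2 * lam * Im (o1 * o2^*) -> u = toC x * o1 + toC y * o2 -> m = toC a * o1 + toC b * o2 ->
  beta + beta^* = m * m^* ->
  toC (pi * lam) * ((u + m) * (u + m)^*) + 2 * pii * toC (M / 2 * (b * x - a * y) + c) =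
  toC (pi * lam) * (u * u^*) + toC (2 * pi * lam) * (m^* * u + beta) +
    2 * pii * toC (c - lam * Im beta).
Proof.
case: o1 o2 beta => [x1 y1] [x2 y2] [b1 b2] -> -> -> hb.
have eb : b1 = ((a * x1 + b * x2) ^+ 2 + (a * y1 + b * y2) ^+ 2) / 2.
  have := congr1 (@complex.Re _) hb; rewrite !(cReD, cImD, cReM, cImM) /= => h.
  by move: h; lra.
apply: complexP; rewrite /pii eb !(cReD, cImD, cReM, cImM) /=; by field.
Qed.

Variables (fr : frame R) (b0 : R[i]) (r : int).
Hypotheses (fr_gt0 : 0 < Im (tau fr)) (b0R : Re b0 = 0) (b0I : 0 < Im b0) (r1 : 1 <= r).

(** The number lambda = i r / beta0, which is real as beta0 is purely imaginary. *)
Definition lam : R := r%:~R / Im b0.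

Lemma lam_gt0 : 0 < lam.
Proof. by rewrite divr_gt0// ltr0z; lia. Qed.

Let b0E : b0 = toC (Im b0) * 'i%C.
Proof. by case: b0 b0R => x y /= ->; apply: complexP => /=; ring. Qed.

Lemma factorE : 2 * pii * r%:~R / b0 = toC (2 * pi * lam).
Proof.
have n0 : toC (Im b0) != 0 by rewrite fmorph_eq0 gt_eqF.
have i0 : 'i%C != 0 :> R[i] by apply/eqP => -[/eqP]; rewrite oner_eq0.
rewrite {1}b0E /pii /lam !rmorphM fmorphV rmorph_nat rmorph_int; field.
by rewrite n0 i0.
Qed.

(** The degree mu of the bundle is 2 lambda times the area, so it is the same on the
    two curves. *)
Lemma mu_area (mu : nat) :
  mu%:R = 2 * ('i%C * r%:~R / b0) * `|om2 fr| ^+ 2 * toC (Im (tau fr)) ->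
  (0 < mu)%N /\ mu%:R = 2 * lam * area fr.
Proof.
move=> H.
have E : mu%:R = 2 * lam * area fr.
  apply: (@complexI R); rewrite rmorph_nat H.
  have n0 : toC (Im b0) != 0 by rewrite fmorph_eq0 gt_eqF.
  have i0 : 'i%C != 0 :> R[i] by apply/eqP => -[/eqP]; rewrite oner_eq0.
  rewrite areaE// sqr_normc -nc_sqr {1}b0E /lam !rmorphM fmorphV rmorph_nat rmorph_int; field.
  by rewrite n0 i0.
split=> //; rewrite -(ltr0n R) E; have := lam_gt0; have := area_gt0 fr_gt0.
by move: lam (area fr) => l A A0 l0; rewrite !mulr_gt0.
Qed.

Section Fixed_degree.
Variables (mu : nat) (rho sg : R).
Hypotheses (mu0 : (0 < mu)%N) (muA : mu%:R = 2 * lam * area fr).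

Let thf := theta_fun fr mu (toC rho) (toC sg).

Lemma theta_fun_theta_twist_lam (x y : R) (u := toC x * om1 fr + toC y * om2 fr) :
  thf u = cexp (toC (pi * lam) * (u * u^*)) * theta_twist (tau fr) mu%:R rho sg x y.
Proof.
rewrite /thf /u (theta_fun_theta_twist rho sg fr_gt0 mu0)/=; last exact: om2_neq0.
have -> // : pi * mu%:R / (2 * Im (tau fr)) / nc (om2 fr) ^+ 2 = pi * lam.
have := area_gt0 fr_gt0; rewrite muA areaE//; move: (nc _ ^+ 2) (Im _) fr_gt0 => A B B0 AB.
have A0 : 0 < A by rewrite -(pmulr_lgt0 _ B0).
by field; rewrite !gt_eqF.
Qed.

(** A theta function obeys the factor of automorphy up to the character of the
    lattice given by thchar and Im beta. *)
Lemma theta_fun_shift (a b : int) (beta u m : R[i]) :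
  m = a%:~R * om1 fr + b%:~R * om2 fr -> beta + beta^* = m * m^* ->
  thf (u + m) = thf u * cexp (toC (2 * pi * lam) * (m^* * u + beta)) *
    e2 (toC (thchar mu rho sg a b - lam * Im beta)).
Proof.
move=> mE hb; have [x [y uE]] := coords fr_gt0 u.
have mE' : m = toC a%:~R * om1 fr + toC b%:~R * om2 fr by rewrite !rmorph_int.
have umE : u + m = toC (x + a%:~R) * om1 fr + toC (y + b%:~R) * om2 fr.
  by rewrite uE mE' !rmorphD; ring.
have -> : thf (u + m) = cexp (toC (pi * lam) * ((u + m) * (u + m)^*)) *
    theta_twist (tau fr) mu%:R rho sg (x + a%:~R) (y + b%:~R).
  by rewrite {1}umE theta_fun_theta_twist_lam -umE.
have -> : thf u = cexp (toC (pi * lam) * (u * u^*)) * theta_twist (tau fr) mu%:R rho sg x y.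
  by rewrite {1}uE theta_fun_theta_twist_lam -uE.
rewrite (theta_twist_auto mu0 fr_gt0) mulrA -cexpD (shift_exponent _ muA uE mE' hb).
by rewrite !cexpD -/(e2 _); ring.
Qed.

End Fixed_degree.
End Automorphy.

(** * Rational sections *)

Section Theta_sections.
Variable R : realType.
Local Notation toC := (real_complex R).

(** Holomorphic functions with the regularity that Stokes' theorem and smoothness
    of the transforms require. *)
Definition regular_hol (f : R[i] -> R[i]) :=
  exists df, [/\ rdiff f df (fun u => 'i%C * df u), Lip df & forall n, diff_upto n f].

Lemma regular_hol_sum (I : Type) (s : seq I) (c : I -> R[i]) (f : I -> R[i] -> R[i]) :
  (forall i, regular_hol (f i)) -> regular_hol (fun u => \sum_(i <- s) c i * f i u).
Proof.
move=> hf; elim: s => [|i s [dg [G Lg Sg]]].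
  under eq_fun do rewrite big_nil.
  exists (fun=> 0); split; [|exact: (@diff_upto_cst _ 0)|by move=> n; exact: diff_upto_cst].
  move=> v r; exists 0 => // h _; rewrite !mulr0 addr0 !subr0 nc0 mul0r; exact: lexx.
have [df [F Lf Sf]] := hf i.
have C : rdiff (fun=> c i) (fun=> 0) (fun=> 0).
  by move=> v r; exists 0 => // h _; rewrite !mulr0 addr0 subr0 subrr nc0 mul0r.
under eq_fun do rewrite big_cons.
exists (fun u => c i * df u + dg u); split.
- have := rdiff_add (rdiff_mul C F) G.
  rewrite (_ : (fun u => 0 * _ + c i * df u + dg u) = fun u => c i * df u + dg u); last first.
    by apply/funext => u; rewrite mul0r add0r.
  rewrite (_ : (fun u => 0 * _ + _ + _) = fun u => 'i%C * (c i * df u + dg u)) //.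
  by apply/funext => u; ring.
- by apply: (@diff_uptoD _ 0) => //; apply: (@diff_uptoM _ 0) => //; exact: (@diff_upto_cst _ 0).
- by move=> n; apply: diff_uptoD => //; apply: diff_uptoM => //; exact: diff_upto_cst.
Qed.

Lemma ratrC (x : rat) : (ratr x : R[i]) = toC (ratr x).
Proof. by rewrite fmorph_rat. Qed.

Variables (F : fieldExtType rat) (iota : {rmorphism F -> R[i]}) (P : set (R[i] * R[i])).
Variables (fr : frame R) (b0 : R[i]) (r : int).
Hypotheses (fr_gt0 : 0 < Im (tau fr)) (b0R : Re b0 = 0) (b0I : 0 < Im b0) (r1 : 1 <= r).
Hypothesis hP : forall m b, P (m, b) -> b + b^* = m * m^*.

Let lm : R := lam b0 r.

(** psi (m) is exp (2 pi i lambda Im beta). *)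
Lemma psi_valE (m z : R[i]) : psi_val P b0 r m z -> exists2 b, P (m, b) & z = e2 (toC (lm * Im b)).
Proof.
move=> [b Pb ->]; exists b => //; rewrite /e2 -mulrA; congr (cexp (_ * _)).
by rewrite -(rmorph_int toC) -rmorphM /lm /lam; congr toC; ring.
Qed.

Definition theta_comb (mu : nat) (rho sg : R) (x : 'I_mu -> R[i]) (u : R[i]) : R[i] :=
  \sum_(k < mu) x k * theta_fun fr mu (toC (rho + k%:R / mu%:R)) (toC sg) u.

(** A rational section as a combination of theta functions with real parameters,
    the characters at the two periods being written as conditions modulo 1. *)
Lemma rational_sectionP f : rational_section iota P b0 fr r f ->
  exists (mu : nat) (rho sg : rat) (x : 'I_mu -> R[i]),
    [/\ (0 < mu)%N /\ mu%:R = 2 * lm * area fr,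
        exists2 b, P (om2 fr, b) & e2 (toC (lm * Im b - mu%:R * ratr rho)) = 1,
        exists2 b, P (om1 fr, b) & e2 (toC (lm * Im b + ratr sg)) = 1,
        forall k, max_abelian iota (x k) &
        f = theta_comb (ratr rho) (ratr sg) (fun k => (hform fr (tau fr))^-1 * x k)].
Proof.
move=> [mu [rho [sg [x [muE /psi_valE[b2 P2 e2E] /psi_valE[b1 P1 e1E] hx ->]]]]].
exists mu, rho, sg, x; split=> //.
- exact: mu_area muE.
- exists b2 => //; rewrite rmorphB e2D e2N -e2E ratrC; move: (ratr rho) => y.
  have -> : cexp (2 * pii * mu%:R * toC y) = e2 (toC (mu%:R * y)).
    by rewrite /e2 rmorphM rmorph_nat; congr cexp; ring.
  exact: divff (e2_neq0 _).
- exists b1 => //; rewrite rmorphD e2D -e1E ratrC /e2 -cexpD addNr; exact: cexp0.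
- apply/funext => u; apply: eq_bigr => k _.
  have -> : ratr rho + k%:R / mu%:R = toC (ratr rho + k%:R / mu%:R).
    by rewrite ratrC; move: (ratr rho) => y; rewrite rmorphD rmorphM fmorphV !rmorph_nat.
  by rewrite ratrC mulrA (mulrC (x k)) !mulrA.
Qed.

Section Fixed_degree.
Variables (mu : nat) (rho sg : R) (x : 'I_mu -> R[i]).
Hypotheses (mu0 : (0 < mu)%N) (muA : mu%:R = 2 * lm * area fr).

Lemma theta_comb_hol : regular_hol (theta_comb rho sg x).
Proof.
apply: regular_hol_sum => k; have [df [F1 F2 F3]] := theta_fun_rdiff (rho + k%:R / mu%:R) sg fr_gt0 mu0.
by exists df.
Qed.

(** Translating rho by k / mu changes the character by an integral phase, so all
    the functions of the basis have the same one. *)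
Lemma e2_thchar_shift (k : nat) (a b : int) (y : R) :
  e2 (toC (thchar mu (rho + k%:R / mu%:R) sg a b + y)) = e2 (toC (thchar mu rho sg a b + y)).
Proof.
have m0 : mu%:R != 0 :> R by rewrite pnatr_eq0 -lt0n.
have -> : thchar mu (rho + k%:R / mu%:R) sg a b + y = thchar mu rho sg a b + y + (b * k%:Z)%:~R.
  by rewrite /thchar intrM; field.
by rewrite rmorphD e2D rmorph_int e2_int mulr1.
Qed.

Lemma theta_comb_shift (a b : int) (beta u m : R[i]) :
  m = a%:~R * om1 fr + b%:~R * om2 fr -> beta + beta^* = m * m^* ->
  theta_comb rho sg x (u + m) = theta_comb rho sg x u *
    cexp (toC (2 * pi * lm) * (m^* * u + beta)) * e2 (toC (thchar mu rho sg a b - lm * Im beta)).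
Proof.
move=> mE hb; rewrite /theta_comb !mulr_suml; apply: eq_bigr => k _.
rewrite (theta_fun_shift fr_gt0 _ _ mu0 muA u mE hb) e2_thchar_shift; ring.
Qed.

Lemma theta_comb_auto (a b : int) (beta u m : R[i]) :
  m = a%:~R * om1 fr + b%:~R * om2 fr -> P (m, beta) ->
  e2 (toC (thchar mu rho sg a b - lm * Im beta)) = 1 ->
  theta_comb rho sg x (u + m) = theta_comb rho sg x u * cexp (2 * pii * r%:~R / b0 * (m^* * u + beta)).
Proof.
by move=> mE /hP hb h; rewrite (theta_comb_shift u mE hb) h mulr1 factorE.
Qed.

(** Conversely, automorphy at a point where the combination does not vanish
    determines its character. *)
Lemma theta_comb_char (a b : int) (beta m u : R[i]) :
  m = a%:~R * om1 fr + b%:~R * om2 fr -> P (m, beta) ->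
  automorphic P b0 r (theta_comb rho sg x) -> theta_comb rho sg x u != 0 ->
  e2 (toC (thchar mu rho sg a b - lm * Im beta)) = 1.
Proof.
move=> mE Pm aut u0; have := aut m beta u Pm.
rewrite (theta_comb_shift u mE (hP Pm)) factorE//.
set w := theta_comb _ _ _ _ * cexp _ => h.
have w0 : w != 0 by rewrite mulf_neq0// cexp_neq0.
by apply: (mulfI w0); rewrite h mulr1.
Qed.

End Fixed_degree.
End Theta_sections.

(** * Transforms of sections *)

Section Transforms.
Variables (R : realType) (F : fieldExtType rat) (iota : {rmorphism F -> R[i]}).
Local Notation toC := (real_complex R).
Local Notation MA := (max_abelian iota).
Let pF : [pchar F] =i pred0 := @fieldExt_pchar0 F.
Variables (P P' : set (R[i] * R[i])) (b0 : R[i]).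
Hypotheses (b0R : Re b0 = 0) (b0I : 0 < Im b0).
Hypothesis PP' : forall m b, P' (m, b) <-> P (m^*%C, b).

Lemma conjE (z : R[i]) : Num.conj z = z^*%C. Proof. by []. Qed.

Lemma dbarZ (c : R[i]) s : smooth s -> smooth (fun u => c * s u) /\ dbar (fun u => c * s u) = (fun u => c * dbar s u).
Proof.
move=> ss; split; first by apply: diff_upto_smooth => n; apply: diff_uptoM; [exact: diff_upto_cst|exact: smooth_diff_upto].
have C : rdiff (fun=> c) (fun=> 0) (fun=> 0).
  by move=> v r; exists 0 => // h _; rewrite !mulr0 addr0 subr0 subrr nc0 mul0r.
have [G _ _] := smooth_rdiff ss; have [ex ey] := rdiff_dxE (rdiff_mul C G).
by apply/funext => u; rewrite {1}/dbar ex ey /dbar; ring.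
Qed.

(** The d-bar operator is linear and a nonzero constant can be divided out of the
    smooth section. *)
Lemma scale_dolbeault (c : R[i]) (r : int) g : c != 0 ->
  scale_class c (dolbeault_class P' b0 r g) = dolbeault_class P' b0 r (fun u => c * g u).
Proof.
have autZ (k : R[i]) s : smooth_section P' b0 r s -> smooth_section P' b0 r (fun u => k * s u).
  move=> [s1 s2]; split; first by have [] := dbarZ k s1.
  by move=> m b u Pm; rewrite (s2 m b u Pm) mulrA.
move=> c0; apply/seteqP; split=> [h [g' [s Ss ->] <-]|h [s Ss ->]].
  exists (fun u => c * s u); first exact: autZ.
  by have [_ ->] := dbarZ c Ss.1; apply/funext => u; rewrite mulrDr.
exists (fun u => g u + dbar (fun v => c^-1 * s v) u).
  by exists (fun v => c^-1 * s v) => //; exact: autZ.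
by have [_ ->] := dbarZ c^-1 Ss.1; apply/funext => u; rewrite mulrDr mulVKf.
Qed.

Section Degree.
Variables (r : int) (phi : R[i] -> R[i]).

(** The Dolbeault representative of eta (phi), and of eta' (phi) when the roles of
    the two curves are exchanged. *)
Definition transform (u : R[i]) : R[i] :=
  - (phi (- u^*%C) * cexp (2 * pii * r%:~R / b0 * (- u^*%C) * u)).

Hypotheses (aut : automorphic P b0 r phi) (Sphi : forall n, diff_upto n phi).

Lemma transform_diff_upto n : diff_upto n transform.
Proof.
have -> : transform = fun u => (-1) * (phi (- u^*%C) * cexp (2 * pii * r%:~R / b0 * (-1) * u^*%C * u)).
  by apply/funext => u; rewrite mulN1r /transform -[- u^*%C]mulN1r !mulrA.
have Sc (c : R[i]) : diff_upto n (fun=> c) := diff_upto_cst n c.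
have Sj : diff_upto n (fun u : R[i] => u^*%C) by exact: diff_upto_conj.
apply: diff_uptoM => //; apply: diff_uptoM; first exact: diff_upto_negconj.
apply: diff_upto_cexp; apply: diff_uptoM; last exact: diff_upto_id.
by apply: diff_uptoM.
Qed.

(** The cross terms in the exponential turn the factor of automorphy of phi at
    conj m into the inverse of the one at m. *)
Lemma transform_auto : automorphic P' b0 (- r) transform.
Proof.
move=> m b u /PP' Pm; set K := 2 * pii * r%:~R / b0.
have KN : 2 * pii * (- r)%:~R / b0 = - K by rewrite /K intrN mulrN mulNr.
have cD : (u + m)^*%C = u^*%C + m^*%C by exact: rmorphD.
have := aut (- (u + m)^*%C) Pm; rewrite -/K ?conjE.
have -> : - (u + m)^*%C + m^*%C = - u^*%C by rewrite cD opprD addrNK.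
rewrite conjcK => e.
rewrite /transform -/K KN e mulNr; congr (- _).
rewrite -!(mulrA (phi _)) -!cexpD; congr (_ * cexp _).
by rewrite cD; ring.
Qed.

Lemma transform_section (c : R[i]) : smooth_section P' b0 (- r) (fun u => c * transform u).
Proof.
split.
  by apply: diff_upto_smooth => n; apply: diff_uptoM; [exact: diff_upto_cst|exact: transform_diff_upto].
by move=> m b u Pm; rewrite (transform_auto u Pm) mulrA.
Qed.

End Degree.

Variables (fr fr' : frame R).
Hypotheses (fr_gt0 : 0 < Im (tau fr)) (fr'_gt0 : 0 < Im (tau fr')).

Section Fixed_basis.
Variables (p p' q q' : int) (J : R[i]).
Hypotheses (e1 : - (om1 fr')^*%C = p%:~R * om1 fr + p'%:~R * om2 fr)
  (e2' : - (om2 fr')^*%C = q%:~R * om1 fr + q'%:~R * om2 fr)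
  (areaE' : area fr = area fr').
Hypothesis hJ : forall (mu : nat) (rho sg rho' sg' : R), (0 < mu)%N ->
    rho \in @rational R -> sg \in @rational R -> rho' \in @rational R -> sg' \in @rational R ->
    e2 (toC (sg' - thchar mu rho sg p p')) = 1 ->
    e2 (toC (mu%:R * rho' + thchar mu rho sg q q')) = 1 ->
    exists2 a, MA a & pairing_int (tau fr) (tau fr') p p' q q' mu rho sg rho' sg' = a * J.

Section Fixed_mu.
Variables (r : int) (mu : nat) (rho sg rho' sg' : rat) (x x' : 'I_mu -> R[i]).
Hypotheses (r1 : 1 <= r) (mu0 : (0 < mu)%N) (muA : mu%:R = 2 * lam b0 r * area fr).

Let mk (y : rat) (k : nat) : R := ratr y + k%:R / mu%:R.

Let mk_rational y k : mk y k \in @rational R.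
Proof.
by rewrite rationalD ?rational_ratr// rationalM ?rational_nat// rationalV ?rational_nat.
Qed.

Let th1 (k : nat) := theta_fun fr mu (toC (mk rho k)) (toC (ratr sg)).
Let th2 (j : nat) := theta_fun fr' mu (toC (mk rho' j)) (toC (ratr sg')).
Let G (k j : nat) (u : R[i]) : R[i] :=
  th1 k (- u^*%C) * cexp (2 * pii * r%:~R / b0 * (- u^*%C) * u) * th2 j u.

Let muA' : mu%:R = 2 * lam b0 r * area fr'. Proof. by rewrite -areaE'. Qed.

Let G_cell (k j : nat) (s t : R) :
  G k j (toC s * om1 fr' + toC t * om2 fr') =
  theta_twist (tau fr') mu%:R (mk rho' j) (ratr sg') s t *
  theta_twist (tau fr) mu%:R (mk rho k) (ratr sg) (p%:~R * s + q%:~R * t) (p'%:~R * s + q'%:~R * t).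
Proof.
set u := toC s * om1 fr' + _; rewrite /G /th1 /th2.
pose v := - u^*%C.
have vE : v = toC (p%:~R * s + q%:~R * t) * om1 fr + toC (p'%:~R * s + q'%:~R * t) * om2 fr.
  have -> : v = toC s * - (om1 fr')^*%C + toC t * - (om2 fr')^*%C.
    rewrite /v /u; case: (om1 fr') => a b; case: (om2 fr') => c d; apply: complexP => /=; ring.
  by rewrite e1 e2' -!(rmorph_int toC) !rmorphD !rmorphM; ring.
rewrite -/v {1}vE (theta_fun_theta_twist_lam fr_gt0 _ _ mu0 muA) -vE.
rewrite (theta_fun_theta_twist_lam fr'_gt0 _ _ mu0 muA' s t) -/u.
rewrite factorE//; set a := theta_twist _ _ _ _ _ _; set b := theta_twist _ _ _ _ _ _.
have E : cexp (toC (pi * lam b0 r) * (v * v^*%C)) * cexp (toC (2 * pi * lam b0 r) * v * u) *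
    cexp (toC (pi * lam b0 r) * (u * u^*%C)) = 1.
  rewrite -!cexpD -[RHS]cexp0; congr cexp.
  have -> : v^*%C = - u by rewrite /v; case: (u) => c d; apply: complexP => /=; ring.
  have -> : u^*%C = - v by rewrite /v opprK.
  have -> : toC (2 * pi * lam b0 r) = toC (pi * lam b0 r) + toC (pi * lam b0 r).
    by rewrite -rmorphD; congr toC; ring.
  by ring.
rewrite -[RHS]mulr1 -E; ring.
Qed.

Let G_Lip k j : Lip (G k j).
Proof.
have [df [_ _ S1]] := theta_fun_rdiff (mk rho k) (ratr sg) fr_gt0 mu0.
have [dg [_ _ S2]] := theta_fun_rdiff (mk rho' j) (ratr sg') fr'_gt0 mu0.
have := @diff_uptoM _ 0 _ _ (@diff_uptoM _ 0 _ _ (diff_upto_cst 0 (-1)) (transform_diff_upto r S1 0)) (S2 0).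
congr Lip; apply/funext => u; rewrite /G /transform /th1 /th2; ring.
Qed.

Hypotheses (MAx : forall k, MA (x k)) (MAx' : forall k, MA (x' k)).
Variables (hh hh' : R[i]).

(** The exponential factors of the two theta functions cancel the one of the
    transform, which leaves the period integral of two twisted series, one of them
    in the coordinates of - conj u.  Expand both sections in theta functions. *)
Lemma transform_pairing :
  e2 (toC (ratr sg' - thchar mu (ratr rho) (ratr sg) p p')) = 1 ->
  e2 (toC (mu%:R * ratr rho' + thchar mu (ratr rho) (ratr sg) q q')) = 1 ->
  exists2 a, MA a & cell_int (om1 fr') (om2 fr')
    (fun u => transform r (theta_comb fr (ratr rho) (ratr sg) (fun k => hh * x k)) u *
              theta_comb fr' (ratr rho') (ratr sg') (fun k => hh' * x' k) u) = a * (hh * hh' * J).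
Proof.
move=> c1 c2.
have m0 : mu%:R != 0 :> R by rewrite pnatr_eq0 -lt0n.
have ex (kj : 'I_mu * 'I_mu) : exists a, MA a /\ cell_int (om1 fr') (om2 fr') (G kj.1 kj.2) = a * J.
  have [||||||a Ma aE] := @hJ mu (mk rho kj.1) (ratr sg) (mk rho' kj.2) (ratr sg') mu0; rewrite ?mk_rational ?rational_ratr//.
  - have -> : ratr sg' - thchar mu (mk rho kj.1) (ratr sg) p p' =
      ratr sg' - thchar mu (ratr rho) (ratr sg) p p' + (- (p' * (kj.1 : nat)%:Z))%:~R.
      by rewrite /thchar /mk intrN intrM; field.
    by rewrite rmorphD e2D c1 rmorph_int e2_int mulr1.
  - have -> : mu%:R * mk rho' kj.2 + thchar mu (mk rho kj.1) (ratr sg) q q' =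
      mu%:R * ratr rho' + thchar mu (ratr rho) (ratr sg) q q' + ((kj.2 : nat)%:Z + q' * (kj.1 : nat)%:Z)%:~R.
      by rewrite /thchar /mk intrD intrM; field.
    by rewrite rmorphD e2D c2 rmorph_int e2_int mulr1.
  exists a; split=> //; rewrite -aE; apply: eq_cint => s _; apply: eq_cint => t _; exact: G_cell.
have [a ha] := choice ex.
exists (\sum_(kj : 'I_mu * 'I_mu) (- (x kj.1 * x' kj.2)) * a kj).
  apply: (max_abelian_sum pF) => kj; apply: (max_abelianM pF); last by have [] := ha kj.
  rewrite -mulN1r; apply: (max_abelianM pF); last by apply: (max_abelianM pF).
  rewrite -[-1](rmorphN1 iota); exact: max_abelian_base pF _.
rewrite mulr_suml.
transitivity (cell_int (om1 fr') (om2 fr') (fun u => \sum_(kj : 'I_mu * 'I_mu)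
    (- (hh * x kj.1 * (hh' * x' kj.2))) * G kj.1 kj.2 u)).
  congr (cell_int _ _ _); apply/funext => u; rewrite /transform /theta_comb.
  rewrite !mulr_suml -sumrN mulr_suml -(pair_bigA _ (fun k j => - (hh * x k * (hh' * x' j)) * G k j u)) /=.
  apply: eq_bigr => k _; rewrite mulr_sumr; apply: eq_bigr => j _.
  rewrite /G /th1 /th2 /mk; ring.
rewrite cell_int_sum; last first.
  by move=> kj; apply: (@diff_uptoM _ 0); [exact: (diff_upto_cst 0)|exact: G_Lip].
apply: eq_bigr => kj _; rewrite cell_intZ; last exact: G_Lip.
by rewrite (ha kj).2; ring.
Qed.

End Fixed_mu.
End Fixed_basis.
End Transforms.

(** * Rationality of the transforms *)

Section Rational_transform.
Variables (R : realType) (F : fieldExtType rat) (iota : {rmorphism F -> R[i]}).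
Local Notation toC := (real_complex R).
Local Notation MA := (max_abelian iota).
Let pF : [pchar F] =i pred0 := @fieldExt_pchar0 F.

Lemma serre_pairingE (fr : frame R) (w : R[i]) g f : serre_pairing fr w g f =
  (2 * pii)^-1 * (2 * 'i%C * (Im (om1 fr * (om2 fr)^*))%:C) *
  cell_int (om1 fr) (om2 fr) (fun u => g u * (f u * w)).
Proof. by []. Qed.

(** Up to the class of the transform, pairings are elements of the field times the
    product of J with the constants of the pairing; c inverts this product.  If it
    is zero, all the pairings are zero and c = 1 serves. *)
Lemma transform_rational (P P' : set (R[i] * R[i])) (b0 : R[i]) (fr fr' : frame R) (w' : R[i]) :
  Re b0 = 0 -> 0 < Im b0 ->
  (forall m b, P (m, b) -> b + b^*%C = m * m^*%C) ->
  (forall m b, P' (m, b) <-> P (m^*%C, b)) ->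
  frame_of P fr -> frame_of P' fr' ->
  exists2 c, c != 0 & forall r phi, 1 <= r -> hol_sections P b0 r phi ->
    rational_section iota P b0 fr r phi ->
    rational_class iota P' b0 fr' w' r
      (scale_class c (dolbeault_class P' b0 (- r) (transform b0 r phi))).
Proof.
move=> b0R b0I hP PP' [L t0 _ _] [L' t0' _ _].
have hP' m b : P' (m, b) -> b + b^*%C = m * m^*%C.
  by move=> /PP'/hP ->; case: m => x y; apply: complexP => /=; ring.
have [p [p' [q [q' [e1 e2' det aE]]]]] := basis_change t0 t0' L L' PP'.
have [J hJ] := pairing_rational iota t0 t0' det.
set o1 := om1 fr' in e1; set o2 := om2 fr' in e2'.
pose K0 : R[i] := (2 * pii)^-1 * (2 * 'i%C * toC (Im (o1 * o2^*))).
pose h := (hform fr (tau fr))^-1; pose h' := (hform fr' (tau fr'))^-1.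
pose D := K0 * (w' * (h * h' * J)).
(* D does not depend on r, and every pairing is an element of the field times c D. *)
pose c := if D == 0 then 1 else D^-1.
have c0 : c != 0 by rewrite /c; case: (eqVneq D 0) => [_|D0]; [exact: oner_neq0|rewrite invr_eq0].
have cD : MA (c * D).
  rewrite /c; case: (eqVneq D 0) => [->|D0]; first by rewrite mulr0; exact: (max_abelian_nat iota 0).
  by rewrite mulVf//; exact: (max_abelian_nat iota 1).
exists c => // r phi r1 [_ aut] /(rational_sectionP t0 b0R b0I r1)[mu [rho [sg [x [[mu0 muA] _ _ MAx phiE]]]]].
have Sphi n : diff_upto n phi by rewrite phiE; have [df [_ _ S]] := theta_comb_hol t0 (ratr rho) (ratr sg) (fun k => h * x k) mu0.
rewrite scale_dolbeault//; split.
  by exists (fun u => c * transform b0 r phi u) => //; exact: transform_section.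
move=> g f [s Ss ->] /(rational_sectionP t0' b0R b0I r1)[mu' [rho' [sg' [x' [[_ muA'] [b2 Pb2 c2] [b1 Pb1 c1] MAx' fE]]]]].
(* Both degrees are 2 lambda times the common area. *)
have em : mu' = mu by apply/eqP; rewrite -(eqr_nat R) muA' muA aE.
move: x' muA' MAx' c1 c2 fE; rewrite em => x' muA' MAx' c1 c2 fE.
have [df [Fd Ld Sf]] : regular_hol f by rewrite fE; exact: theta_comb_hol.
pose G u := transform b0 r phi u * f u.
have LG : Lip G.
  by apply: (@diff_uptoM _ 0); [exact: (transform_diff_upto b0 r Sphi 0)|exact: (Sf 0)].
have LS : Lip (fun u => f u * dbar s u).
  by apply: (@diff_uptoM _ 0); [exact: (Sf 0)|exact: Lip_dbar Ss.1].
have stokes : cell_int o1 o2 (fun u => f u * dbar s u) = 0.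
  have per m b u : P' (m, b) -> f (u + m) = f u * cexp (2 * pii * r%:~R / b0 * (m^*%C * u + b)) ->
      f (u + m) * s (u + m) = f u * s u.
    move=> Pm ->; rewrite (Ss.2 m b u Pm) mulrACA -cexpD.
    have -> : 2 * pii * r%:~R / b0 * (m^*%C * u + b) + 2 * pii * (- r)%:~R / b0 * (m^*%C * u + b) = 0.
      by rewrite intrN; ring.
    by rewrite cexp0 mulr1.
  apply: (stokes_dbar Fd Ld Ss.1).
  - move=> u; apply: (per _ _ _ Pb1); rewrite fE.
    apply: (theta_comb_auto t0' b0R b0I hP' _ mu0 muA' (a := 1) (b := 0)) => //.
      by rewrite mul1r mul0r addr0.
    rewrite -[RHS]invr1 -[in RHS]c1 -e2N -rmorphN; congr e2; congr toC.
    by rewrite /thchar; ring.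
  - move=> u; apply: (per _ _ _ Pb2); rewrite fE.
    apply: (theta_comb_auto t0' b0R b0I hP' _ mu0 muA' (a := 0) (b := 1)) => //.
      by rewrite mul1r mul0r add0r.
    rewrite -[RHS]invr1 -[in RHS]c2 -e2N -rmorphN; congr e2; congr toC.
    by rewrite /thchar; ring.
  - have := area_gt0 t0'; rewrite /area -/o1 -/o2 => A.
    rewrite (_ : _ - _ = - Im (o1 * o2^*)); first by rewrite oppr_eq0 gt_eqF.
    by case: (o1) => ? ?; case: (o2) => ? ? /=; ring.
rewrite serre_pairingE -/o1 -/o2 -/K0.
have -> : cell_int o1 o2 (fun u => (c * transform b0 r phi u + dbar s u) * (f u * w')) =
    c * w' * cell_int o1 o2 G.
  rewrite -[RHS]addr0 -[X in _ + X](mulr0 w') -stokes -!cell_intZ// -cell_intD; try exact: Lip_scale.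
  by apply: eq_cell_int => u; rewrite /G; ring.
(* The characters can be read off phi only at a point where it does not vanish. *)
have [[u0 phi0]|phi0] := pselect (exists u, phi u != 0); last first.
  have -> : cell_int o1 o2 G = 0.
    rewrite -[RHS](cell_int0 o1 o2); apply: eq_cell_int => u; rewrite /G /transform.
    case: (eqVneq (phi (- u^*%C)) 0) => [->|n0]; first by rewrite mul0r oppr0 mul0r.
    by case: phi0; eexists; exact: n0.
  by rewrite !mulr0; exact: (max_abelian_nat iota 0).
rewrite phiE in aut phi0.
have char m b (i j : int) : P' (m, b) -> - m^*%C = i%:~R * om1 fr + j%:~R * om2 fr ->
    e2 (toC (thchar mu (ratr rho) (ratr sg) (- i) (- j) - lam b0 r * Im b)) = 1.
  move=> /PP' Pm mE; apply: (theta_comb_char t0 b0R b0I hP mu0 muA _ Pm aut phi0).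
  by rewrite !rmorphN /= !mulNr -opprD -mE opprK.
have int1 (y : R) (n : int) : e2 (toC (y + n%:~R)) = e2 (toC y).
  by rewrite rmorphD e2D rmorph_int e2_int mulr1.
have k1 : e2 (toC (ratr sg' - thchar mu (ratr rho) (ratr sg) p p')) = 1.
  have k := char _ _ _ _ Pb1 e1.
  have -> : ratr sg' - thchar mu (ratr rho) (ratr sg) p p' = (lam b0 r * Im b1 + ratr sg') +
      (thchar mu (ratr rho) (ratr sg) (- p) (- p') - lam b0 r * Im b1) + (mu%:Z * p * p')%:~R.
    by rewrite /thchar !rmorphN !intrM; field.
  by rewrite int1 rmorphD e2D c1 k mulr1.
have k2 : e2 (toC (mu%:R * ratr rho' + thchar mu (ratr rho) (ratr sg) q q')) = 1.
  have k := char _ _ _ _ Pb2 e2'.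
  have -> : mu%:R * ratr rho' + thchar mu (ratr rho) (ratr sg) q q' = - ((lam b0 r * Im b2 - mu%:R * ratr rho') +
      (thchar mu (ratr rho) (ratr sg) (- q) (- q') - lam b0 r * Im b2)) + (- (mu%:Z * q * q'))%:~R.
    by rewrite /thchar !intrN !intrM; field.
  by rewrite int1 rmorphN e2N rmorphD e2D c2 k mulr1 invr1.
have [al Mal alE] := transform_pairing b0R b0I t0 t0' e1 e2' aE hJ mu0 muA MAx MAx' h h' k1 k2.
have -> : cell_int o1 o2 G = al * (h * h' * J) by rewrite -alE /G phiE fE.
have -> : K0 * (c * w' * (al * (h * h' * J))) = al * (c * D) by rewrite /D; ring.
exact: max_abelianM.
Qed.

End Rational_transform.

(** * The pairs attached to the two curves *)

Section Heisenberg_pairs.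
Variables (R : realType) (F : fieldExtType rat) (iota : {rmorphism F -> R[i]}).
Variable Gamma : set 'M[R[i]]_3.

Lemma unip_inj (a b a' b' : R[i]) : unip a b = unip a' b' -> a = a' /\ b = b'.
Proof.
move=> /matrixP h; have := h 0 1; have := h 0 (inord 2); rewrite !mxE /= !inordK//.
Qed.

Lemma pairs_E'_norm m b : pairs_E' iota Gamma (m, b) -> b + b^*%C = m * m^*%C.
Proof. by move=> [_ [a [b' [_ _ h /= /unip_inj[-> ->]]]]]. Qed.

Lemma pairs_conj m b : pairs_E' iota Gamma (m, b) <-> pairs_E iota Gamma (m^*%C, b).
Proof. by rewrite /pairs_E /pairs_E' /= conjcK. Qed.

Lemma pairs_E_norm m b : pairs_E iota Gamma (m, b) -> b + b^*%C = m * m^*%C.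
Proof.
move=> h; have /pairs_E'_norm -> : pairs_E' iota Gamma (m^*%C, b) by exact: h.
by case: m {h} => x y; apply: complexP => /=; ring.
Qed.

End Heisenberg_pairs.

Theorem mainTheorem3 (R : realType) (F : fieldExtType rat)
    (iota : {rmorphism F -> R[i]}) (hF : imaginary_quadratic iota) :
  exists2 N0 : nat, (0 < N0)%N &
  forall (Gamma : set 'M[R[i]]_3),
    congruence_subgroup iota Gamma ->
    Gamma `<=` principal_congruence iota N0 ->
  forall (b0 : R[i]), is_beta0 Gamma b0 ->
  let E := pairs_E iota Gamma in
  let E' := pairs_E' iota Gamma in
  forall (fr fr' : frame R) (w w' : R[i]),
    frame_of E fr -> frame_of E' fr' ->
    rational_differential iota E b0 fr w -> w != 0 ->
    rational_differential iota E' b0 fr' w' -> w' != 0 ->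
  exists c c' : R[i],
    [/\ c != 0, c' != 0 &
    forall r : int, 1 <= r ->
      (forall phi, hol_sections E b0 r phi ->
         rational_section iota E b0 fr r phi ->
         rational_class iota E' b0 fr' w' r
           (scale_class c (eta_map E' b0 r phi))) /\
      (forall phi', hol_sections E' b0 r phi' ->
         rational_section iota E' b0 fr' r phi' ->
         rational_class iota E b0 fr w r
           (scale_class c' (eta'_map E b0 r phi')))].
Proof.
exists 1%N => // Gamma _ _ b0 [b0R b0I _ _] E E' fr fr' w w' hfr hfr' _ _ _ _.
have [c c0 hc] := transform_rational iota w' b0R b0I (@pairs_E_norm _ _ iota Gamma)
  (@pairs_conj _ _ iota Gamma) hfr hfr'.
have [c' c0' hc'] := transform_rational iota w b0R b0I (@pairs_E'_norm _ _ iota Gamma)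
  (fun m b => iff_refl (E (m, b))) hfr' hfr.
exists c, c'; split=> // r r1; split=> phi hphi rphi; first exact: hc.
rewrite /eta'_map (_ : dolbeault1 _ = transform b0 r phi); first exact: hc'.
by apply/funext => z; rewrite /dolbeault1 /eta'_form /transform mulrAC.
Qed.
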